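(* The complete graph $K_7$ is intrinsically chiral.
   Context: Embeddings of (finite) graphs in $S^3$ are tame. A graph embedded in $S^3$ is achiral if there is an orientation reversing homeomorphism of $S^3$ that takes the embedded graph to itself setwise (edge labels and edge orientations are disregarded); otherwise it is chiral. An abstract graph is intrinsically chiral if every embedding of the graph in $S^3$ is chiral. *)

(* Defs.v *)
From HB Require Import structures.
From mathcomp.multinomials Require Import freeg.
From mathcomp Require Import all_boot all_order all_algebra.
From mathcomp Require Import all_classical all_reals all_analysis.

Set Implicit Arguments.
Unset Strict Implicit.
Unset Printing Implicit Defensive.

Import Order.TTheory GRing.Theory Num.Theory.
Import numFieldNormedType.Exports.

Local Open Scope classical_set_scope.
Local Open Scope ring_scope.

Definition homeomorphism (X Y : topologicalType) (f : continuousType X Y) :=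
  exists g : continuousType Y X, cancel f g /\ cancel g f.

(* An injection inducing on X the subspace topology of its image, that is, a
   homeomorphism onto the image. *)
Definition embedding (X Y : topologicalType) (f : X -> Y) :=
  [/\ injective f, continuous f
    & forall U : set X, open U -> exists2 V : set Y, open V & f @^-1` V = U].

Definition S3_set (R : realType) : set 'rV[R]_4 :=
  [set x | \sum_i x 0 i ^+ 2 = 1].

Definition S3 (R : realType) : topologicalType := set_type (@S3_set R).

Definition simplex_set (R : realType) (n : nat) : set 'rV[R]_n.+1 :=
  [set x | (forall i, 0 <= x 0 i) /\ \sum_i x 0 i = 1].

Definition simplex (R : realType) (n : nat) : topologicalType :=
  set_type (@simplex_set R n).

(* In barycentric coordinates, the i-th coface inserts a zero at position i. *)
Definition coface_row (R : realType) (n : nat) (i : 'I_n.+2)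
    (x : 'rV[R]_n.+1) : 'rV[R]_n.+2 :=
  \row_j (if unlift i j is Some k then x 0 k else 0).

Lemma coface_row_simplex (R : realType) (n : nat) (i : 'I_n.+2)
    (x : simplex R n) : coface_row i (set_val x) \in @simplex_set R n.+1.
Proof.
have [x0 x1] := set_valP x; apply/mem_set; split => [j|].
  by rewrite mxE; case: unlift.
rewrite (bigD1_ord i) //= mxE unlift_none add0r -[RHS]x1.
by apply: eq_bigr => j _; rewrite mxE liftK.
Qed.

Definition coface (R : realType) (n : nat) (i : 'I_n.+2) (x : simplex R n) :
  simplex R n.+1 :=
  exist (fun y => y \in @simplex_set R n.+1) _ (coface_row_simplex i x).

Lemma coface_row_continuous (R : realType) (n : nat) (i : 'I_n.+2) :
  continuous (@coface_row R n i).
Proof.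
move=> x U [P Px PU]; exists (fun _ k => P 0 (lift i k)) => [a k|y Py].
  by rewrite ord1; have := Px 0 (lift i k); rewrite mxE liftK.
apply: PU => a j; rewrite ord1 mxE; case: unliftP => [k ->|ji]; first exact: Py.
by have := nbhs_singleton (Px 0 j); rewrite mxE ji unlift_none.
Qed.

Lemma coface_continuous (R : realType) (n : nat) (i : 'I_n.+2) :
  continuous (@coface R n i).
Proof.
apply/continuous_comp_initial => x.
apply: (@continuous_comp _ _ _ set_val (@coface_row R n i)).
  exact: initial_continuous.
exact: coface_row_continuous.
Qed.

HB.instance Definition _ (R : realType) (n : nat) (i : 'I_n.+2) :=
  @isContinuous.Build _ _ (@coface R n i) (@coface_continuous R n i).

Definition singular_chain (R : realType) (n : nat) (X : topologicalType) :=
  {freeg (continuousType (simplex R n) X) / int}.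

Definition face (R : realType) (n : nat) (X : topologicalType) (i : 'I_n.+2)
    (s : continuousType (simplex R n.+1) X) : continuousType (simplex R n) X :=
  s \o @coface R n i.

Definition boundary (R : realType) (n : nat) (X : topologicalType) :
    singular_chain R n.+1 X -> singular_chain R n X :=
  fglift (fun s => \sum_(i < n.+2) << (-1) ^+ i *g face i s >>).

Definition push (R : realType) (n : nat) (X Y : topologicalType)
    (h : continuousType X Y) (s : continuousType (simplex R n) X) :
    continuousType (simplex R n) Y := h \o s.

Definition chain_map (R : realType) (n : nat) (X Y : topologicalType)
    (h : continuousType X Y) :
    singular_chain R n X -> singular_chain R n Y :=
  fglift (fun s => << push h s >>).

(* Degree -1: since H_3(S^3; Z) = Z, this says h_*[z] = -[z] for each class. *)
Definition orientation_reversing (R : realType)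
    (h : continuousType (S3 R) (S3 R)) :=
  forall z : singular_chain R 3 (S3 R), boundary z = 0 ->
    exists w : singular_chain R 4 (S3 R), boundary w = chain_map h z + z.

Record graph := Graph {
  vertex :> finType;
  adj : rel vertex;
  adj_sym : symmetric adj;
  adj_irr : irreflexive adj }.

Lemma neq_sym (T : eqType) : symmetric (fun x y : T => x != y).
Proof. by move=> x y; rewrite eq_sym. Qed.

Lemma neq_irr (T : eqType) : irreflexive (fun x y : T => x != y).
Proof. by move=> x; rewrite eqxx. Qed.

Definition complete_graph (n : nat) : graph :=
  Graph (@neq_sym 'I_n) (@neq_irr 'I_n).

(* Barycentric coordinates: the points of the simplex spanned by the vertices
   whose support lies in a vertex (v = w) or in an edge. *)
Definition realization_set (R : realType) (G : graph) : set {ptws G -> R} :=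
  [set x | [/\ forall v, 0 <= x v, \sum_v x v = 1
    & exists v w, (v = w \/ adj v w) /\
        forall u, x u != 0 -> u = v \/ u = w]].

Definition realization (R : realType) (G : graph) : topologicalType :=
  set_type (@realization_set R G).

(* The minor great-circle arc between p and q, for p and q not antipodal. *)
Definition geodesic_arc (R : realType) (p q : S3 R) : set (S3 R) :=
  [set x | exists a b : R, [/\ 0 <= a, 0 <= b
    & set_val x = a *: set_val p + b *: set_val q]].

Definition polygonal (R : realType) (A : set (S3 R)) :=
  exists s : seq (S3 R * S3 R),
    (forall pq, pq \in s -> set_val pq.1 != - set_val pq.2) /\
    A = [set x | exists2 pq, pq \in s & geodesic_arc pq.1 pq.2 x].

Definition tame (R : realType) (A : set (S3 R)) :=
  exists2 h : continuousType (S3 R) (S3 R),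
    homeomorphism h & polygonal (h @` A).

Definition achiral (R : realType) (A : set (S3 R)) :=
  exists h : continuousType (S3 R) (S3 R),
    [/\ homeomorphism h, orientation_reversing h & h @` A = A].

Definition chiral (R : realType) (A : set (S3 R)) := ~ achiral A.

Definition intrinsically_chiral (R : realType) (G : graph) :=
  forall f : realization R G -> S3 R,
    embedding f -> tame (range f) -> chiral (range f).

(* Main.v *)
(* Let h be an orientation-reversing homeomorphism of S^3 preserving the image of an
   embedding f of K_7. A self-embedding of a complete graph permutes its vertices and
   its edges, so h induces a permutation phi of the vertices.

   For disjoint edges e and e', the map (x, y) |-> f x - f y, made homogeneous of degree
   one, has no zero on the join of e and e', and one counts how often a fine
   subdivision of this join crosses a generic ray from the origin of R^4. The sum of
   these integers over the pairs of edges of two disjoint triangles T and T' is a degree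
   lk(T, T') of the join of T and T' into R^4 minus the origin. Every homotopy without
   zeros preserves it and h negates it, whence lk(phi T, phi T') = - lk(T, T').

   Exchanging x and y is the antipodal map in the target, and acts freely on the deleted
   join of K_5. Pushing the parity of the crossing number of this complex down a
   symmetric filtration to a single vertex shows that it is odd. This gives the
   Conway-Gordon theorem: in every K_6, the ten numbers lk(T, T') have an odd sum.

   Replacing phi by phi^105 leaves all this true and makes phi^4 = 1. The parity of lk is
   constant along phi-orbits of pairs of triangles, and lk = 0 on a pair that phi fixes
   with its sign. A sum of an odd number of Conway-Gordon relations in which each other
   orbit occurs an even number of times, found for each phi by computation, is then a
   contradiction. *)
Require Import Defs.
From HB Require Import structures.
From mathcomp.multinomials Require Import freeg.
From mathcomp Require Import all_boot all_order all_algebra.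
From mathcomp Require Import all_classical all_reals all_analysis.
From mathcomp Require Import ring lra zify.

Set Implicit Arguments.
Unset Strict Implicit.
Unset Printing Implicit Defensive.

Import Order.TTheory GRing.Theory Num.Theory.
Import numFieldNormedType.Exports.

Local Open Scope classical_set_scope.
Local Open Scope ring_scope.

(** * Cochains and barycentric subdivision *)

(** No homology group of the sphere is computed. Chains are lists of points, cochains are arbitrary
    integer functions on such lists, and identities between them become exact only after a fine
    subdivision. The obstacle is the order of choices: [winding] behaves as a cocycle on lists whose
    convex hull misses the origin, and it depends on a flag [t] of coordinates. Hence every homotopy
    or boundary argument yields a bound [K] that serves all [t] with distinct nodes; finitely many
    bounds are joined, [k] is fixed, and only then is [t] chosen generic for the finitely many
    points of the [k]-th subdivision. Genericity serves the antipodal arguments, which compare a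
    simplex with its negative in all lower dimensions. Linking numbers have to be integers, not
    residues: a pair fixed with its sign has lk = - lk, which says nothing modulo 2. *)

Section Cochains.
Variable V : Type.
Implicit Types (t s : seq V -> int) (v w : seq V).

(** The simplicial coboundary: the recursion keeps the head in all later faces, and the minus sign
    in front of it alternates the signs. The only face of a single vertex is the empty list. *)
Fixpoint cobd t v : int :=
  if v is a :: v' then t v' - cobd (fun w => t (a :: w)) v' else 0.

Fixpoint faces v : seq (seq V) :=
  if v is a :: v' then v' :: map (cons a) (faces v') else [::].

Lemma cobdD t s v : cobd (fun w => t w + s w) v = cobd t v + cobd s v.
Proof. by elim: v t s => [|a v IH] t s /=; rewrite ?addr0 ?IH //; ring. Qed.

Lemma cobdN t v : cobd (fun w => - t w) v = - cobd t v.
Proof. by elim: v t => [|a v IH] t /=; rewrite ?oppr0 ?IH //; ring. Qed.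

Lemma cobdB t s v : cobd (fun w => t w - s w) v = cobd t v - cobd s v.
Proof. by rewrite cobdD cobdN. Qed.

Lemma cobd0 v : cobd (fun=> 0) v = 0.
Proof. by elim: v => //= a v ->; rewrite subr0. Qed.

Lemma cobdZ (c : int) t v : cobd (fun w => c * t w) v = c * cobd t v.
Proof. by elim: v t => [|a v IH] t /=; rewrite ?mulr0 ?IH //; ring. Qed.

Lemma cobd_cobd t v : cobd (cobd t) v = 0.
Proof.
elim: v t => [|a v IH] t //=.
by rewrite cobdB IH subr0 subrr.
Qed.

End Cochains.

Lemma cobd_map (V W : Type) (f : V -> W) (t : seq W -> int) v :
  cobd t (map f v) = cobd (fun w => t (map f w)) v.
Proof. by elim: v t => [|a v IH] t //=; rewrite IH. Qed.

Lemma cobd_eq_in (V : eqType) (t s : seq V -> int) v :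
  {in faces v, t =1 s} -> cobd t v = cobd s v.
Proof.
elim: v t s => [|a v IH] t s //= H; congr (_ - _).
  by apply: H; rewrite inE eqxx.
by apply: IH => w wv; apply: H; rewrite inE map_f ?orbT.
Qed.

Lemma size_faces (V : eqType) (v w : seq V) : w \in faces v -> size v = (size w).+1.
Proof.
elim: v w => [|a v IH] w //=; rewrite inE => /orP [/eqP -> //|].
by case/mapP => u uv ->; rewrite (IH u).
Qed.

Lemma faces_sub (V : eqType) (v w : seq V) : w \in faces v -> {subset w <= v}.
Proof.
elim: v w => [|a v IH] w //=; rewrite inE => /orP [/eqP -> |].
  by move=> x xv; rewrite inE xv orbT.
case/mapP => u uv -> x; rewrite !inE => /orP [->//|/(IH _ uv) ->].
by rewrite orbT.
Qed.

Lemma cobd_eq_size (V : Type) (t s : seq V -> int) n v :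
  size v = n.+1 -> (forall w, size w = n -> t w = s w) -> cobd t v = cobd s v.
Proof.
elim: v n t s => [|a v IH] n t s //= [sv] H; congr (_ - _); first exact: H.
case: n sv H => [/size0nil -> //|n sv H].
by apply: (IH n) => // w sw; apply: H; rewrite /= sw.
Qed.

Section Alternation.
Variable V : Type.
Implicit Types (t : seq V -> int).

Definition alternating n t := forall a b v1 v2,
  (size v1 + size v2).+2 = n -> t (v1 ++ a :: b :: v2) = - t (v1 ++ b :: a :: v2).

(** The faces that keep both [a] and [b] change sign because [t] alternates; the two faces that omit
    one of them are exchanged, and they carry opposite signs. *)
Lemma cobd_alternating n t : alternating n t -> alternating n.+1 (cobd t).
Proof.
move=> At a b v1 v2; elim: v1 n t At => [|c v1 IH] n t At /= [e].
  suff: cobd (fun w => t [:: a, b & w]) v2 = - cobd (fun w => t [:: b, a & w]) v2.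
    by move=> ->; ring.
  rewrite -cobdN; case: v2 e => // c v2 e; apply: (@cobd_eq_size _ _ _ (size v2)) => //.
  by move=> w sw; apply: (At a b [::] w); rewrite -e sw.
rewrite (At a b v1 v2) // (IH n.-1 (fun w => t (c :: w))) -?e //=; first by ring.
by move=> a' b' u1 u2 es; apply: (At _ _ (c :: u1)) => /=; rewrite -e -es.
Qed.

End Alternation.

Section Subdivision.
Variables (R : realFieldType) (V : lmodType R).
Implicit Types (t s : seq V -> int) (v w : seq V).

Definition bary v : V := (size v)%:R^-1 *: \sum_(x <- v) x.

(* Dual to barycentric subdivision of chains: the value of the [n]-cochain [t] on the
   subdivided simplex [v]. *)
Fixpoint subdiv n t v : int :=
  if n is n'.+1 then cobd (subdiv n' (fun w => t (bary v :: w))) v else t v.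

Fixpoint subdivs n v : seq (seq V) :=
  if n is n'.+1 then
    [seq bary v :: u | u <- flatten [seq subdivs n' w | w <- faces v]]
  else [:: v].

Lemma subdivB n t s v : subdiv n (fun w => t w - s w) v = subdiv n t v - subdiv n s v.
Proof.
elim: n t s v => //= n IH t s v; rewrite -cobdB; congr cobd.
by apply/funext => w; rewrite IH.
Qed.

Lemma subdivZ n c t v : subdiv n (fun w => c * t w) v = c * subdiv n t v.
Proof.
elim: n t v => //= n IH t v; rewrite -cobdZ; congr cobd.
by apply/funext => w; rewrite IH.
Qed.

(** Subdivision is a chain map: the boundary of the cone from [bary v] over the subdivided boundary
    is that boundary minus the cone over its own boundary, and the latter vanishes by
    [cobd_cobd]. *)
Lemma subdiv_cobd n t v : subdiv n.+1 (cobd t) v = cobd (subdiv n t) v.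
Proof.
elim: n t v => [|n IH] t v.
  by rewrite /= cobdB cobd_cobd subr0.
rewrite [LHS]/=.
have -> : (fun w => subdiv n.+1 (fun u => t u - cobd (fun u' => t (bary v :: u')) u) w)
   = (fun w => subdiv n.+1 t w - cobd (subdiv n (fun u' => t (bary v :: u'))) w).
  by apply/funext => w; rewrite subdivB IH.
by rewrite cobdB cobd_cobd subr0.
Qed.

Lemma subdiv_eq n t s v :
  {in subdivs n v, t =1 s} -> subdiv n t v = subdiv n s v.
Proof.
elim: n t s v => [|n IH] t s v /= H; first by apply: H; rewrite inE.
apply: cobd_eq_in => w wv; apply: IH => u uw; apply: H; apply: map_f.
by apply/flatten_mapP; exists w.
Qed.

Lemma bary_swap a b v1 v2 : bary (v1 ++ a :: b :: v2) = bary (v1 ++ b :: a :: v2).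
Proof.
by rewrite /bary !size_cat !big_cat /= !big_cons; congr (_ *: (_ + _)); rewrite addrCA.
Qed.

(** No symmetry of [t] is assumed: the barycentre ignores the order of the vertices, and [cobd]
    supplies the sign. One subdivision thus makes [winding] alternating. *)
Lemma subdiv_alternating n t : (0 < n)%N -> alternating n.+1 (subdiv n t).
Proof.
elim: n t => // n IH t _ a b v1 v2 e; rewrite /= bary_swap.
move: (fun w : seq V => _) => t'; case: n IH e => [|n] IH e.
  by case: v1 v2 e => [|c v1] [|d v2]; rewrite /= ?addnS //= => _; ring.
by apply: (@cobd_alternating _ n.+2 (subdiv n.+1 t')) => //; apply: IH.
Qed.

Definition subdivk n k t := iter k (subdiv n) t.

Fixpoint subdivks n k v : seq (seq V) :=
  if k is k'.+1 then flatten [seq subdivks n k' w | w <- subdivs n v] else [:: v].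

Lemma subdivk_cobd n k t : subdivk n.+1 k (cobd t) = cobd (subdivk n k t).
Proof.
elim: k => // k IH; rewrite /subdivk !iterS -!/(subdivk _ _ _) IH.
by apply/funext => v; rewrite subdiv_cobd.
Qed.

Lemma subdivkB n k t s :
  subdivk n k (fun w => t w - s w) = (fun v => subdivk n k t v - subdivk n k s v).
Proof. by elim: k => //= k ->; apply/funext => v; rewrite subdivB. Qed.

Lemma subdivkZ n k c t : subdivk n k (fun w => c * t w) = (fun v => c * subdivk n k t v).
Proof. by elim: k => //= k ->; apply/funext => v; rewrite subdivZ. Qed.

Lemma subdivk_eq n k t s v :
  {in subdivks n k v, t =1 s} -> subdivk n k t v = subdivk n k s v.
Proof.
elim: k v => [|k IH] v /= H; first by apply: H; rewrite inE.
apply: subdiv_eq => w wv; apply: IH => u uw; apply: H.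
by apply/flatten_mapP; exists w.
Qed.

Definition bary_closed (C : set V) :=
  forall v, (0 < size v)%N -> (forall x, x \in v -> C x) -> C (bary v).

Lemma size_subdivs n v w : size v = n.+1 -> w \in subdivs n v -> size w = n.+1.
Proof.
elim: n v w => [|n IH] v w /= sv; first by rewrite inE => /eqP ->.
case/mapP => u /flatten_mapP [f fv uf] ->.
by move: (size_faces fv); rewrite sv => -[sf] /=; rewrite (IH f).
Qed.

Lemma size_subdivks n k v w : size v = n.+1 -> w \in subdivks n k v -> size w = n.+1.
Proof.
elim: k v => [|k IH] v /= sv; first by rewrite inE => /eqP ->.
by case/flatten_mapP => u /(size_subdivs sv) su; exact: IH.
Qed.

Lemma subdivs_closed (C : set V) n v w : bary_closed C -> size v = n.+1 ->
  (forall x, x \in v -> C x) -> w \in subdivs n v -> forall x, x \in w -> C x.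
Proof.
move=> CC; elim: n v w => [|n IH] v w /= sv Cv; first by rewrite inE => /eqP ->.
case/mapP => u /flatten_mapP [f fv uf] -> x; rewrite inE => /orP [/eqP ->|].
  by apply: CC; rewrite ?sv.
move: (size_faces fv); rewrite sv => -[sf].
by apply: (IH f) => // y yf; apply: Cv; exact: (faces_sub fv).
Qed.

Lemma subdivks_closed (C : set V) n k v w : bary_closed C -> size v = n.+1 ->
  (forall x, x \in v -> C x) -> w \in subdivks n k v -> forall x, x \in w -> C x.
Proof.
move=> CC; elim: k v => [|k IH] v /= sv Cv; first by rewrite inE => /eqP ->.
case/flatten_mapP => u uv; apply: IH; first exact: size_subdivs uv.
exact: subdivs_closed uv.
Qed.

End Subdivision.

Section SubdivisionMap.
Variables (R : realFieldType) (V W : lmodType R) (A : V -> W).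
Hypothesis A_bary : forall v, A (bary v) = bary (map A v).

Lemma subdiv_map n (t : seq W -> int) v :
  subdiv n t (map A v) = subdiv n (fun w => t (map A w)) v.
Proof.
elim: n t v => //= n IH t v; rewrite cobd_map; congr cobd.
by apply/funext => w; rewrite IH /= A_bary.
Qed.

Lemma subdivk_map n k (t : seq W -> int) v :
  subdivk n k t (map A v) = subdivk n k (fun w => t (map A w)) v.
Proof.
elim: k v => //= k IH v; rewrite subdiv_map; congr subdiv.
by apply/funext => w; rewrite IH.
Qed.

End SubdivisionMap.

(** * Mesh of iterated subdivisions *)

Section Mesh.
Variables (R : realType) (V : normedModType R).

Definition pairwise_le (r : R) (v : seq V) :=
  forall x y, x \in v -> y \in v -> `|x - y| <= r.

Lemma ball_bary_closed (C : set V) (c : V) (r : R) : bary_closed C ->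
  bary_closed (C `&` [set x | `|c - x| <= r]).
Proof.
move=> CC v v0 Cv; split; first by apply: CC => // x /Cv [].
have n0 : (0 : R) < (size v)%:R by rewrite ltr0n.
rewrite /=; have -> : c - bary v = (size v)%:R^-1 *: \sum_(x <- v) (c - x).
  rewrite /bary sumrB scalerBr big_const_seq count_predT iter_addr_0.
  by rewrite -[c *+ _]scaler_nat scalerA mulVf ?scale1r // gt_eqF.
rewrite normrZ ger0_norm ?invr_ge0 ?ler0n // mulrC ler_pdivrMr //.
apply: le_trans (ler_norm_sum _ _ _) _.
rewrite big_seq; apply: (@le_trans _ _ (\sum_(x <- v | x \in v) r)).
  by apply: ler_sum => x /Cv [].
by rewrite -big_seq big_const_seq count_predT iter_addr_0 mulr_natr.
Qed.

(** In the average of the differences [x - y] the term [y = x] is zero, which leaves [n] terms over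
    [n.+1]. *)
Lemma bary_dist n (v : seq V) (r : R) x : size v = n.+1 -> pairwise_le r v ->
  x \in v -> `|bary v - x| <= n%:R / n.+1%:R * r.
Proof.
move=> sv vr xv; rewrite distrC.
have n0 : (0 : R) < n.+1%:R by rewrite ltr0n.
have -> : x - bary v = (size v)%:R^-1 *: \sum_(y <- rem x v) (x - y).
  have -> : \sum_(y <- rem x v) (x - y) = \sum_(y <- v) (x - y).
    by rewrite [RHS](perm_big _ (perm_to_rem xv)) big_cons /= subrr add0r.
  rewrite /bary sumrB scalerBr big_const_seq count_predT iter_addr_0.
  by rewrite -[x *+ _]scaler_nat scalerA mulVf ?scale1r // sv gt_eqF.
rewrite normrZ sv ger0_norm ?invr_ge0 ?ler0n // [_ / _]mulrC -mulrA.
rewrite ler_pM2l ?invr_gt0 //.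
apply: le_trans (ler_norm_sum _ _ _) _.
rewrite big_seq; apply: (@le_trans _ _ (\sum_(y <- rem x v | y \in rem x v) r)).
  by apply: ler_sum => y /mem_rem yv; exact: vr.
by rewrite -big_seq big_const_seq count_predT iter_addr_0 size_rem // sv mulr_natl.
Qed.

(** Edges at the new barycentre are bounded by [bary_dist]; all others lie in a subdivided face of
    lower dimension, where the factor is smaller still. *)
Lemma subdivs_mesh n (v w : seq V) (r : R) : size v = n.+1 -> 0 <= r ->
  pairwise_le r v -> w \in subdivs n v -> pairwise_le (n%:R / n.+1%:R * r) w.
Proof.
elim: n v w => [|n IH] v w sv r0 vr /=.
  rewrite inE => /eqP ->; case: v sv {vr} => [|a []] // _ x y.
  by rewrite !inE => /eqP -> /eqP ->; rewrite subrr normr0 mul0r mul0r.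
case/mapP => u /flatten_mapP [f fv uf] ->.
set q := n.+1%:R / _ * r.
have q0 : 0 <= q by rewrite !mulr_ge0 ?invr_ge0 ?ler0n.
move: (size_faces fv); rewrite sv => -[sf].
have ub x : x \in u -> `|bary v - x| <= q.
  have TC : bary_closed (setT `&` [set x : V | `|bary v - x| <= q]).
    by apply: ball_bary_closed.
  move=> xu; have Cf y : y \in f -> (setT `&` [set x : V | `|bary v - x| <= q]) y.
    by move=> yf; split => //=; apply: bary_dist => //; exact: (faces_sub fv).
  by case: (subdivs_closed TC (esym sf) Cf uf xu).
have uq : pairwise_le q u.
  move=> x y xu yu; apply: le_trans (IH f u (esym sf) r0 _ uf x y xu yu) _.
    by move=> a b af bf; apply: vr; exact: (faces_sub fv).
  apply: ler_wpM2r => //; rewrite ler_pdivrMr ?ltr0n // mulrAC ler_pdivlMr ?ltr0n //.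
  by rewrite -!natrM ler_nat; lia.
move=> x y; rewrite !inE => /orP[/eqP ->|xu] /orP[/eqP ->|yu].
- by rewrite subrr normr0.
- exact: ub.
- by rewrite distrC ub.
- exact: uq.
Qed.

Lemma subdivks_mesh n k (v w : seq V) (r : R) : size v = n.+1 -> 0 <= r ->
  pairwise_le r v -> w \in subdivks n k v ->
  pairwise_le ((n%:R / n.+1%:R) ^+ k * r) w.
Proof.
elim: k v r => [|k IH] v r sv r0 vr /=.
  by rewrite inE => /eqP ->; rewrite expr0 mul1r.
case/flatten_mapP => u uv wu; rewrite exprSr -mulrA.
apply: (IH u) => //; first exact: size_subdivs uv.
  by rewrite !mulr_ge0 ?invr_ge0 ?ler0n.
exact: subdivs_mesh uv.
Qed.

End Mesh.

(** * Winding cocycles *)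

Section Cone.
Variables (R : realFieldType) (V : lmodType R).

(* [pcone w 0] says that the convex hull of [w] contains the origin. *)
Inductive pcone (w : seq V) : V -> Prop :=
| pcone_in x : x \in w -> pcone w x
| pcone_add x y : pcone w x -> pcone w y -> pcone w (x + y)
| pcone_scale c x : 0 < c -> pcone w x -> pcone w (c *: x).

Lemma pcone_sub w v p : {subset w <= v} -> pcone w p -> pcone v p.
Proof.
move=> wv; elim=> [x /wv|x y _ ? _ ?|c x ? _ ?].
- exact: pcone_in.
- exact: pcone_add.
- exact: pcone_scale.
Qed.

Lemma pcone_map_scale (T : eqType) (F : T -> V) (c : T -> R) (w : seq T) p :
  (forall x, x \in w -> 0 < c x) ->
  pcone (map (fun x => c x *: F x) w) p <-> pcone (map F w) p.
Proof.
move=> c0; split; elim=> [x|x y _ ? _ ?|d x ? _ ?].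
- case/mapP => y yw ->; apply: pcone_scale; first exact: c0.
  exact/pcone_in/map_f.
- exact: pcone_add.
- exact: pcone_scale.
- case/mapP => y yw ->; have -> : F y = (c y)^-1 *: (c y *: F y).
    by rewrite scalerA mulVf ?scale1r // gt_eqF ?c0.
  apply: pcone_scale; first by rewrite invr_gt0 c0.
  by apply: pcone_in; apply/mapP; exists y.
- exact: pcone_add.
- exact: pcone_scale.
Qed.

Lemma pcone_map_opp w p : pcone w p -> pcone (map -%R w) (- p).
Proof.
elim=> [x xw|x y _ ? _ ?|c x ? _ ?].
- by apply: pcone_in; apply: map_f.
- by rewrite opprD; apply: pcone_add.
- by rewrite -scalerN; apply: pcone_scale.
Qed.

Lemma pcone_opp w p : pcone (map -%R w) p <-> pcone w (- p).
Proof.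
split=> [/pcone_map_opp|/pcone_map_opp]; last by rewrite opprK.
by rewrite mapK //; exact: opprK.
Qed.

End Cone.

(** By induction on the cone, each of its points [p] is closer to some positive multiple [c *: p0]
    than that multiple is to the origin, which is impossible for [p = 0]. *)
Lemma pcone_ball (R : realType) (V : normedModType R) (w : seq V) (p0 : V) :
  (forall x, x \in w -> `|x - p0| < `|p0|) -> ~ pcone w 0.
Proof.
move=> wp0; suff H p : pcone w p -> exists2 c : R, 0 < c & `|p - c *: p0| < c * `|p0|.
  move=> /H [c c0]; rewrite sub0r normrN normrZ ger0_norm ?ltW //.
  by rewrite ltxx.
elim=> [x xw|x y _ [c c0 xc] _ [d d0 yd]|a x a0 _ [c c0 xc]].
- by exists 1; rewrite ?ltr01 // scale1r mul1r wp0.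
- exists (c + d); first exact: addr_gt0.
  rewrite scalerDl opprD addrACA mulrDl.
  by apply: le_lt_trans (ler_normD _ _) _; exact: ltrD.
- exists (a * c); first exact: mulr_gt0.
  by rewrite -scalerA -scalerBr normrZ gtr0_norm // -mulrA ltr_pM2l.
Qed.

Section Winding.
Variables (R : realFieldType) (V : lmodType R) (l : nat -> V -> R).
Hypothesis lD : forall j x y, l j (x + y) = l j x + l j y.
Hypothesis lZ : forall j c x, l j (c *: x) = c * l j x.

Definition hit k (w : seq V) :=
  exists2 p, pcone w p & (forall j, (j < k)%N -> l j p = 0) /\ 0 < l k p.

(** The cone, projected to the first [k] coordinates, misses the origin. For [winding k] to be a
    cocycle the relevant condition is [pointed k.+1]. *)
Definition pointed k (w : seq V) :=
  forall p, pcone w p -> exists2 j, (j < k)%N & l j p != 0.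

(* [winding k] is a cocycle representing the winding number around the origin of
   spheres of dimension [k] in the space with coordinates [l 0, ..., l k]: it
   counts the crossings with the half-line on which the last coordinate is
   positive and the others are zero. *)
Fixpoint winding k (w : seq V) : int :=
  if `[< hit k w >] then (if k is k'.+1 then cobd (winding k') w else 1) else 0.

Let lN j x : l j (- x) = - l j x.
Proof. by rewrite -scaleN1r lZ mulN1r. Qed.

Lemma hit_sub k v w : {subset w <= v} -> hit k w -> hit k v.
Proof. by move=> wv [p wp H]; exists p => //; exact: pcone_sub wp. Qed.

Lemma pointed_sub k v w : {subset w <= v} -> pointed k v -> pointed k w.
Proof. by move=> wv H p wp; apply: H; exact: pcone_sub wp. Qed.

Lemma pointed_combine k v p p' : pointed k.+1 v -> pcone v p -> pcone v p' ->
  (forall j, (j < k)%N -> l j p = 0) -> (forall j, (j < k)%N -> l j p' = 0) ->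
  l k p < 0 -> 0 < l k p' -> False.
Proof.
move=> Pv vp vp' p0 p'0 pn p'p.
have [|j] := Pv (l k p' *: p + (- l k p) *: p').
  by apply: pcone_add; apply: pcone_scale; rewrite ?oppr_gt0.
rewrite lD !lZ ltnS leq_eqVlt => /orP [/eqP ->|jk].
  by rewrite mulrC mulNr subrr eqxx.
by rewrite (p0 j) // (p'0 j) // !mulr0 addr0 eqxx.
Qed.

(** Where the first [k] coordinates vanish, coordinate [k] does not, and its sign decides whether
    [v] or its negative is hit. *)
Lemma unhit_pointed k v : pointed k.+1 v -> ~ hit k v -> ~ hit k (map -%R v) ->
  pointed k v.
Proof.
move=> Pv h1 h2 p vp; have [j] := Pv p vp.
rewrite ltnS leq_eqVlt => /orP [/eqP -> {j} pk|jk ?]; last by exists j.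
apply: contrapT => np.
have p0 j : (j < k)%N -> l j p = 0.
  by move=> jk; apply/eqP/negPn/negP => pj; apply: np; exists j.
have [pn|pp|p00] := ltgtP (l k p) 0.
- apply: h2; exists (- p); first exact: pcone_map_opp.
  by split=> [j /p0|]; rewrite lN ?oppr_gt0 // => ->; rewrite oppr0.
- by apply: h1; exists p.
- by rewrite p00 eqxx in pk.
Qed.

(** If [v] is not hit, no face is. If it is, pointedness keeps every face off the opposite
    half-line, so a face that is not hit is pointed in one coordinate less and [cobd (winding k)]
    vanishes on it by induction. Then [winding k.+1] agrees with [cobd (winding k)] on all faces,
    and [cobd] squares to zero. *)
Lemma winding_cocycle k v : size v = k.+2 -> pointed k.+1 v -> cobd (winding k) v = 0.
Proof.
elim: k v => [|k IH] v sv Pv.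
  case: v sv Pv => [|a [|b []]] // _ Pv /=; rewrite subr0.
  have hitE x : x \in [:: a; b] -> hit 0 [:: x] <-> 0 < l 0%N x.
    move=> xab; split=> [[p]|x0]; last by exists x => //; apply: pcone_in; rewrite inE.
    elim=> [y|y z ? IHy ? IHz [_]|c y c0 ? IHy [_]].
    - by rewrite inE => /eqP -> [].
    - rewrite lD; have [y0|y0] := ltP 0 (l 0%N y); first by rewrite IHy.
      by move=> yz; apply: IHz; split=> //; lra.
    - by rewrite lZ pmulr_rgt0 // => y0; apply: IHy.
  have nz x : x \in [:: a; b] -> l 0%N x != 0.
    by move=> xab; have [|[] // _] := Pv x; first exact: pcone_in.
  have Pab x y : x \in [:: a; b] -> y \in [:: a; b] -> 0 < l 0%N x -> 0 < l 0%N y.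
    move=> xab yab x0; rewrite ltNge; apply/negP => y0.
    apply: (@pointed_combine 0 _ y x Pv) => //; rewrite ?lt_neqAle ?y0 ?nz //.
      by apply: pcone_in.
    by apply: pcone_in.
  have -> : `[< hit 0 [:: b] >] = `[< hit 0 [:: a] >]; last by rewrite subrr.
  apply: asbool_equiv_eq; rewrite !hitE ?inE ?eqxx ?orbT //.
  by split; apply: Pab; rewrite !inE eqxx ?orbT.
have [hv|nhv] := pselect (hit k.+1 v); last first.
  rewrite -[RHS](cobd0 v); apply: cobd_eq_in => w wv.
  rewrite /= asboolF // => hw; apply: nhv; apply: hit_sub hw; exact: faces_sub.
transitivity (cobd (cobd (winding k)) v); last exact: cobd_cobd.
apply: cobd_eq_in => w wv /=; case: asboolP => // nhw.
have sw : size w = k.+2 by have := size_faces wv; rewrite sv => -[].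
rewrite IH //; apply: unhit_pointed nhw _; first exact: pointed_sub (faces_sub wv) Pv.
case=> p /pcone_opp wp [p0 pp]; have [q vq [q0 qp]] := hv.
apply: (@pointed_combine k.+1 v (- p) q Pv) => //.
- exact: pcone_sub (faces_sub wv) wp.
- by move=> j jk; rewrite lN p0 ?oppr0.
- by rewrite lN oppr_lt0.
Qed.

(** Crossings with a half-line depend only on the rays through the points. This lets maps into the
    sphere be replaced by homogeneous maps into [R^4]. *)
Lemma winding_scale k (T : eqType) (F : T -> V) (c : T -> R) (w : seq T) :
  (forall x, x \in w -> 0 < c x) ->
  winding k (map (fun x => c x *: F x) w) = winding k (map F w).
Proof.
have hitE j (u : seq T) : (forall x, x \in u -> 0 < c x) ->
    `[< hit j (map (fun x => c x *: F x) u) >] = `[< hit j (map F u) >].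
  move=> c0; apply: asbool_equiv_eq.
  by split=> -[p /(pcone_map_scale _ _ c0) wp H]; exists p.
elim: k w => [|k IH] w c0 /=; rewrite hitE // !cobd_map.
case: asbool => //; apply: cobd_eq_in => u uw.
by apply: IH => x xu; apply: c0; exact: (faces_sub uw).
Qed.

(** General position with respect to the flag: the cone on [k] points avoids the subspace of
    codimension [k] where the first [k] coordinates vanish. *)
Definition generic (w : seq V) := forall k u, (0 < k)%N -> {subset u <= w} ->
  size u = k -> pointed k u.

Lemma generic_sub v w : {subset w <= v} -> generic v -> generic w.
Proof. by move=> wv Gv k u k0 uw; apply: Gv => // x /uw /wv. Qed.

Let signr2 m : (-1 : int) ^+ m * (-1) ^+ m = 1.
Proof. by rewrite -exprMn mulrNN mulr1 expr1n. Qed.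

(** A pointed [w] cannot hit both half-lines of coordinate [k.+1]. If it hits the positive one the
    first term is everything, if its negative does the second term is, by the assumed equivariance,
    and if neither does the cocycle property gives zero. *)
Let winding_split_of k w : size w = k.+2 -> generic w ->
  cobd (winding k) (map -%R w) = (-1) ^+ k.+1 * cobd (winding k) w ->
  cobd (winding k) w = winding k.+1 w + (-1) ^+ k.+1 * winding k.+1 (map -%R w).
Proof.
move=> sw Gw Ew /=; rewrite Ew.
have P2 : pointed k.+2 w by apply: Gw.
have [h|h] := asboolP (hit k.+1 w); have [h'|h'] := asboolP (hit k.+1 (map -%R w)).
- have [p /pcone_opp up [p0 pp]] := h'; have [q uq [q0 qp]] := h; exfalso.
  apply: (@pointed_combine k.+1 w (- p) q P2) => //.
    by move=> j jk; rewrite lN p0 ?oppr0.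
  by rewrite lN oppr_lt0.
- by rewrite mulr0 addr0.
- by rewrite add0r mulrA signr2 mul1r.
- by rewrite mulr0 addr0 winding_cocycle //; exact: unhit_pointed.
Qed.

(* The antipodal map acts on [winding] as on the equivariant cohomology of spheres. *)
Lemma cobd_winding_opp k w : size w = k.+2 -> generic w ->
  cobd (winding k) (map -%R w) = (-1) ^+ k.+1 * cobd (winding k) w.
Proof.
elim: k w => [|k IH] w sw Gw.
  case: w sw Gw => [|a [|b []]] // _ Gw /=; rewrite !subr0.
  have oppE x : x \in [:: a; b] -> `[< hit 0 [:: - x] >] = ~~ `[< hit 0 [:: x] >].
    move=> xab; have P1 : pointed 1 [:: x].
      by apply: Gw => // y; rewrite inE => /eqP ->.
    have [h|h] := asboolP (hit 0 [:: x]); last first.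
      apply/asboolP; apply: contrapT => h'.
      by have [j] := unhit_pointed P1 h h' (pcone_in (mem_head x [::])).
    apply/asboolP => -[p /(@pcone_opp _ _ [:: x]) xp [p0 pp]].
    have [q xq [q0 qp]] := h.
    by apply: (@pointed_combine 0 _ (- p) q P1) => //; rewrite lN oppr_lt0.
  by rewrite !oppE ?inE ?eqxx ?orbT //; do 2 case: asbool.
have split_ u : size u = k.+2 -> generic u ->
    cobd (winding k) u = winding k.+1 u + (-1) ^+ k.+1 * winding k.+1 (map -%R u).
  by move=> su Gu; apply: winding_split_of => //; exact: IH.
(* Taking [cobd] of the splitting on the faces of [w] gives zero on the left, so the coboundaries of
   [winding k.+1] at [w] and at its negative determine each other. *)
have /eqP := cobd_cobd (winding k) w.
rewrite (_ : cobd (cobd (winding k)) w = cobd (fun u => winding k.+1 u +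
    (-1) ^+ k.+1 * winding k.+1 (map -%R u)) w); last first.
  apply: cobd_eq_in => u uw; apply: split_.
    by have := size_faces uw; rewrite sw => -[].
  exact: generic_sub (faces_sub uw) Gw.
rewrite cobdD cobdZ -cobd_map; set X := cobd _ w; set Y := cobd _ _.
rewrite addr_eq0 => /eqP ->.
by rewrite exprS mulN1r mulNr mulrN opprK mulrA signr2 mul1r.
Qed.

(** The descent step: crossings in dimension [k.+1], added over an antipodal pair, are read off from
    crossings in dimension [k] on the boundary. *)
Lemma winding_split k w : size w = k.+2 -> generic w ->
  cobd (winding k) w = winding k.+1 w + (-1) ^+ k.+1 * winding k.+1 (map -%R w).
Proof. by move=> sw Gw; apply: winding_split_of => //; exact: cobd_winding_opp. Qed.

Lemma winding0_opp p : pointed 1 [:: p] -> winding 0 [:: p] + winding 0 [:: - p] = 1.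
Proof.
move=> P1 /=; have [h|h] := asboolP (hit 0 [:: p]); have [h'|h'] := asboolP (hit 0 [:: - p]) => //.
  have [q /(@pcone_opp _ _ [:: p]) xp [p0 pp]] := h'.
  have [r xr [r0 rp]] := h; exfalso.
  by apply: (@pointed_combine 0 _ (- q) r P1) => //; rewrite lN oppr_lt0.
by have [j] := unhit_pointed P1 h h' (pcone_in (mem_head p [::])).
Qed.

End Winding.

(** * Generic flags of coordinates *)

Section Flag.
Variable R : realType.

Lemma exists_nonroot (Q : {poly R}) : Q != 0 -> exists a : R, Q.[a] != 0.
Proof.
move=> Q0; apply: contrapT => H.
have := @max_poly_roots _ Q [seq i%:R | i <- iota 0 (size Q)] Q0.
rewrite size_map size_iota ltnn => F; suff : false by []; apply: F.
  apply/allP => a _; rewrite /root; apply/negPn/negP => Qa; apply: H; by exists a.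
rewrite map_inj_uniq ?iota_uniq // => i j /eqP; rewrite eqr_nat; exact: eqP.
Qed.

Lemma rVpoly_neq0 n (v : 'rV[R]_n) : v != 0 -> rVpoly v != 0.
Proof. by apply: contra => /eqP v0; rewrite -[v]rVpolyK v0 linear0. Qed.

Lemma exists_nonvanishing n (s : seq R) (Z : seq 'rV[R]_n) :
  exists a, a \notin s /\ forall z, z \in Z -> z != 0 -> (rVpoly z).[a] != 0.
Proof.
pose Q := \prod_(b <- s) ('X - b%:P) * \prod_(z <- Z | z != 0) rVpoly z.
have [|a] := @exists_nonroot Q.
  rewrite mulf_neq0 // prodf_seq_neq0; apply/allP => z _ /=.
    by rewrite polyXsubC_eq0.
  by apply/implyP; exact: rVpoly_neq0.
rewrite hornerM mulf_eq0 negb_or !horner_prod => /andP [H1 H2].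
exists a; split=> [|z zZ z0].
  apply: contra H1 => sa; rewrite prodf_seq_eq0; apply/hasP; exists a => //=.
  by rewrite !hornerE subrr.
by move: H2; rewrite prodf_seq_neq0 => /allP /(_ z zZ); rewrite z0.
Qed.

(** A row is read as a polynomial and evaluated at the node [t j]. Distinct nodes give independent
    coordinates (Vandermonde), and a generic new coordinate only has to avoid finitely many
    roots. *)
Definition evalv n (t : nat -> R) j (x : 'rV[R]_n) : R := (rVpoly x).[t j].

Lemma evalvD n t j (x y : 'rV[R]_n) : evalv t j (x + y) = evalv t j x + evalv t j y.
Proof. by rewrite /evalv linearD hornerD. Qed.

Lemma evalvZ n t j c (x : 'rV[R]_n) : evalv t j (c *: x) = c * evalv t j x.
Proof. by rewrite /evalv linearZ hornerZ. Qed.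

Definition distinct n (t : nat -> R) := forall i j, (i < n)%N -> (j < n)%N -> t i = t j -> i = j.

Lemma evalv_inj n t (x : 'rV[R]_n) : distinct n t ->
  (forall j, (j < n)%N -> evalv t j x = 0) -> x = 0.
Proof.
move=> Dt H; apply/eqP/negPn/negP => /rVpoly_neq0 x0.
have := @max_poly_roots _ _ [seq t i | i <- iota 0 n] x0.
rewrite size_map size_iota ltnNge size_poly => F; suff : false by []; apply: F.
  apply/allP => a /mapP [j]; rewrite mem_iota add0n => /andP [_ jn] ->.
  by apply/eqP/H.
rewrite map_inj_in_uniq ?iota_uniq // => i j; rewrite !mem_iota !add0n.
by move=> /andP [_ ?] /andP [_ ?]; exact: Dt.
Qed.

Lemma pointed_small n t (w : seq 'rV[R]_n) : distinct n t -> ~ pcone w 0 ->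
  pointed (evalv t) n w.
Proof.
move=> Dt w0 p wp; apply: contrapT => np; apply: w0.
suff -> : 0 = p by [].
apply/esym/(evalv_inj Dt) => j jn; apply/eqP/negPn/negP => pj.
by apply: np; exists j.
Qed.

Section Lists.
Variable T : eqType.

Fixpoint lists (N : seq T) m : seq (seq T) :=
  if m is m'.+1 then [seq x :: u | x <- N, u <- lists N m'] else [:: [::]].

Lemma mem_lists N m u : size u = m -> {subset u <= N} -> u \in lists N m.
Proof.
elim: m u => [|m IH] [|x u] //= [su] uN; apply/allpairsP; exists (x, u) => /=.
split=> //; first by rewrite uN ?mem_head.
by apply: IH => // y yu; rewrite uN // inE yu orbT.
Qed.

End Lists.

Lemma pcone_sum (V : lmodType R) (w : seq V) p : pcone w p ->
  exists c : V -> R, p = \sum_(x <- w) c x *: x.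
Proof.
elim=> [x xw|x y _ [c ->] _ [d ->]|a x _ _ [c ->]].
- exists (fun y => (y == x)%:R / (count_mem x w)%:R).
  rewrite (eq_bigr (fun y => if y == x then (count_mem x w)%:R^-1 *: x else 0)); last first.
    by move=> y _; case: eqP => [->|]; rewrite ?mul1r // mul0r scale0r.
  rewrite -big_mkcond big_const_seq iter_addr_0 -scaler_nat scalerA mulfV ?scale1r //.
  by rewrite pnatr_eq0 -lt0n -has_count has_pred1.
- exists (fun z => c z + d z); rewrite -big_split; apply: eq_bigr => i _.
  by rewrite scalerDl.
- exists (fun z => a * c z); rewrite scaler_sumr; apply: eq_bigr => i _.
  by rewrite scalerA.
Qed.

(** Nodes are chosen one at a time. Among the combinations of [k.+1] given vectors, those killed by
    [k] evaluations are proportional to each other: eliminating one vector leaves a combination of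
    [k] vectors, which is zero by induction. One representative per tuple is enough, so the new node
    avoids the roots of finitely many polynomials. *)
Lemma exists_flag n (N : seq 'rV[R]_n) k : exists t : nat -> R, distinct k t /\
  forall i u (c : 'rV[R]_n -> R), (i <= k)%N -> size u = i -> {subset u <= N} ->
    let v := \sum_(x <- u) c x *: x in
    (forall j, (j < i)%N -> evalv t j v = 0) -> v = 0.
Proof.
elim: k => [|k [t [Dt Ht]]].
  exists (fun=> 0); split=> // i u c; rewrite leqn0 => /eqP -> /size0nil -> _ /=.
  by rewrite big_nil.
pose inK (u : seq 'rV[R]_n) (v : 'rV[R]_n) := [/\ v != 0, exists c : 'rV[R]_n -> R, v = \sum_(x <- u) c x *: x &
  forall j, (j < k)%N -> evalv t j v = 0].
(* Tuples without such a vector get 0, which [exists_nonvanishing] passes over. *)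
pose zof (u : seq 'rV[R]_n) : 'rV[R]_n := if pselect (exists z, inK u z) is left e then projT1 (cid e) else 0.
have [a [as_ aZ]] := exists_nonvanishing [seq t i | i <- iota 0 k]
  [seq zof u | u <- lists N k.+1].
pose t' j := if j == k then a else t j.
have t'E j : (j < k)%N -> t' j = t j by rewrite /t'; case: ltngtP.
have ek j x : (j < k)%N -> evalv t' j x = evalv t j x.
  by move=> jk; rewrite /evalv t'E.
exists t'; split=> [i j|i u c].
  have nt m : (m < k)%N -> t m != a.
    move=> mk; apply: contra as_ => /eqP <-; apply: map_f.
    by rewrite mem_iota add0n.
  rewrite /t' !ltnS => ik jk; case: eqP => [->|/eqP ni]; case: eqP => [->|/eqP nj] //=.
  - by move/esym/eqP; rewrite (negPf (nt _ _)) // ltn_neqAle nj.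
  - by move/eqP; rewrite (negPf (nt _ _)) // ltn_neqAle ni.
  - by apply: Dt; rewrite ltn_neqAle ?ni ?nj.
rewrite leq_eqVlt => /orP [/eqP ->|]; last first.
  rewrite ltnS => ik su uN v H; apply: (Ht i) => // j ji.
  by rewrite -ek ?H // (leq_trans ji).
move=> su uN v H; apply/eqP/negPn/negP => v0.
have vK : inK u v.
  split=> //; first by exists c.
  by move=> j jk; rewrite -ek // H // ltnW.
have /= zu : inK u (zof u).
  by rewrite /zof; case: pselect => [e|[]]; [exact: projT2 (cid e)|exists v].
case: zu => z0 [d zE] zk.
have : evalv t' k (zof u) != 0.
  rewrite /evalv /t' eqxx; apply: aZ => //; apply: map_f; exact: mem_lists.
have [y yu cy] : exists2 y, y \in u & c y != 0.
  apply: contrapT => nc; move/negP: v0; apply; rewrite /v big1_seq //.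
  move=> y /andP [_ yu]; apply/eqP; rewrite scaler_eq0; apply/orP; left.
  by apply/negPn/negP => cy; apply: nc; exists y.
pose q := d y / c y.
have zv : zof u - q *: v = \sum_(x <- rem y u) (d x - q * c x) *: x.
  rewrite zE /v scaler_sumr -sumrB (perm_big _ (perm_to_rem yu)) big_cons /=.
  rewrite /q scalerA divfK // subrr add0r; apply: eq_bigr => x _.
  by rewrite scalerBl scalerA.
have zv0 : zof u - q *: v = 0.
  rewrite zv; apply: (Ht k); rewrite ?size_rem ?su //.
    by move=> x /mem_rem /uN.
  move=> j jk; rewrite -zv evalvD -scaleN1r !evalvZ zk //.
  by rewrite -ek // H ?mulr0 ?addr0 // ltnW.
move/subr0_eq: zv0 => ->; rewrite evalvZ H // mulr0 eqxx //.
Qed.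

(** A cone point killed by too many evaluations is 0: for [k <= 4] by the choice of the flag, and
    beyond because four distinct nodes determine a row of length 4. *)
Lemma exists_generic (N : seq 'rV[R]_4) : exists t : nat -> R, distinct 4 t /\
  forall w, (size w <= 4)%N -> {subset w <= N} -> ~ pcone w 0 -> generic (evalv t) w.
Proof.
have [t [Dt Ht]] := exists_flag N 4; exists t; split=> // w sw wN w0 k u k0 uw su p up.
apply: contrapT => np; have [c pE] := pcone_sum up.
apply: w0; suff -> : 0 = p by exact: pcone_sub up.
apply/esym; rewrite pE.
have [k4|k4] := leqP k 4.
  apply: (Ht k) => //; first by move=> x /uw /wN.
  by move=> j jk; rewrite -pE; apply/eqP/negPn/negP => pj; apply: np; exists j.
rewrite -pE; apply: (evalv_inj Dt) => j j4.
by apply/eqP/negPn/negP => pj; apply: np; exists j; rewrite // (ltn_trans j4).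
Qed.

End Flag.

(** * Fine subdivisions and homotopy invariance *)

Definition cont_on (X Y : topologicalType) (C : set X) (F : X -> Y) :=
  forall x, C x -> F y @[y --> within C (nbhs x)] --> F x.

(* Close points have images in a common ball missing the origin. *)
Definition fine_on (R : realType) (V W : normedModType R) (d : R) (C : set V) (F : V -> W) :=
  0 < d /\ forall x y, C x -> C y -> `|x - y| <= d -> `|F x - F y| < `|F y|.

Lemma fine_on_compact (R : realType) (V W : normedModType R) (C : set V) (F : V -> W) :
  compact C -> cont_on C F -> (forall x, C x -> F x != 0) -> exists d, fine_on d C F.
Proof.
move=> /compact_near_coveringP/(_ R 0^'+
  (fun d x => C x -> forall y, C y -> `|x - y| <= d -> `|F x - F y| < `|F y|)) cC cF F0.
have Cn x : C x -> \forall x' \near x & d \near 0^'+, C x' -> forall y, C y -> `|x' - y| <= d -> `|F x' - F y| < `|F y|.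
  (* With a third of [|F x|], two images near [F x] differ by less than two thirds of it, while each
     of them is longer than that. *)
  move=> Cx; have Fx : 0 < `|F x| / 3 by rewrite divr_gt0 ?normr_gt0 ?F0.
  have /cvgrPdist_lt /(_ _ Fx) := cF x Cx.
  rewrite near_withinE => /nbhs_normP [e /= e0 He].
  pose e2 := e / 2; have e20 : 0 < e2 by rewrite divr_gt0.
  exists (ball x e2, [set d | d < e2]).
    by split=> /=; [exact: nbhsx_ballx|exact: nbhs_right_lt].
  move=> [x' d] /= [xx' de2] Cx' y Cy x'y.
  rewrite -ball_normE /= in xx'.
  have H1 : `|F x - F x'| < `|F x| / 3.
    by apply: He => //=; rewrite (lt_le_trans xx') // /e2; lra.
  have H2 : `|F x - F y| < `|F x| / 3.
    apply: He => //=; rewrite -(subrKA x'); apply: le_lt_trans (ler_normD _ _) _.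
    by rewrite (splitr e) ltrD // (le_lt_trans x'y).
  have H3 : `|F x' - F y| < `|F x| / 3 + `|F x| / 3.
    rewrite -(subrKA (F x)); apply: le_lt_trans (ler_normD _ _) _.
    by rewrite ltrD // distrC.
  have H4 : `|F x| <= `|F x - F y| + `|F y|.
    by rewrite -{1}(subrK (F y) (F x)) ler_normD.
  by move: H1 H2 H3 H4; set a := `|F x|; set b := `|F y|; lra.
have [e /= e0 He] := cC _ Cn.
exists (e / 2); have e20 : 0 < e / 2 by rewrite divr_gt0.
split=> // x y Cx Cy xy.
apply: (He (e / 2) _ _ x Cx Cx y Cy xy) => //=.
by rewrite sub0r normrN gtr0_norm // ltr_pdivrMr // ltr_pMr ?ltr1n.
Qed.

Section Small.
Variables (R : realType) (V : normedModType R).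

Lemma seq_bounded (v : seq V) : exists2 r : R, 0 <= r & pairwise_le r v.
Proof.
exists (\sum_(x <- v) `|x| + \sum_(x <- v) `|x|).
  by rewrite addr_ge0 // sumr_ge0.
have H x : x \in v -> `|x| <= \sum_(x <- v) `|x|.
  move=> xv; rewrite (perm_big _ (perm_to_rem xv)) big_cons /= lerDl.
  by rewrite sumr_ge0.
by move=> x y /H xv /H yv; apply: le_trans (ler_normB _ _) _; exact: lerD.
Qed.

Lemma subdivks_small n (v : seq V) (d : R) : size v = n.+1 -> 0 < d ->
  exists K, forall k, (K <= k)%N -> forall w, w \in subdivks n k v -> pairwise_le d w.
Proof.
move=> sv d0; have [r r0 vr] := seq_bounded v.
have n0 : (0 : R) < n.+1%:R by rewrite ltr0n.
have q1 : `|n%:R / n.+1%:R : R| < 1.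
  by rewrite ger0_norm ?divr_ge0 ?ler0n // ltr_pdivrMr // mul1r ltr_nat.
(* [r + 1] rather than [r], since the bound [r] may be 0. *)
have e0 : 0 < d / (r + 1) by rewrite divr_gt0 // ltr_wpDl.
have := @cvg_geometric _ 1 _ q1 => /cvgrPdist_lt /(_ _ e0) [K _ HK].
exists K => k Kk w wv x y xw yw.
apply: le_trans (subdivks_mesh sv r0 vr wv xw yw) _.
have /= := HK k Kk; rewrite /geometric /= mul1r sub0r normrN ger0_norm; last first.
  by rewrite exprn_ge0 // divr_ge0 ?ler0n.
rewrite ltr_pdivlMr ?ltr_wpDl // => H; apply: ltW; apply: le_lt_trans H.
by rewrite ler_wpM2l ?exprn_ge0 ?divr_ge0 ?ler0n // lerDl.
Qed.

Lemma fine_pcone (W : normedModType R) (C : set V) d (F : V -> W) (w : seq V) :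
  fine_on d C F -> (0 < size w)%N -> (forall x, x \in w -> C x) -> pairwise_le d w ->
  ~ pcone (map F w) 0.
Proof.
move=> [d0 fF] w0 Cw dw; case: w w0 Cw dw => // a w _ Cw dw.
apply: (@pcone_ball _ _ _ (F a)) => x /mapP [y yw ->].
by apply: fF; [exact: Cw|apply: Cw; rewrite mem_head|apply: dw; rewrite ?mem_head].
Qed.

End Small.

Section Degree.
Variables (R : realType) (V : normedModType R).
Local Notation W := 'rV[R]_4.

Lemma subdivk0 n k (v : seq V) : subdivk n k (fun=> 0) v = 0.
Proof.
pose z (w : seq V) : int := 0.
have /(congr1 (fun g : seq V -> int => g v)) /= := subdivkB n k z z.
rewrite subrr => H; rewrite -[RHS]H; by congr (subdivk _ _ _ v).
Qed.

(** The coboundary is moved inside the subdivision, where every small simplex has its image in a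
    ball that misses the origin. The bound [K] comes from the mesh alone and so precedes [t]. *)
Lemma fine_cocycle (C : set V) d (F : V -> W) (v : seq V) :
  bary_closed C -> fine_on d C F -> size v = 5%N -> (forall x, x \in v -> C x) ->
  exists K, forall k, (K <= k)%N -> forall t, distinct 4 t ->
    cobd (subdivk 3 k (fun w => winding (evalv t) 3 (map F w))) v = 0.
Proof.
move=> CC fF sv Cv; have [K HK] := subdivks_small sv fF.1.
exists K => k Kk t Dt; rewrite -subdivk_cobd.
transitivity (subdivk 4 k (fun=> 0) v); last exact: subdivk0.
apply: subdivk_eq => w wv; rewrite -cobd_map.
have sw := size_subdivks sv wv.
apply: winding_cocycle => //.
- by move=> j x y; exact: evalvD.
- by move=> j c x; exact: evalvZ.
- by rewrite size_map sw.
apply: pointed_small => //; apply: (@fine_pcone _ _ _ C d) => //.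
- by rewrite sw.
- exact: (subdivks_closed CC sv Cv wv).
- exact: (HK k Kk).
Qed.

(** Dual of the usual prism operator: the signed sum of [t] over the simplices
    [F a0, ..., F ai, F' ai, ..., F' an]. *)
Fixpoint prism (F F' : V -> W) (t : seq W -> int) (v : seq V) : int :=
  if v is a :: v' then
    t (F a :: F' a :: map F' v') - prism F F' (fun w => t (F a :: w)) v'
  else 0.

Lemma prismB F F' t s v :
  prism F F' (fun w => t w - s w) v = prism F F' t v - prism F F' s v.
Proof. by elim: v t s => [|a v IH] t s //=; rewrite IH; ring. Qed.

Lemma prism_homotopy F F' t v :
  cobd (prism F F' t) v + prism F F' (cobd t) v = t (map F' v) - t (map F v).
Proof.
elim: v t => [|a v IH] t /=; first by ring.
rewrite cobdB prismB (cobd_map F' (fun u => t [:: F a, F' a & u])).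
have E : prism F F' (cobd (fun w => t (F a :: w))) v =
    t (F a :: map F' v) - t (F a :: map F v) - cobd (prism F F' (fun w => t (F a :: w))) v.
  by have := IH (fun w => t (F a :: w)); lia.
by rewrite E; ring.
Qed.

Lemma prism_eq0 F F' t v :
  (forall u, size u = (size v).+1 -> {subset u <= map F v ++ map F' v} -> t u = 0) ->
  prism F F' t v = 0.
Proof.
elim: v t => [|a v IH] t //= H; rewrite H; first 1 last.
- by rewrite /= size_map.
- move=> x; rewrite !(mem_cat, inE) => /or3P [->|->|->]; rewrite ?orbT //.
- rewrite IH ?oppr0 // => u su uv; apply: H; rewrite /= ?su // => x; rewrite inE => /orP [/eqP ->|/uv].
    by rewrite mem_head.
  by rewrite !(mem_cat, inE) => /orP [->|->]; rewrite !orbT.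
Qed.

(** A single prism from [F 0] to [F 1] could sweep across the origin, so the unit interval is cut
    into [N] steps, to be taken so short that each small prism stays near a nonzero point. *)
Definition prism_sum N (F : R -> V -> W) (t : seq W -> int) (v : seq V) : int :=
  \sum_(i < N) prism (F (i%:R / N%:R)) (F (i.+1%:R / N%:R)) t v.

Lemma cobd_sum (I : Type) (r : seq I) (t : I -> seq V -> int) v :
  cobd (fun w => \sum_(i <- r) t i w) v = \sum_(i <- r) cobd (t i) v.
Proof.
elim: r => [|i r IH]; first by rewrite big_nil -[RHS](cobd0 v); congr cobd; apply/funext => w; rewrite big_nil.
rewrite big_cons -IH -cobdD; congr cobd; apply/funext => w; by rewrite big_cons.
Qed.

Definition fine_homotopy (C : set V) d (F : R -> V -> W) :=
  0 < d /\ forall x y a b, C x -> C y -> 0 <= a <= 1 -> 0 <= b <= 1 ->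
    `|x - y| <= d -> `|a - b| <= d -> `|F a x - F b y| < `|F b y|.

(** The correction is [cobd] of a cochain that depends on [N], [k] and [t] but not on [v], so the
    corrections of several simplices cancel when these form a cycle. *)
Lemma fine_homotopy_cobd (C : set V) d N (F : R -> V -> W) (v : seq V) :
  bary_closed C -> fine_homotopy C d F -> (0 < N)%N -> N%:R^-1 <= d -> size v = 4%N ->
  (forall x, x \in v -> C x) ->
  exists K, forall k, (K <= k)%N -> forall t, distinct 4 t ->
    let w3 := winding (evalv t) 3 in
    subdivk 3 k (fun w => w3 (map (F 1) w)) v - subdivk 3 k (fun w => w3 (map (F 0) w)) v
    = cobd (subdivk 2 k (prism_sum N F w3)) v.
Proof.
move=> CC [d0 fF] N0 Nd sv Cv; have [K HK] := subdivks_small sv d0.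
exists K => k Kk t Dt w3; rewrite -subdivk_cobd.
transitivity (subdivk 3 k (fun w => w3 (map (F 1) w) - w3 (map (F 0) w)) v).
  by rewrite subdivkB.
apply: subdivk_eq => w wv.
have sw := size_subdivks sv wv.
have NN : N%:R != 0 :> R by rewrite pnatr_eq0 -lt0n.
rewrite /prism_sum cobd_sum.
transitivity (\sum_(i < N) (w3 (map (F (i.+1%:R / N%:R)) w) - w3 (map (F (i%:R / N%:R)) w))).
  have := telescope_sumr (fun i => w3 (map (F (i%:R / N%:R)) w)) (leq0n N).
  by rewrite big_mkord => ->; rewrite mul0r divff.
apply: eq_bigr => i _; rewrite -prism_homotopy prism_eq0 ?addr0 // => u su uw.
apply: winding_cocycle => //.
- by move=> j x y; exact: evalvD.
- by move=> j c x; exact: evalvZ.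
- by rewrite su sw.
apply: pointed_small => //.
have uP x : x \in u -> exists y a, [/\ y \in w, x = F a y, a = i%:R / N%:R \/ a = i.+1%:R / N%:R & 0 <= a <= 1].
  have i1 j : (j <= N)%N -> 0 <= (j%:R / N%:R : R) <= 1.
    by move=> jN; rewrite divr_ge0 ?ler0n // ler_pdivrMr ?ltr0n // mul1r ler_nat jN.
  move/uw; rewrite mem_cat => /orP [] /mapP [y yw ->]; exists y.
    by exists (i%:R / N%:R); split; [| |left|apply: i1; apply: ltnW].
  by exists (i.+1%:R / N%:R); split; [| |right|apply: i1].
case: u su uw uP => // x0 u _ _ uP.
have [y0 [a0 [y0w x0E a0E a01]]] := uP x0 (mem_head _ _); rewrite x0E in uP *.
apply: (@pcone_ball _ _ _ (F a0 y0)) => x xu; have [y [a [yw -> aE a1]]] := uP x xu.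
have Cw := subdivks_closed CC sv Cv wv.
have iN : i.+1%:R / N%:R - i%:R / N%:R = N%:R^-1 :> R.
  by rewrite -mulrBl -natrB // subSnn mul1r.
apply: fF; [exact: Cw|exact: Cw|by []|by []|exact: (HK k Kk w wv)|].
case: aE a0E => -> [] ->; rewrite ?subrr ?normr0; try exact: ltW.
  by rewrite distrC iN ger0_norm ?invr_ge0 ?ler0n.
by rewrite iN ger0_norm ?invr_ge0 ?ler0n.
Qed.

Lemma fine_homotopy_compact (C : set V) (F : R -> V -> W) : compact C ->
  cont_on ([set a : R | 0 <= a <= 1] `*` C) (fun p : R * V => F p.1 p.2) ->
  (forall a x, 0 <= a <= 1 -> C x -> F a x != 0) -> exists d, fine_homotopy C d F.
Proof.
move=> cC cF F0.
have cI : compact [set a : R | 0 <= a <= 1].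
  rewrite (_ : mkset _ = `[0, 1]%classic); first exact: segment_compact.
  by apply/seteqP; split=> a /=; rewrite in_itv.
have [|d [d0 Hd]] := @fine_on_compact R (R^o * V)%type W _ _ (compact_setX cI cC) cF.
  by move=> [a x] /= [? ?]; exact: F0.
exists d; split=> // x y a b Cx Cy a1 b1 xy ab.
apply: (Hd (a, x) (b, y)) => //.
by rewrite prod_normE /= ge_max xy ab.
Qed.

End Degree.

(** * Linking numbers and the deleted join of K_5 *)

Definition par (x : int) := odd (absz x).

Lemma parD (x y : int) : par (x + y) = par x (+) par y.
Proof. rewrite /par; lia. Qed.

Lemma parN x : par (- x) = par x.
Proof. by rewrite /par abszN. Qed.

Lemma par_sign n x : par ((-1) ^+ n * x) = par x.
Proof. by rewrite -signr_odd; case: odd; rewrite ?expr1 ?expr0 ?mulN1r ?mul1r ?parN. Qed.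

Lemma par_cobd (V : Type) (t : seq V -> int) v :
  par (cobd t v) = \big[addb/false]_(f <- faces v) par (t f).
Proof.
elim: v t => [|a v IH] t; first by rewrite big_nil.
by rewrite /= big_cons big_map parD parN IH.
Qed.

Lemma faces_map (V W : Type) (f : V -> W) v : faces (map f v) = map (map f) (faces v).
Proof. by elim: v => //= a v ->; congr cons; rewrite -!map_comp. Qed.

Section PermInvariance.
Variables (V : eqType) (t : seq V -> int).

Lemma par_move n (a : V) v1 u v2 : alternating n t -> size (v1 ++ u ++ a :: v2) = n ->
  par (t (v1 ++ u ++ a :: v2)) = par (t (v1 ++ a :: u ++ v2)).
Proof.
move=> At; elim/last_ind: u v2 => [|u b IH] v2 //.
rewrite -cats1 -!catA /= => sn.
rewrite catA At ?parN; last by rewrite -sn !size_cat /=; lia.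
by rewrite -catA IH //; rewrite -sn !size_cat /=; lia.
Qed.

End PermInvariance.

Lemma par_perm (V : eqType) (t : seq V -> int) n u v : alternating n t -> size u = n ->
  perm_eq u v -> par (t u) = par (t v).
Proof.
elim: u v t n => [|a u IH] v t n At; first by move=> _; rewrite perm_sym => /perm_nilP ->.
move=> su uv; have av : a \in v by rewrite -(perm_mem uv) mem_head.
case/splitPr: av uv => v1 v2 uv.
have sv : size (v1 ++ a :: v2) = n by rewrite -(perm_size uv).
rewrite -[v1 ++ _]cat0s (par_move At) // /=.
have uv' : perm_eq u (v1 ++ v2).
  by move: uv; rewrite perm_sym (perm_catCA v1 [:: a] v2) perm_cons perm_sym.
apply: (IH (v1 ++ v2) (fun w => t (a :: w)) n.-1) => //.
  by move=> x y w1 w2 e; apply: (At x y (a :: w1)); rewrite -su /= addSn e -su.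
by rewrite -su.
Qed.

(** Turns an identity of chains modulo 2 into a count of multiplicities, which can be checked by
    evaluation. *)
Lemma addb_cancel (T : eqType) (b : T -> bool) (s s' : seq T) :
  all (fun x => ~~ odd (count_mem x (s ++ s'))) (s ++ s') ->
  \big[addb/false]_(x <- s) b x = \big[addb/false]_(x <- s') b x.
Proof.
move=> /allP H.
suff : \big[addb/false]_(x <- s ++ s') b x = false.
  by rewrite big_cat /=; do 2 case: (\big[_/_]_(_ <- _) _).
rewrite -big_undup_iterop_count big1_seq // => x /=; rewrite mem_undup => /H.
rewrite Monoid.iteropE; have -> n : iter n (addb (b x)) false = odd n && b x.
  by elim: n => //= n ->; case: odd; case: (b x).
by move=> /negPf ->.
Qed.

(* The codes [i] and [i + 5], for [i < 5], stand for the two copies of the vertex [i]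
   of [K_5] in its deleted join. *)
Definition opp_code (i : nat) : nat := if (i < 5)%N then (i + 5)%N else (i - 5)%N.

(** [K_5] has thirty ordered pairs of disjoint edges; one is listed from each antipodal pair. *)
Definition join3 : seq (seq nat) :=
  [:: [:: 0; 1; 7; 8]; [:: 0; 1; 7; 9]; [:: 0; 1; 8; 9]; [:: 0; 2; 6; 8];
      [:: 0; 2; 6; 9]; [:: 0; 2; 8; 9]; [:: 0; 3; 6; 7]; [:: 0; 3; 6; 9];
      [:: 0; 3; 7; 9]; [:: 0; 4; 6; 7]; [:: 0; 4; 6; 8]; [:: 0; 4; 7; 8];
      [:: 1; 2; 8; 9]; [:: 1; 3; 7; 9]; [:: 1; 4; 7; 8]]%N.

Definition join2 : seq (seq nat) :=
  [:: [:: 1; 2; 8]; [:: 1; 2; 9]; [:: 1; 3; 7]; [:: 1; 3; 9]; [:: 1; 4; 7]; [:: 1; 4; 8]]%N.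

Definition join1 : seq (seq nat) := [:: [:: 2; 8]; [:: 2; 9]; [:: 3; 9]]%N.

Definition opp_simplex (l : seq nat) := sort leq (map opp_code l).

(* The simplices of dimension [k] involved are those of [join k] and their
   mirror images; the boundary of [join (k + 1)] is this union mod 2, and the
   antipodal symmetry pushes the parity down to a single vertex. *)
Lemma deleted_join_parity (b : seq nat -> bool) :
  (forall l, l \in join3 ++ join2 ++ join1 -> b l (+) b (opp_simplex l) =
     \big[addb/false]_(f <- faces l) b f) ->
  b [:: 3%N] (+) b [:: 8%N] = true ->
  \big[addb/false]_(l <- join3 ++ map opp_simplex join3) b l = true.
Proof.
move=> H H0.
have pair s : {subset s <= join3 ++ join2 ++ join1} ->
    \big[addb/false]_(l <- s ++ map opp_simplex s) b l =
    \big[addb/false]_(f <- flatten (map (@faces nat) s)) b f.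
  move=> ss; rewrite big_cat big_map /= -big_split big_flatten big_map /=.
  by apply: eq_big_seq => l /ss /H.
rewrite pair; last by move=> l; rewrite mem_cat => ->.
rewrite (@addb_cancel _ b _ (join2 ++ map opp_simplex join2)) //.
rewrite pair; last by move=> l; rewrite !mem_cat => ->; rewrite orbT.
rewrite (@addb_cancel _ b _ (join1 ++ map opp_simplex join1)) //.
rewrite pair; last by move=> l; rewrite !mem_cat => ->; rewrite !orbT.
rewrite (@addb_cancel _ b _ ([:: [:: 3]; [:: 8]])) //.
by rewrite !big_cons big_nil addbF.
Qed.

Lemma eventually_all (T : eqType) (s : seq T) (P : T -> nat -> Prop) :
  (forall x, x \in s -> exists K, forall k, (K <= k)%N -> P x k) ->
  exists K, forall k, (K <= k)%N -> forall x, x \in s -> P x k.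
Proof.
elim: s => [|a s IH] H; first by exists 0%N.
have [|K HK] := IH; first by move=> x xs; apply: H; rewrite inE xs orbT.
have [K' HK'] := H a (mem_head _ _).
exists (maxn K K') => k; rewrite geq_max => /andP [Kk K'k] x.
by rewrite inE => /orP [/eqP ->|xs]; [exact: HK'|exact: HK].
Qed.

Lemma subdivk_0 (R : realFieldType) (V : lmodType R) k (t : seq V -> int) :
  subdivk 0 k t = t.
Proof. by rewrite /subdivk; elim: k => //= k ->. Qed.

Lemma subdivk_alternating (R : realFieldType) (V : lmodType R) n k (t : seq V -> int) :
  (0 < n)%N -> (0 < k)%N -> alternating n.+1 (subdivk n k t).
Proof. by case: k => // k n0 _; rewrite /subdivk iterS; exact: subdiv_alternating. Qed.

(* [s a b x y] is the contribution of the edges [ab] and [xy] to the linking number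
   of the triangles [abc] and [xyz]. *)
Definition linking (T : Type) (s : T -> T -> T -> T -> int) a b c x y z : int :=
  s a b x y + s a b y z + s a b z x + (s b c x y + s b c y z + s b c z x) +
  (s c a x y + s c a y z + s c a z x).

(** The join of two closed triangles is a cycle: each of its 2-simplices is a face of two of the
    nine tetrahedra, with opposite signs. *)
Lemma linking_cobd (T V : Type) (p q : T -> V) (t : seq V -> int) a b c x y z :
  linking (fun v0 v1 w0 w1 => cobd t [:: p v0; p v1; q w0; q w1]) a b c x y z = 0.
Proof. by rewrite /linking /=; ring. Qed.

Definition deleted_join_quads : seq (seq nat) := join3 ++ map opp_simplex join3.

(* [sw] exchanges the two copies of the graph and [pt b i] is the vertex [i] of the copy
   [b]; [C v0 v1 w0 w1] is the join of the edges [v0 v1] and [w0 w1]. *)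
Section LinkingParity.
Variables (R : realType) (V : normedModType R) (F : V -> 'rV[R]_4).
Variables (sw : V -> V) (T : finType) (pt : bool -> T -> V).
Variable C : T -> T -> T -> T -> set V.
Hypothesis sw_bary : forall v, sw (bary v) = bary (map sw v).
Hypothesis F_sw : forall p, F (sw p) = - F p.
Hypothesis sw_pt : forall b i, sw (pt b i) = pt (~~ b) i.
Hypothesis C_closed : forall v0 v1 w0 w1, bary_closed (C v0 v1 w0 w1).
Hypothesis C_pt : forall v0 v1 w0 w1, [/\ C v0 v1 w0 w1 (pt true v0),
  C v0 v1 w0 w1 (pt true v1), C v0 v1 w0 w1 (pt false w0) & C v0 v1 w0 w1 (pt false w1)].
Hypothesis C_fine : forall v0 v1 w0 w1, uniq [:: v0; v1; w0; w1] ->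
  exists d, fine_on d (C v0 v1 w0 w1) F.

Definition wchain t k j := subdivk j k (fun w => winding (evalv t) j (map F w)).

Definition wquad t k v0 v1 w0 w1 :=
  wchain t k 3 [:: pt true v0; pt true v1; pt false w0; pt false w1].

Let ptl (l : bool * T) := pt l.1 l.2.

Definition join_simplex (l : seq (bool * T)) := exists v0 v1 w0 w1,
  uniq [:: v0; v1; w0; w1] /\
  {subset l <= [:: (true, v0); (true, v1); (false, w0); (false, w1)]}.

Lemma wquad_swap1 t k v0 v1 w0 w1 : (0 < k)%N ->
  wquad t k v1 v0 w0 w1 = - wquad t k v0 v1 w0 w1.
Proof.
move=> k0.
exact: (@subdivk_alternating _ _ 3 k _ isT k0 _ _ [::] [:: _; _] (erefl _)).
Qed.

Lemma wquad_swap2 t k v0 v1 w0 w1 : (0 < k)%N ->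
  wquad t k v0 v1 w1 w0 = - wquad t k v0 v1 w0 w1.
Proof.
move=> k0.
exact: (@subdivk_alternating _ _ 3 k _ isT k0 _ _ [:: _; _] [::] (erefl _)).
Qed.

Definition good_flag t k := forall l w, join_simplex l -> (0 < size l <= 4)%N ->
  w \in subdivks (size l).-1 k (map ptl l) -> generic (evalv t) (map F w).

(** [k] comes first: subdividing the finitely many join simplices with at most four vertices finely
    enough keeps all small hulls off the origin. The flag is then chosen for the finite list of all
    image points. *)
Lemma exists_good_flag : exists K, forall k, (K <= k)%N -> exists t,
  distinct 4 t /\ good_flag t k.
Proof.
pose ls := flatten [seq lists (enum {: bool * T}) m | m <- iota 1 4].
have lsP l : (0 < size l <= 4)%N -> l \in ls.
  move=> /andP [l0 l4]; apply/flatten_mapP; exists (size l).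
    by rewrite mem_iota l0 add1n ltnS l4.
  by apply: mem_lists => // x _; rewrite mem_enum.
have [l lsl|K HK] := @eventually_all _ ls (fun l k => join_simplex l ->
    (0 < size l)%N -> forall w, w \in subdivks (size l).-1 k (map ptl l) ->
    ~ pcone (map F w) 0).
  have [[v0 [v1 [w0 [w1 [u lq]]]]]|nl] := pselect (join_simplex l); last by exists 0%N.
  have [d dF] := C_fine u.
  have [l0|l0] := ltnP 0 (size l); last by exists 0%N.
  have sl : size (map ptl l) = (size l).-1.+1 by rewrite size_map prednK.
  have [K HK] := subdivks_small sl dF.1; exists K => k Kk _ _ w wl.
  apply: (fine_pcone dF); last exact: HK wl.
    by rewrite (size_subdivks sl wl).
apply: (subdivks_closed (@C_closed v0 v1 w0 w1) sl _ wl) => x /mapP [i /lq il ->].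
  have [? ? ? ?] := C_pt v0 v1 w0 w1.
  by move: il; rewrite !inE => /or4P [] /eqP ->.
exists K => k /HK {}HK.
pose N := [seq F x | x <- flatten (flatten [seq subdivks (size l).-1 k (map ptl l) | l <- ls])].
have [t [Dt Gt]] := exists_generic N; exists t; split=> // l w jl sl wl.
have /andP [l0 l4] := sl.
have sl' : size (map ptl l) = (size l).-1.+1 by rewrite size_map prednK.
apply: Gt; last by apply: HK wl => //; exact: lsP.
  by rewrite size_map (size_subdivks sl' wl) prednK.
move=> y /mapP [x xw ->]; apply: map_f; apply/flattenP; exists w => //.
by apply/flatten_mapP; exists l => //; exact: lsP.
Qed.

Section GoodFlag.
Variables (t : nat -> R) (k : nat).
Hypotheses (k_gt0 : (0 < k)%N) (Gt : good_flag t k).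

(** Exchanging the two copies negates images under [F], so [winding_split] holds on each simplex of
    the subdivision and sums up. *)
Lemma wchain_split j l : join_simplex l -> size l = j.+2 -> (j <= 2)%N ->
  wchain t k j.+1 (map ptl l) + (-1) ^+ j.+1 * wchain t k j.+1 (map sw (map ptl l)) =
  cobd (wchain t k j) (map ptl l).
Proof.
move=> jl sl j2; rewrite /wchain -subdivk_cobd (subdivk_map sw_bary).
transitivity (subdivk j.+1 k (fun w => winding (evalv t) j.+1 (map F w) +
    (-1) ^+ j.+1 * winding (evalv t) j.+1 (map F (map sw w))) (map ptl l)).
  pose A w := winding (evalv t) j.+1 (map F w).
  pose B w := (- (-1) ^+ j.+1) * winding (evalv t) j.+1 (map F (map sw w)).
  transitivity (subdivk j.+1 k (fun w => A w - B w) (map ptl l)).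
    by rewrite subdivkB /A /B subdivkZ mulNr opprK.
  by congr subdivk; apply/funext => w; rewrite /A /B mulNr opprK.
apply: subdivk_eq => w wl.
have sw' : size w = j.+2.
  by apply: size_subdivks wl; rewrite size_map.
rewrite -cobd_map winding_split //.
- by congr (_ + _ * winding _ _ _); rewrite -!map_comp; apply: eq_map => x /=.
- by move=> i x y; exact: evalvD.
- by move=> i c x; exact: evalvZ.
- by rewrite size_map sw'.
by apply: (Gt jl); rewrite ?sl.
Qed.

Lemma wchain0_opp b i : join_simplex [:: (b, i)] ->
  wchain t k 0 [:: pt b i] + wchain t k 0 [:: pt (~~ b) i] = 1.
Proof.
move=> jl; rewrite /wchain subdivk_0 -sw_pt /map F_sw winding0_opp //.
- by move=> j x y; exact: evalvD.
- by move=> j c x; exact: evalvZ.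
have /(_ [:: pt b i]) G := Gt jl isT.
apply: G => //.
by elim: (k) => [|m IH]; rewrite /= ?cats0 // mem_head.
Qed.

(** By [wchain_split] in top degree, exchanging the copies changes each of the nine terms by a
    coboundary, and these cancel by [linking_cobd]. Moving two vertices past two others takes four
    transpositions, so no sign appears. *)
Lemma linking_sym a b c x y z : uniq [:: a; b; c; x; y; z] ->
  linking (wquad t k) x y z a b c = linking (wquad t k) a b c x y z.
Proof.
move=> u.
have E v0 v1 w0 w1 : uniq [:: v0; v1; w0; w1] -> wquad t k w0 w1 v0 v1 =
    wquad t k v0 v1 w0 w1 - cobd (wchain t k 2) [:: pt true v0; pt true v1; pt false w0; pt false w1].
  move=> uv; have jl : join_simplex [:: (true, v0); (true, v1); (false, w0); (false, w1)].
    by exists v0, v1, w0, w1; split.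
  have /= := @wchain_split 2 _ jl (erefl _) (leqnn _).
  rewrite /ptl /= !sw_pt /= => <-; rewrite opprD addrA subrr add0r.
  have -> : (-1) ^+ 3 = -1 :> int by [].
  rewrite mulN1r opprK /wquad.
  set g := wchain t k 3.
  have Ag := @subdivk_alternating _ _ 3 k (fun w => winding (evalv t) 3 (map F w)) isT k_gt0.
  have S1 p q r s : g [:: p; q; r; s] = - g [:: q; p; r; s] by exact: (Ag p q [::]).
  have S2 p q r s : g [:: p; q; r; s] = - g [:: p; r; q; s] by exact: (Ag q r [:: _]).
  have S3 p q r s : g [:: p; q; r; s] = - g [:: p; q; s; r] by exact: (Ag r s [:: _; _]).
  by rewrite S2 S1 S3 S2 !opprK.
have := linking_cobd (pt true) (pt false) (wchain t k 2) a b c x y z.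
have U p q : p \in [:: (a, b); (b, c); (c, a)] -> q \in [:: (x, y); (y, z); (z, x)] ->
    uniq [:: p.1; p.2; q.1; q.2].
  move: u; rewrite /= !inE !negb_or -!andbA.
  move=> /and5P [ab ac ax ay] /and5P [az bc bx bY] /and5P [bz cx cy cz] /and4P [xy xz yz _].
  move=> /or3P [] /eqP -> /or3P [] /eqP -> /=; rewrite ?inE ?negb_or ?(eq_sym c a) ?(eq_sym z x);
    by rewrite ?ab ?ac ?ax ?ay ?az ?bc ?bx ?bY ?bz ?cx ?cy ?cz ?xy ?xz ?yz.
have {}E v0 v1 w0 w1 : (v0, v1) \in [:: (a, b); (b, c); (c, a)] ->
    (w0, w1) \in [:: (x, y); (y, z); (z, x)] -> _ := fun h h' => E v0 v1 w0 w1 (U _ _ h h').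
rewrite /linking (E a b x y) ?(E a b y z) ?(E a b z x) ?(E b c x y) ?(E b c y z)
  ?(E b c z x) ?(E c a x y) ?(E c a y z) ?(E c a z x) ?inE ?eqxx ?orbT //.
by move=> H; rewrite -[RHS]subr0 -H; ring.
Qed.

Lemma deleted_join_parity_wquad (a : nat -> T) :
  (forall i j, (i < 5)%N -> (j < 5)%N -> a i = a j -> i = j) ->
  \big[addb/false]_(l <- deleted_join_quads)
    par (wchain t k 3 [seq pt (i < 5)%N (a (i %% 5)%N) | i <- l]) = true.
Proof.
move=> a_inj; pose r i := ((i < 5)%N, a (i %% 5)%N).
pose b l := par (wchain t k (size l).-1 (map ptl (map r l))).
have r_opp i : (i < 10)%N -> ptl (r (opp_code i)) = sw (ptl (r i)).
  by do 10 (case: i => [|i]; first by rewrite /ptl sw_pt).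
(* [q] lists the ends of two disjoint edges whose join contains [l]: a computable test for
   [join_simplex]. *)
have jq l : all (fun i => i < 10)%N l ->
  has (fun q => (uniq q && (size q == 4)) && all (fun i => i \in
     [:: nth 0 q 0; nth 0 q 1; nth 0 q 2 + 5; nth 0 q 3 + 5]) l)%N
   (lists (iota 0 5) 4) -> join_simplex (map r l).
  move=> l10 /hasP [q qs /andP [/andP [uq sq] ql]].
  have q5 i : (i < 4)%N -> (nth 0 q i < 5)%N.
    move=> i4; have /allP /(_ q qs) /allP : all (all (fun i => i < 5)%N) (lists (iota 0 5) 4).
      by vm_compute.
    by apply; rewrite mem_nth // (eqP sq).
  exists (a (nth 0 q 0)%N), (a (nth 0 q 1)%N), (a (nth 0 q 2)%N), (a (nth 0 q 3)%N); split.
    have -> : [:: a (nth 0 q 0)%N; a (nth 0 q 1)%N; a (nth 0 q 2)%N; a (nth 0 q 3)%N] = map a q.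
      by case: (q) sq => [|? [|? [|? [|? []]]]].
    rewrite map_inj_in_uniq // => i j /(nthP 0%N) [i' i'q <-] /(nthP 0%N) [j' j'q <-].
    by apply: a_inj; apply: q5; rewrite -(eqP sq).
  move=> x /mapP [i il ->]; have /allP /(_ i il) := ql.
  rewrite !inE /r => /or4P [] /eqP ->.
  - by rewrite q5 // modn_small ?q5 // eqxx /= ?orbT.
  - by rewrite q5 // modn_small ?q5 // eqxx /= ?orbT.
  - by rewrite ltnNge leq_addl /= modnDr modn_small ?q5 // eqxx /= ?orbT.
  - by rewrite ltnNge leq_addl /= modnDr modn_small ?q5 // eqxx /= ?orbT.
have -> : \big[addb/false]_(l <- deleted_join_quads)
    par (wchain t k 3 [seq pt (i < 5)%N (a (i %% 5)%N) | i <- l]) =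
   \big[addb/false]_(l <- deleted_join_quads) b l.
  apply: eq_big_seq => l lq; rewrite /b -map_comp.
  have : all (fun l => size l == 4) deleted_join_quads by [].
  by move/allP/(_ l lq)/eqP => ->.
apply: deleted_join_parity.
  move=> l ll.
  have /allP /(_ l ll) : all (fun l => [&& (2 <= size l <= 4)%N, all (fun i => i < 10)%N l &
     has (fun q => (uniq q && (size q == 4)) && all (fun i => i \in
     [:: nth 0 q 0; nth 0 q 1; nth 0 q 2 + 5; nth 0 q 3 + 5]) l)%N
     (lists (iota 0 5) 4)]) (join3 ++ join2 ++ join1) by vm_compute.
  case/and3P => /andP [l2 l4] l10 lq.
  have jl := jq l l10 lq.
  have sl : size l = (size l).-2.+2 by case: (l) l2 => [|? []].
  have slr : size (map r l) = (size l).-2.+2 by rewrite size_map.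
  have sl' : size (opp_simplex l) = size l by rewrite size_sort size_map.
  have /(congr1 par) := wchain_split jl slr (ltac:(by case: (size l) l4 => [|[|[|[|[]]]]])).
  rewrite parD par_sign par_cobd faces_map big_map => E.
  have -> : \big[addb/false]_(f <- faces l) b f =
      \big[addb/false]_(f <- faces (map r l)) par (wchain t k (size l).-2 (map ptl f)).
    rewrite faces_map big_map; apply: eq_big_seq => f /size_faces sf.
    by rewrite /b sf.
  rewrite -E; congr (_ (+) _).
    by rewrite /b; congr par; congr wchain; rewrite sl.
  (* [opp_simplex] sorts the codes and [sw] does not; the parity of an alternating cochain cannot
     see the permutation. *)
  rewrite /b sl' [in LHS]sl /=; apply: (@par_perm _ _ (size l).-2.+2).
  - exact: subdivk_alternating.
  - by rewrite !size_map size_sort size_map.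
  rewrite -!map_comp; apply: (@perm_trans _ (map (ptl \o r) (map opp_code l))).
    by apply: perm_map; rewrite perm_sort.
  rewrite -map_comp (_ : map _ l = map (sw \o (ptl \o r)) l) //.
  by apply/eq_in_map => i il /=; apply: r_opp; exact: (allP l10).
have j3 : join_simplex [:: (true, a 3%N)].
  by apply: (jq [:: 3%N]) => //; vm_compute.
by rewrite -parD /b /= /ptl /= (wchain0_opp j3).
Qed.

End GoodFlag.
End LinkingParity.

(** * Antisymmetric linking numbers on K_7 *)

Section Codes.
Local Open Scope nat_scope.

(** The boolean is the parity of the sorting permutation, that is, the change of orientation of the
    triangle. *)
Definition sort3 (a b c : nat) : bool * seq nat :=
  if a < b then
    if b < c then (false, [:: a; b; c])
    else if a < c then (true, [:: a; c; b]) else (false, [:: c; a; b])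
  else
    if a < c then (true, [:: b; a; c])
    else if b < c then (false, [:: b; c; a]) else (true, [:: c; b; a]).

(* A pair of disjoint triangles is coded by its six vertices; the normal form comes
   with the sign by which the linking number changes. *)
Definition norm6 (l : seq nat) : bool * seq nat :=
  if l is [:: a; b; c; x; y; z] then
    let t := sort3 a b c in let u := sort3 x y z in
    (t.1 (+) u.1, if head 0 t.2 < head 0 u.2 then t.2 ++ u.2 else u.2 ++ t.2)
  else (false, l).

Definition act (q l : seq nat) := [seq nth 0 q i | i <- l].

Definition act_norm q l := (norm6 (act q l)).2.

Definition pw (q : seq nat) n := iter n (act q) (iota 0 7).

Fixpoint lexle (s t : seq nat) : bool :=
  match s, t with
  | x :: s', y :: t' => if x == y then lexle s' t' else x < y
  | _, _ => true
  end.

Definition lexmin s t := if lexle s t then s else t.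

(** Four images suffice, as [certified] is only invoked for permutations whose fourth power is the
    identity. *)
Definition orbit_rep q l :=
  let l0 := (norm6 l).2 in let l1 := act_norm q l0 in
  let l2 := act_norm q l1 in let l3 := act_norm q l2 in
  lexmin (lexmin l0 l1) (lexmin l2 l3).

(* The ten pairs of disjoint triangles of [K_7] avoiding the vertex [v]. *)
Definition conway_gordon_pairs (v : nat) : seq (seq nat) :=
  if rem v (iota 0 7) is [:: f; a; b; c; d; e] then
    [:: [:: f; a; b; c; d; e]; [:: f; a; c; b; d; e]; [:: f; a; d; b; c; e];
        [:: f; a; e; b; c; d]; [:: f; b; c; a; d; e]; [:: f; b; d; a; c; e];
        [:: f; b; e; a; c; d]; [:: f; c; d; a; b; e]; [:: f; c; e; a; b; d];
        [:: f; d; e; a; b; c]]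
  else [::].

(* The boundary of the tetrahedron [u] has linking number [0] with the triangle [t]. *)
Definition tetrahedron_pairs (t u : seq nat) : seq (seq nat) :=
  if u is [:: a; b; c; d] then
    [:: t ++ [:: b; c; d]; t ++ [:: a; c; d]; t ++ [:: a; b; d]; t ++ [:: a; b; c]]
  else [::].

(* The vertices whose Conway-Gordon relations are summed, an odd number of them, and the
   tetrahedron relations to add; the formulas follow the cycle type of [q], which has
   order dividing 4. *)
Definition certificate (q : seq nat) : seq nat * seq (seq nat * seq nat) :=
  let fixed := [seq i <- iota 0 7 | nth 0 q i == i] in
  let four := [seq i <- iota 0 7 | nth 0 q (nth 0 q i) != i] in
  let two := [seq i <- iota 0 7 | (nth 0 q i != i) && (nth 0 q (nth 0 q i) == i)] in
  if (size two == 2) && (size four == 0) then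
    (fixed, [seq (rcons two a, rem a fixed) | a <- fixed])
  else if (size two == 2) && (size four == 4) then
    let a := head 0 four in let b := nth 0 q a in let c := nth 0 q b in
    let d := nth 0 q c in let x := head 0 two in let y := nth 0 q x in
    let z := head 0 fixed in
    ([:: z], [:: ([:: a; c; x], [:: b; d; y; z]); ([:: a; c; y], [:: b; d; x; z]);
        ([:: b; d; z], [:: a; c; x; y])])
  else (iota 0 7, [::]).

Definition certificate_codes (c : seq nat * seq (seq nat * seq nat)) : seq (seq nat) :=
  flatten (map conway_gordon_pairs c.1) ++ flatten [seq tetrahedron_pairs t.1 t.2 | t <- c.2].

Definition vanishing q l := norm6 (act q l) == (false, l).

Definition wf_code (l : seq nat) := [&& size l == 6, uniq l & all (fun i => i < 7) l].

Definition certified (q : seq nat) : bool :=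
  let c := certificate q in
  let l := [seq orbit_rep q x | x <- certificate_codes c] in
  let l' := [seq x <- l | ~~ vanishing q x] in
  [&& odd (size c.1), all (fun v => v < 7) c.1,
      all (fun t => (size t.1 == 3) && (size t.2 == 4)) c.2,
      all wf_code (certificate_codes c) &
      all (fun x => ~~ odd (count_mem x l')) l'].

Lemma all_certified :
  all (fun q => if pw q 4 == iota 0 7 then certified q else true)
    (permutations (iota 0 7)).
Proof. vm_compute. reflexivity. Qed.

(* 105 = 3 * 5 * 7 is the odd part of the exponent of the symmetric group of degree 7,
   whose elements of 2-power order have order dividing 4. *)
Lemma pw105_order4 :
  all (fun q => pw (pw q 105) 4 == iota 0 7) (permutations (iota 0 7)).
Proof. vm_compute. reflexivity. Qed.

End Codes.

Section NoAntisymmetricLinking.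
Variable T : Type.
Variables (s : T -> T -> T -> T -> int) (v : nat -> T).
Hypothesis s_swap1 : forall a b x y, s b a x y = - s a b x y.
Hypothesis s_swap2 : forall a b x y, s a b y x = - s a b x y.

Definition code_linking (l : seq nat) : int :=
  if l is [:: a; b; c; x; y; z] then linking s (v a) (v b) (v c) (v x) (v y) (v z) else 0.

Lemma linking_sort31 a b c x y z : exists a' b' c', (sort3 a b c).2 = [:: a'; b'; c'] /\
  linking s (v a) (v b) (v c) x y z =
    (-1) ^+ (sort3 a b c).1 * linking s (v a') (v b') (v c') x y z.
Proof.
rewrite /sort3; do 3?case: ifP => _; do 3 eexists; split=> //=;
  rewrite ?expr0 ?expr1 ?mul1r ?mulN1r /linking ?(s_swap1 (v a) (v c))
    ?(s_swap1 (v a) (v b)) ?(s_swap1 (v b) (v c)); ring.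
Qed.

Lemma linking_sort32 a b c x y z : exists a' b' c', (sort3 a b c).2 = [:: a'; b'; c'] /\
  linking s x y z (v a) (v b) (v c) =
    (-1) ^+ (sort3 a b c).1 * linking s x y z (v a') (v b') (v c').
Proof.
rewrite /sort3; do 3?case: ifP => _; do 3 eexists; split=> //=;
  rewrite ?expr0 ?expr1 ?mul1r ?mulN1r /linking ?(s_swap2 _ _ (v a) (v c))
    ?(s_swap2 _ _ (v a) (v b)) ?(s_swap2 _ _ (v b) (v c)); ring.
Qed.

Lemma perm_sort3 a b c : perm_eq (sort3 a b c).2 [:: a; b; c].
Proof.
apply/permP => p; rewrite /sort3; do 3?case: ifP => _ /=; lia.
Qed.

Hypothesis s_sym : forall l, wf_code l -> code_linking (drop 3 l ++ take 3 l) = code_linking l.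

Lemma wf_perm l l' : perm_eq l l' -> wf_code l -> wf_code l'.
Proof.
by move=> ll'; rewrite /wf_code (perm_size ll') (perm_uniq ll') (perm_all _ ll').
Qed.

Lemma perm_norm6 l : perm_eq (norm6 l).2 l.
Proof.
case: l => [|a [|b [|c [|x [|y [|z [|? ?]]]]]]] //=.
case: ifP => _; last rewrite perm_catC.
  by rewrite -[l in perm_eq _ l]/([:: a; b; c] ++ [:: x; y; z]) perm_cat ?perm_sort3.
by rewrite -[l in perm_eq _ l]/([:: a; b; c] ++ [:: x; y; z]) perm_cat ?perm_sort3.
Qed.

Lemma code_linking_norm6 l : wf_code l ->
  code_linking l = (-1) ^+ (norm6 l).1 * code_linking (norm6 l).2.
Proof.
move=> wl; have wn : wf_code (norm6 l).2 by apply: wf_perm wl; rewrite perm_sym perm_norm6.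
case: l wl wn => [|a [|b [|c [|x [|y [|z [|? ?]]]]]]] // wl; rewrite /norm6.
set t := sort3 a b c; set u := sort3 x y z.
have [a' [b' [c' [tE]]]] := linking_sort31 a b c (v x) (v y) (v z).
have [x' [y' [z' [uE]]]] := linking_sort32 x y z (v a') (v b') (v c').
rewrite -/t in tE *; rewrite -/u in uE *; rewrite tE uE.
rewrite [code_linking [:: a, b, c & _]]/code_linking => -> ->.
rewrite mulrA signr_addb.
by case: ifP => _ wn //=; have /= <- := s_sym wn.
Qed.

Lemma par_norm6 l : wf_code l -> par (code_linking (norm6 l).2) = par (code_linking l).
Proof. by move=> wl; rewrite (code_linking_norm6 wl) par_sign. Qed.

Section Permutation.
Variable q : seq nat.
Hypothesis q_perm : perm_eq q (iota 0 7).
Hypothesis q_opp : forall l, wf_code l -> code_linking (act q l) = - code_linking l.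

Lemma wf_act l : wf_code l -> wf_code (act q l).
Proof.
have sq : size q = 7%N by rewrite (perm_size q_perm) size_iota.
case/and3P => sl ul l7; apply/and3P; split; first by rewrite size_map.
  rewrite map_inj_in_uniq // => i j /(allP l7) i7 /(allP l7) j7 /eqP.
  by rewrite nth_uniq ?sq // ?(perm_uniq q_perm) ?iota_uniq // => /eqP.
apply/allP => i /mapP [j /(allP l7) j7 ->].
have : nth 0%N q j \in q by rewrite mem_nth // sq.
by rewrite (perm_mem q_perm) mem_iota.
Qed.

Lemma par_act_norm l : wf_code l ->
  par (code_linking (act_norm q l)) = par (code_linking l) /\ wf_code (act_norm q l).
Proof.
move=> wl; have wa := wf_act wl; split; first by rewrite par_norm6 // q_opp // parN.
by apply: wf_perm wa; rewrite perm_sym perm_norm6.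
Qed.

Lemma par_orbit_rep l : wf_code l ->
  par (code_linking (orbit_rep q l)) = par (code_linking l) /\ wf_code (orbit_rep q l).
Proof.
move=> wl; have w0 : wf_code (norm6 l).2 by apply: wf_perm wl; rewrite perm_sym perm_norm6.
have [p1 w1] := par_act_norm w0; have [p2 w2] := par_act_norm w1.
have [p3 w3] := par_act_norm w2.
have p0 := par_norm6 wl.
by rewrite /orbit_rep /lexmin; do 3?case: ifP => _; split; rewrite // ?p3 ?p2 ?p1.
Qed.

Lemma par_vanishing l : wf_code l -> vanishing q l -> par (code_linking l) = false.
Proof.
move=> wl /eqP e; have := code_linking_norm6 (wf_act wl).
by rewrite e /= expr0 mul1r q_opp // => E; have -> : code_linking l = 0 by lia.
Qed.

Hypothesis conway_gordon : forall w, (w < 7)%N ->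
  \big[addb/false]_(l <- conway_gordon_pairs w) par (code_linking l) = true.

(** Signs are free modulo 2. With two of them changed, every edge of the tetrahedron occurs once in
    each direction and [s_swap2] cancels the sum. *)
Lemma par_tetrahedron (t u : seq nat) : size t = 3 -> size u = 4 ->
  \big[addb/false]_(l <- tetrahedron_pairs t u) par (code_linking l) = false.
Proof.
case: t => [|x [|y [|z []]]] // _; case: u => [|a [|b [|c [|d []]]]] // _.
rewrite !big_cons big_nil /= addbF.
rewrite -(parN (linking s (v x) (v y) (v z) (v a) (v c) (v d))).
rewrite -(parN (linking s (v x) (v y) (v z) (v a) (v b) (v c))) -!parD.
set e := (X in par X); suff -> : e = 0 by [].
by rewrite /e /linking ?(s_swap2 _ _ (v a) (v c)) ?(s_swap2 _ _ (v b) (v d))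
  ?(s_swap2 _ _ (v a) (v d)); ring.
Qed.

Lemma not_certified : certified q -> False.
Proof.
rewrite /certified; case: (certificate q) => cs ts; rewrite /certificate_codes [(cs, ts).1]/= [(cs, ts).2]/=.
set L := flatten _ ++ flatten _; set L' := [seq x <- _ | _].
case/and5P => odd_cs cs7 ts34 wfL L'even.
have : \big[addb/false]_(l <- L) par (code_linking l) = true.
  rewrite big_cat !big_flatten !big_map /=.
  have -> : \big[addb/false]_(t <- ts) \big[addb/false]_(l <- tetrahedron_pairs t.1 t.2)
      par (code_linking l) = false.
    rewrite big1_seq // => t /andP [_ /(allP ts34) /andP [/eqP t3 /eqP u4]].
    exact: par_tetrahedron.
  rewrite addbF (eq_big_seq (fun=> true)); last by move=> w /(allP cs7); exact: conway_gordon.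
  rewrite big_const_seq count_predT.
  by elim: (size cs) odd_cs => // n IH /=; case: (odd n) IH => //= IH _; rewrite ?IH //.
have -> : \big[addb/false]_(l <- L) par (code_linking l) =
    \big[addb/false]_(l <- L') par (code_linking l).
  rewrite /L' big_filter big_map [RHS]big_mkcond; apply: eq_big_seq => l /(allP wfL) wl.
  have [pl wo] := par_orbit_rep wl.
  by case: ifP => // /negbFE /(par_vanishing wo); rewrite pl.
rewrite (@addb_cancel _ (fun l => par (code_linking l)) L' [::]) ?cats0 // big_nil //.
Qed.

End Permutation.
End NoAntisymmetricLinking.

Definition quad_par (T : Type) (s : T -> T -> T -> T -> int) (v : nat -> T) (l : seq nat) :=
  par (s (v (nth 0 l 0)) (v (nth 0 l 1)) (v (nth 0 l 2)) (v (nth 0 l 3)))%N.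

(** * The Conway-Gordon relations from the parity on [K_5] *)

Section ConwayGordon.
Variables (s : 'I_7 -> 'I_7 -> 'I_7 -> 'I_7 -> int).
Hypothesis s_swap1 : forall a b x y, s b a x y = - s a b x y.
Hypothesis s_swap2 : forall a b x y, s a b y x = - s a b x y.
Hypothesis s_parity : forall a : nat -> 'I_7,
  (forall i j, (i < 5)%N -> (j < 5)%N -> a i = a j -> i = j) ->
  \big[addb/false]_(l <- deleted_join_quads)
    par (s (a (nth 0 l 0)) (a (nth 0 l 1)) (a (nth 0 l 2 - 5)) (a (nth 0 l 3 - 5)))%N = true.

Let v (i : nat) : 'I_7 := inord i.
Let pquad := quad_par s v.

Definition norm_quad (a b x y : nat) :=
  [:: minn a b; maxn a b; minn x y; maxn x y].

Definition code_quads (l : seq nat) : seq (seq nat) :=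
  if l is [:: a; b; c; x; y; z] then
    [seq norm_quad e.1 e.2 f.1 f.2 | e <- [:: (a, b); (b, c); (c, a)],
      f <- [:: (x, y); (y, z); (z, x)]]
  else [::].

Lemma par_norm_quad a b x y :
  par (s (v a) (v b) (v x) (v y)) = pquad (norm_quad a b x y).
Proof.
rewrite /pquad /quad_par /norm_quad /= /minn /maxn.
by case: ifP => _; case: ifP => _; rewrite // ?(s_swap1 (v b) (v a)) ?(s_swap2 _ _ (v y) (v x)) !parN.
Qed.

Lemma par_code_linking l :
  par (code_linking s v l) = \big[addb/false]_(e <- code_quads l) pquad e.
Proof.
case: l => [|a [|b [|c [|x [|y [|z [|? ?]]]]]]]; rewrite ?big_nil //.
rewrite /= /linking !parD !par_norm_quad !big_cons big_nil addbF.
by rewrite !addbA.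
Qed.

Definition k5_quads (u : seq nat) : seq (seq nat) :=
  [seq norm_quad (nth 0 u (nth 0 l 0)) (nth 0 u (nth 0 l 1))
    (nth 0 u (nth 0 l 2 - 5)) (nth 0 u (nth 0 l 3 - 5)) | l <- deleted_join_quads]%N.

Lemma conway_gordon_of_parity w : (w < 7)%N ->
  \big[addb/false]_(l <- conway_gordon_pairs w) par (code_linking s v l) = true.
Proof.
move=> w7; pose u := behead (rem w (iota 0 7)).
have Eu : \big[addb/false]_(l <- k5_quads u) pquad l = true.
  have /allP /(_ w) : all (fun w => [&& size (behead (rem w (iota 0 7))) == 5,
    uniq (behead (rem w (iota 0 7))) & all (fun i => i < 7)%N (behead (rem w (iota 0 7)))]) (iota 0 7).
    by vm_compute.
  rewrite mem_iota => /(_ w7) /and3P [/eqP su uu u7].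
  rewrite -[RHS](s_parity (a := fun i => v (nth 0%N u i))); last first.
    move=> i j i5 j5 /(congr1 (@nat_of_ord 7)); rewrite !inordK ?(allP u7) ?mem_nth ?su // => /eqP.
    by rewrite nth_uniq ?su // => /eqP.
  by rewrite big_map; apply: eq_bigr => l _; rewrite -par_norm_quad.
rewrite -[RHS]Eu (eq_bigr _ (fun l _ => par_code_linking l)).
have -> : \big[addb/false]_(l <- conway_gordon_pairs w)
    \big[addb/false]_(e <- code_quads l) pquad e =
    \big[addb/false]_(e <- flatten (map code_quads (conway_gordon_pairs w))) pquad e.
  by rewrite big_flatten big_map.
apply: addb_cancel.
have /allP /(_ w) : all (fun w => let s := flatten (map code_quads (conway_gordon_pairs w))
    ++ k5_quads (behead (rem w (iota 0 7))) in all (fun x => ~~ odd (count_mem x s)) s) (iota 0 7).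
  by vm_compute.
by rewrite mem_iota => /(_ w7).
Qed.

End ConwayGordon.

Lemma no_antisymmetric_linking (s : 'I_7 -> 'I_7 -> 'I_7 -> 'I_7 -> int)
    (phi : 'I_7 -> 'I_7) :
  injective phi ->
  (forall a b x y, s b a x y = - s a b x y) ->
  (forall a b x y, s a b y x = - s a b x y) ->
  (forall a b c x y z, uniq [:: a; b; c; x; y; z] ->
    linking s x y z a b c = linking s a b c x y z) ->
  (forall a : nat -> 'I_7, (forall i j, (i < 5)%N -> (j < 5)%N -> a i = a j -> i = j) ->
    \big[addb/false]_(l <- deleted_join_quads)
      par (s (a (nth 0 l 0)) (a (nth 0 l 1)) (a (nth 0 l 2 - 5)) (a (nth 0 l 3 - 5)))%N = true) ->
  (forall a b c x y z, uniq [:: a; b; c; x; y; z] ->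
    linking s (phi a) (phi b) (phi c) (phi x) (phi y) (phi z) = - linking s a b c x y z) ->
  False.
Proof.
move=> phi_inj s1 s2 s_sym s5 s_opp.
pose v (i : nat) : 'I_7 := inord i.
pose p := [seq val (phi (v i)) | i <- iota 0 7].
have vp i : (i < 7)%N -> v (nth 0%N p i) = phi (v i).
  by move=> i7; rewrite /p (nth_map 0%N) ?size_iota // nth_iota // add0n /v inord_val.
have v_inj i j : (i < 7)%N -> (j < 7)%N -> v i = v j -> i = j.
  by move=> i7 j7 /(congr1 (@nat_of_ord 7)); rewrite !inordK.
have wf_uniq l : wf_code l -> uniq (map v l).
  case/and3P => _ ul l7; rewrite map_inj_in_uniq // => i j /(allP l7) i7 /(allP l7) j7.
  exact: v_inj.
have up : uniq p.
  rewrite map_inj_in_uniq ?iota_uniq // => i j; rewrite !mem_iota => i7 j7.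
  by move/val_inj/phi_inj; exact: v_inj.
have p_perm : perm_eq p (iota 0 7).
  apply: uniq_perm; rewrite ?iota_uniq //.
  have sub : {subset p <= iota 0 7} by move=> i /mapP [j _ ->]; rewrite mem_iota ltn_ord.
  by have [|_] := uniq_min_size up sub; rewrite ?size_map.
have p_opp l : wf_code l -> code_linking s v (act p l) = - code_linking s v l.
  move=> wl; have := wf_uniq l wl; case/and3P: wl => sl _.
  case: l sl => [|a [|b [|c [|x [|y [|z [|? ?]]]]]]] // _.
  move=> /and5P [a7 b7 c7 x7 /and3P [y7 z7 _]] H.
  by rewrite /= !vp //; exact: s_opp.
have pw_perm n : perm_eq (pw p n) (iota 0 7).
  elim: n => [|n IH]; first exact: perm_refl.
  apply: perm_trans (perm_map _ IH) _.
  have -> : [seq nth 0%N p i | i <- iota 0 7] = p by rewrite -[RHS](mkseq_nth 0%N) size_map.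
  exact: p_perm.
have pw_opp n l : wf_code l ->
    code_linking s v (act (pw p n) l) = (-1) ^+ n * code_linking s v l.
  move=> wl; elim: n => [|n IH].
    rewrite expr0 mul1r; congr code_linking; rewrite /act /pw -[RHS]map_id.
    apply/eq_in_map => i /(allP (proj2 (andP (proj2 (andP wl))))) i7.
    by rewrite nth_iota.
  rewrite exprS -mulrA -IH mulN1r -p_opp; last exact: (wf_act (pw_perm n) wl).
  congr code_linking; rewrite /act -map_comp.
  apply/eq_in_map => i /(allP (proj2 (andP (proj2 (andP wl))))) i7 /=.
  by rewrite (nth_map 0%N) // (perm_size (pw_perm n)).
have /allP /(_ p) := pw105_order4; rewrite mem_permutations => /(_ p_perm) /eqP q4.
have /allP /(_ (pw p 105)) := all_certified; rewrite mem_permutations => /(_ (pw_perm _)).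
rewrite q4 eqxx => cert; apply: (@not_certified _ s v s1 s2 _ _ (pw_perm 105) _ _ cert).
- move=> l wl; have := wf_uniq l wl; case/and3P: wl => sl _ _.
  case: l sl => [|a [|b [|c [|x [|y [|z [|? ?]]]]]]] //= _ H.
  by rewrite (s_sym (v a)).
(* 105 is odd, so the sign survives in the power of the permutation. *)
- by move=> l wl; rewrite pw_opp // -signr_odd mulN1r.
- by move=> w w7; apply: conway_gordon_of_parity.
Qed.

(** * Self-embeddings of complete graphs *)

Section GraphSelfMaps.
Variables (R : realType) (n : nat).
Local Notation I := 'I_n.
Local Notation X := (realization R (complete_graph n)).

Definition crd (x : X) (i : I) : R := (set_val x : I -> R) i.

Lemma crd_ge0 x i : 0 <= crd x i.
Proof. by have [H _ _] := set_valP x; exact: H. Qed.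

Lemma crd_sum x : \sum_i crd x i = 1.
Proof. by have [_ H _] := set_valP x; exact: H. Qed.

Lemma crd_supp x : exists v w : I, forall u, crd x u != 0 -> u = v \/ u = w.
Proof. by have [_ _ [v [w [_ H]]]] := set_valP x; exists v, w. Qed.

Lemma crd_inj x y : crd x =1 crd y -> x = y.
Proof. by move=> xy; apply: val_inj; apply/funext => i; exact: xy. Qed.

Lemma crd_continuous i : continuous (crd ^~ i).
Proof.
move=> x; apply: (@continuous_comp X {ptws I -> R} R set_val (fun y => y i)).
  exact: initial_continuous.
exact: (@proj_continuous I (fun=> R) i).
Qed.

Lemma continuous_to_realization (Y : topologicalType) (f : Y -> X) :
  (forall i, continuous (fun y => crd (f y) i)) -> continuous f.
Proof.
move=> H; apply/continuous_comp_initial => y.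
apply/cvg_sup => i; move: y.
exact: (@continuous_comp_initial _ _ _ (fun g : I -> R => g i) (fun y => set_val (f y)) (H i)).
Qed.

Definition edge_fun (v w : I) (s : R) : I -> R :=
  fun i => (1 - s) * (i == v)%:R + s * (i == w)%:R.

Lemma edge_funP v w s : 0 <= s <= 1 ->
  edge_fun v w s \in @realization_set R (complete_graph n).
Proof.
move=> /andP [s0 s1]; apply/mem_set; split.
- by move=> i; rewrite /edge_fun addr_ge0 ?mulr_ge0 ?ler0n // subr_ge0.
- rewrite /edge_fun big_split /= -!mulr_sumr.
  have sum1 u : \sum_(i < n) ((i == u)%:R : R) = 1.
    by rewrite (bigD1 u) //= eqxx big1 ?addr0 // => i /negPf ->.
  by rewrite !sum1 !mulr1 subrK.
- exists v, w; split; first by have [->|vw] := eqVneq v w; [left|right].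
  move=> u; rewrite /edge_fun; case: (u =P v) => [->|]; first by left.
  case: (u =P w) => [->|]; first by right.
  by rewrite !mulr0 addr0 eqxx.
Qed.

(** Makes [edge_pt] total and continuous on the whole line, so that the intermediate value theorem
    applies without restricting domains. *)
Definition clamp (s : R) : R := Num.max 0 (Num.min s 1).

Lemma clamp01 s : 0 <= clamp s <= 1.
Proof. by rewrite /clamp le_max lexx /= ge_max ler01 ge_min lexx orbT. Qed.

Lemma clamp_id s : 0 <= s <= 1 -> clamp s = s.
Proof. by case/andP=> s0 s1; rewrite /clamp min_l // max_r. Qed.

Lemma clamp_continuous : continuous clamp.
Proof.
move=> s; apply: (@continuous_max R R (cst 0) (fun s => Num.min s 1)); first exact: cvg_cst.
by apply: (@continuous_min R R id (cst 1)); [exact: cvg_id|exact: cvg_cst].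
Qed.

Definition edge_pt v w s : X :=
  exist (fun y => y \in @realization_set R (complete_graph n)) _ (@edge_funP v w _ (clamp01 s)).

Lemma crd_edge v w s i : 0 <= s <= 1 ->
  crd (edge_pt v w s) i = (1 - s) * (i == v)%:R + s * (i == w)%:R.
Proof.
by move=> s01; rewrite /crd -[set_val _]/(edge_fun v w (clamp s)) /edge_fun clamp_id.
Qed.

Lemma edge_pt_continuous v w : continuous (edge_pt v w).
Proof.
apply: continuous_to_realization => i s.
have cs : {for s, continuous clamp} by exact: clamp_continuous.
rewrite -[fun _ => crd _ _]/(fun s => edge_fun v w (clamp s) i) /edge_fun.
apply: (@continuousD _ R^o R (fun s => (1 - clamp s) * (i == v)%:R)
  (fun s => clamp s * (i == w)%:R)).
  apply: (@continuousM _ _ (fun s => 1 - clamp s) (cst _)); last exact: cvg_cst.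
  by apply: (@continuousB _ R^o R (cst 1) clamp); first exact: cvg_cst.
by apply: (@continuousM _ _ clamp (cst _)); last exact: cvg_cst.
Qed.

Lemma crd_nonneg_eq1 x i : crd x i = 1 -> forall j, j != i -> crd x j = 0.
Proof.
move=> x1 j ji; have := crd_sum x; rewrite (bigD1 i) //= x1 (bigD1 j) //= => H.
have : 0 <= \sum_(k < n | (k != i) && (k != j)) crd x k.
  by apply: sumr_ge0 => k _; exact: crd_ge0.
by have := crd_ge0 x j; lra.
Qed.

Lemma crd_pair x a b : a != b -> 0 < crd x a -> 0 < crd x b ->
  crd x a + crd x b = 1 /\ forall c, c != a -> c != b -> crd x c = 0.
Proof.
move=> ab xa xb; have [v [w H]] := crd_supp x.
have Ha := H a (lt0r_neq0 xa); have Hb := H b (lt0r_neq0 xb).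
have z c : c != a -> c != b -> crd x c = 0.
  move=> ca cb; apply/eqP/negPn/negP => /H xc.
  move: ab ca cb; case: Ha Hb xc => -> [] -> [] ->; rewrite ?eqxx //.
split=> //; have := crd_sum x; rewrite (bigD1 a) //= (bigD1 b) 1?eq_sym //=.
by rewrite big1 ?addr0 // => c /andP [ca cb]; exact: z.
Qed.

Lemma crd_vertex_or_pair x : (exists u, crd x u = 1) \/
  exists a b, [/\ a != b, 0 < crd x a & 0 < crd x b].
Proof.
have [v [w H]] := crd_supp x.
have pos i : crd x i != 0 -> 0 < crd x i by rewrite lt_neqAle eq_sym crd_ge0 andbT.
have vert i : (forall j, j != i -> crd x j = 0) -> crd x i = 1.
  by move=> z; have := crd_sum x; rewrite (bigD1 i) //= big1 ?addr0.
have [xv|xv] := eqVneq (crd x v) 0.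
  left; exists w; apply: vert => j jw; apply/eqP/negPn/negP => /[dup] xj /H [] ji.
    by rewrite ji xv eqxx in xj.
  by rewrite ji eqxx in jw.
have [xw|xw] := eqVneq (crd x w) 0.
  left; exists v; apply: vert => j jv; apply/eqP/negPn/negP => /[dup] xj /H [] ji.
    by rewrite ji eqxx in jv.
  by rewrite ji xw eqxx in xj.
have [vw|vw] := eqVneq v w; last by right; exists v, w; rewrite vw !pos.
left; exists v; apply: vert => j jv; apply/eqP/negPn/negP => /H.
by rewrite -vw => -[] /eqP; rewrite (negPf jv).
Qed.

Lemma continuous_eps (f : R -> R) (s e : R) : continuous f -> 0 < e ->
  exists2 d, 0 < d & forall s', `|s - s'| < d -> `|f s - f s'| < e.
Proof.
move=> cf e0; have /cvgrPdist_lt /(_ e e0) := cf s.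
by move=> /nbhs_normP [d /= d0 H]; exists d.
Qed.

Lemma IVT_cont (f : R -> R) a b y : continuous f -> a <= b ->
  Num.min (f a) (f b) <= y <= Num.max (f a) (f b) -> exists2 c, a <= c <= b & f c = y.
Proof.
move=> cf ab yab; have [|c] := IVT ab _ yab; first exact: continuous_subspaceT.
by rewrite in_itv /= => cab fc; exists c.
Qed.

Variable g : X -> X.
Hypotheses (g_cont : continuous g) (g_inj : injective g).

Let gc v w i s := crd (g (edge_pt v w s)) i.

Let gc_cont v w i : continuous (gc v w i).
Proof.
move=> s; apply: (@continuous_comp _ _ _ (g \o edge_pt v w) (crd ^~ i)).
  by apply: continuous_comp; [exact: edge_pt_continuous|exact: g_cont].
exact: crd_continuous.
Qed.

Lemma edge_pt_eq v w w' s s' : 0 <= s <= 1 -> 0 <= s' <= 1 -> v != w -> w != w' ->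
  edge_pt v w s = edge_pt v w' s' -> s = 0.
Proof.
move=> s01 s01' vw ww' /(congr1 (crd ^~ w)); rewrite !crd_edge // eqxx.
by rewrite eq_sym (negPf vw) (negPf ww') !mulr0 addr0 add0r mulr1.
Qed.

Definition vtx v := edge_pt v v 0.

Lemma crd_vtx v i : crd (vtx v) i = (i == v)%:R.
Proof. by rewrite crd_edge ?lexx ?ler01 // subr0 mul1r mul0r addr0. Qed.

Lemma vtx_edge v w : edge_pt v w 0 = vtx v.
Proof.
by apply: crd_inj => i; rewrite !crd_edge ?lexx ?ler01 // !mul0r.
Qed.

Lemma vtx_of x u : crd x u = 1 -> x = vtx u.
Proof.
move=> xu; apply: crd_inj => i; rewrite crd_vtx.
by have [->|iu] := eqVneq i u; last exact: (crd_nonneg_eq1 xu).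
Qed.

(* Two edges leaving an interior point of an edge on the same side overlap, by the
   intermediate value theorem. *)
Lemma tripod_same_side v w w' a b d : v != w -> v != w' -> w != w' -> a != b ->
  0 < d <= 1 ->
  (forall s, 0 <= s <= d -> [/\ 0 < gc v w a s, 0 < gc v w b s, 0 < gc v w' a s & 0 < gc v w' b s]) ->
  (gc v w a 0 < gc v w a d <= gc v w' a d) \/ (gc v w' a d <= gc v w a d < gc v w a 0) -> False.
Proof.
move=> vw vw' ww' ab /andP [d0 d1] H side.
have g00 : gc v w' a 0 = gc v w a 0 by rewrite /gc !vtx_edge.
have [s /andP [s0 sd] gs] : exists2 s, 0 <= s <= d & gc v w' a s = gc v w a d.
  apply: IVT_cont => //; first exact: ltW.
  by rewrite ge_min le_max g00; case: side => /andP [h1 h2];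
    rewrite ?h1 ?h2 ?(ltW h1) ?(ltW h2) ?orbT.
have s01 : 0 <= s <= 1 by rewrite s0 (le_trans sd).
have dd : 0 <= d <= d by rewrite ltW //=.
have d01 : 0 <= d <= 1 by rewrite ltW.
have [wa wb _ _] := H d dd.
have [|_ _ wa' wb'] := H s; first by rewrite s0.
have [e1 z1] := crd_pair ab wa wb; have [e2 z2] := crd_pair ab wa' wb'.
have /g_inj E : g (edge_pt v w d) = g (edge_pt v w' s).
  apply: crd_inj => i; have [->|ia] := eqVneq i a; first by rewrite -/(gc _ _ _ _) -gs.
  have [->|ib] := eqVneq i b; last by rewrite z1 // z2.
  by move: gs e1 e2; rewrite /gc; lra.
by have := edge_pt_eq d01 s01 vw ww' E => d00; rewrite d00 ltxx in d0.
Qed.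

Lemma pos_near v w i : 0 < gc v w i 0 ->
  exists2 d, 0 < d <= 1 & forall s, 0 <= s <= d -> 0 < gc v w i s.
Proof.
move=> p0; have [d d0 H] := continuous_eps 0 (@gc_cont v w i) p0.
have m0 : 0 < Num.min (d / 2) 1 by rewrite lt_min ltr01 divr_gt0.
exists (Num.min (d / 2) 1); first by rewrite m0 ge_min lexx orbT.
move=> s /andP [s0]; rewrite le_min => /andP [sd _].
have /H : `|0 - s| < d by rewrite sub0r normrN ger0_norm //; lra.
by rewrite ltr_norml => /andP [_]; lra.
Qed.

(** At least three edges leave [v], as [n > 3]. If its image were interior to an edge [ab], the
    coordinate [a] would increase or decrease along each of them, and two of the three would go to
    the same side, against [tripod_same_side]. *)
Lemma vertex_to_vertex v : (3 < n)%N -> exists u, g (vtx v) = vtx u.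
Proof.
move=> n3; have [[u /vtx_of gu]|[a [b [ab ga gb]]]] := crd_vertex_or_pair (g (vtx v)).
  by exists u.
exfalso; have g0 w i : gc v w i 0 = crd (g (vtx v)) i by rewrite /gc vtx_edge.
have good w : exists2 d, 0 < d <= 1 & forall s, 0 <= s <= d -> 0 < gc v w a s /\ 0 < gc v w b s.
  have [|d /andP [d0 d1] H] := @pos_near v w a; first by rewrite g0.
  have [|e /andP [e0 e1] H'] := @pos_near v w b; first by rewrite g0.
  exists (Num.min d e); first by rewrite lt_min d0 e0 ge_min d1.
  by move=> s /andP [s0]; rewrite le_min => /andP [sd se]; rewrite H ?H' ?s0.
have : (2 < #|[set~ v]%SET|)%N by rewrite cardsC1 card_ord; lia.
case/card_gt2P => w1 [w2 [w3 [[+ + +] [w12 w23 w31]]]].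
rewrite !inE => v1 v2 v3; rewrite eq_sym in v1; rewrite eq_sym in v2; rewrite eq_sym in v3.
have [d1 /andP [d10 d11] H1] := good w1; have [d2 /andP [d20 d21] H2] := good w2.
have [d3 /andP [d30 d31] H3] := good w3.
pose d := Num.min d1 (Num.min d2 d3).
have d0 : 0 < d by rewrite !lt_min d10 d20 d30.
have dle s : s <= d -> [/\ s <= d1, s <= d2 & s <= d3] by rewrite !le_min => /and3P.
have d01 : 0 < d <= 1 by rewrite d0 ge_min d11.
have H w s : w \in [:: w1; w2; w3] -> 0 <= s <= d -> 0 < gc v w a s /\ 0 < gc v w b s.
  move=> + /andP [s0 /dle [e1 e2 e3]]; rewrite !inE => /or3P [] /eqP ->.
  - by apply: H1; rewrite s0.
  - by apply: H2; rewrite s0.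
  - by apply: H3; rewrite s0.
pose c := crd (g (vtx v)) a.
have ne w : w \in [:: w1; w2; w3] -> v != w -> gc v w a d != c.
  move=> ww vw; apply/eqP => E; have [|pa pb] := H w d ww; first by rewrite lexx ltW.
  have [e1 z1] := crd_pair ab pa pb; have [e2 z2] := crd_pair ab ga gb.
  have /g_inj/(congr1 (crd ^~ w)) : g (edge_pt v w d) = g (vtx v).
    apply: crd_inj => i; have [->|ia] := eqVneq i a; first exact: E.
    have [->|ib] := eqVneq i b; last by rewrite z1 // z2.
    by move: E e1 e2; rewrite /gc /c; lra.
  rewrite crd_vtx crd_edge; last by rewrite ltW //=; case/andP: d01.
  rewrite eqxx eq_sym (negPf vw) mulr0 add0r mulr1 => dz.
  by rewrite dz ltxx in d0.
have two w w' : w \in [:: w1; w2; w3] -> w' \in [:: w1; w2; w3] -> v != w -> v != w' ->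
    w != w' -> (c < gc v w a d) = ~~ (c < gc v w' a d).
  move=> ww ww' vw vw' wdw'.
  have T := tripod_same_side _ _ _ ab d01.
  have Hs s : 0 <= s <= d -> [/\ 0 < gc v w a s, 0 < gc v w b s, 0 < gc v w' a s & 0 < gc v w' b s].
    by move=> sd; have [? ?] := H w s ww sd; have [? ?] := H w' s ww' sd.
  have Hs' s : 0 <= s <= d -> [/\ 0 < gc v w' a s, 0 < gc v w' b s, 0 < gc v w a s & 0 < gc v w b s].
    by move=> /Hs [].
  have w'w : w' != w by rewrite eq_sym.
  have F := T v w w' vw vw' wdw' Hs; have F' := T v w' w vw' vw w'w Hs'.
  rewrite !g0 -/c in F F'; have n1 := ne w ww vw; have n2 := ne w' ww' vw'.
  have [h|h|h] := ltgtP c (gc v w a d); last by rewrite -h eqxx in n1.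
    have [h'|//|h'] := ltgtP c (gc v w' a d); last by rewrite -h' eqxx in n2.
    exfalso; have [l|l] := leP (gc v w a d) (gc v w' a d); first by apply: F; left; rewrite h.
    by apply: F'; left; rewrite h' ltW.
  have [//|h'|h'] := ltgtP c (gc v w' a d); last by rewrite -h' eqxx in n2.
  exfalso; have [l|l] := leP (gc v w a d) (gc v w' a d); first by apply: F'; right; rewrite h' l.
  by apply: F; right; rewrite h ltW.
have := two w1 w2; have := two w2 w3; have := two w1 w3.
rewrite !inE !eqxx ?orbT => /(_ isT isT v1 v3); rewrite eq_sym => /(_ w31).
move=> + /(_ isT isT v2 v3 w23) + /(_ isT isT v1 v2 w12).
by do 3 case: (c < _).
Qed.

Lemma edge_to_edge v w u u' s : (3 < n)%N -> v != w -> g (vtx v) = vtx u ->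
  g (vtx w) = vtx u' -> 0 <= s <= 1 -> forall i, i != u -> i != u' -> gc v w i s = 0.
Proof.
move=> n3 vw gv gw s01 i iu iu'.
have [phi phiP] := choice (fun x => vertex_to_vertex x n3).
have vtx_inj : injective vtx.
  move=> x y /(congr1 (crd ^~ x)); rewrite !crd_vtx eqxx; case: eqVneq => // _ /eqP.
  by rewrite oner_eq0.
have phi_inj : injective phi.
  by move=> x y e; apply: vtx_inj; apply: g_inj; rewrite !phiP e.
(* [phi] is injective on a finite set, hence onto: each vertex is already the image of a vertex, so
   no interior point of an edge can reach it. *)
have edge_nv x y : 0 < y < 1 -> g (edge_pt v w y) <> vtx x.
  move=> /andP [y0 y1] E; have [x' x'E] : exists x', phi x' = x.
    by exists (invF phi_inj x); rewrite f_invF.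
  move: E; rewrite -x'E -phiP => /g_inj E.
  have y01 : 0 <= y <= 1 by rewrite !ltW.
  have := congr1 (crd ^~ v) E; have := congr1 (crd ^~ w) E.
  rewrite !crd_vtx !crd_edge // !eqxx (eq_sym w v) (negPf vw) !mulr0 add0r addr0 !mulr1.
  by case: eqP => _; case: eqP => _ /=; lra.
have half : 0 < (2^-1 : R) < 1 by rewrite invr_gt0 ltr0n /= invf_lt1 ?ltr1n ?ltr0n.
have [[x xE]|[a [b [ab ga gb]]]] := crd_vertex_or_pair (g (edge_pt v w 2^-1)).
  by case: (edge_nv x _ half); exact: vtx_of.
(* [q] is positive when the image is interior to the edge [ab], negative when it is off that edge,
   and zero only at the vertices [a] and [b]. As it has no zero for [0 < y < 1], it keeps its sign
   there. *)
pose q y := gc v w a y * gc v w b y - (1 - gc v w a y - gc v w b y).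
have q_cont : continuous q.
  move=> y; apply: (@continuousB _ R^o R (fun y => gc v w a y * gc v w b y)).
    by apply: (@continuousM _ _ (gc v w a) (gc v w b)); exact: gc_cont.
  apply: (@continuousB _ R^o R (fun y => 1 - gc v w a y)); last exact: gc_cont.
  by apply: (@continuousB _ R^o R (cst 1)); [exact: cvg_cst|exact: gc_cont].
have q_pos y : 0 < gc v w a y -> 0 < gc v w b y -> 0 < q y.
  move=> pa pb; have [e _] := crd_pair ab pa pb.
  by rewrite /q -addrA -opprD e subrr subr0 mulr_gt0.
have sum_le y c c' : c != c' -> gc v w c y + gc v w c' y <= 1.
  move=> cc; rewrite -(crd_sum (g (edge_pt v w y))) (bigD1 c) //= (bigD1 c') 1?eq_sym //=.
  by rewrite addrA lerDl sumr_ge0 // => j _; exact: crd_ge0.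
have q_neq0 y : 0 < y < 1 -> q y != 0.
  move=> y01; have [pa|pa] := ltP 0 (gc v w a y); last first.
    have a0 : gc v w a y = 0 by apply/eqP; rewrite eq_le pa crd_ge0.
    rewrite /q a0 mul0r sub0r subr0 oppr_eq0 subr_eq0; apply/eqP => /esym /vtx_of.
    exact: edge_nv.
  have [pb|pb] := ltP 0 (gc v w b y); first by rewrite gt_eqF ?q_pos.
  have b0 : gc v w b y = 0 by apply/eqP; rewrite eq_le pb crd_ge0.
  rewrite /q b0 mulr0 sub0r subr0 oppr_eq0 subr_eq0; apply/eqP => /esym /vtx_of.
  exact: edge_nv.
have q_gt0 y : 0 < y < 1 -> 0 < q y.
  move=> y01; rewrite ltNge; apply/negP => qy.
  have qh : 0 <= q 2^-1 by rewrite ltW // q_pos.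
  case/andP: half => h0 h1; case/andP: y01 => y0 y1.
  have [yh|yh] := leP y 2^-1.
    have [|c /andP [yc ch] qc] := @IVT_cont q y 2^-1 0 q_cont yh.
      by rewrite ge_min le_max qy qh orbT.
    have /q_neq0 : 0 < c < 1 by rewrite (lt_le_trans y0) // (le_lt_trans ch).
    by rewrite qc eqxx.
  have [|c /andP [hc cy] qc] := @IVT_cont q 2^-1 y 0 q_cont (ltW yh).
    by rewrite ge_min le_max qy qh orbT.
  have /q_neq0 : 0 < c < 1 by rewrite (lt_le_trans h0) // (le_lt_trans cy).
  by rewrite qc eqxx.
have z c y : c != a -> c != b -> 0 < y < 1 -> gc v w c y = 0.
  move=> ca cb y01; have qy := q_gt0 y y01; have sy := sum_le y a b ab.
  have ga0 : 0 <= gc v w a y := crd_ge0 _ _; have gb0 : 0 <= gc v w b y := crd_ge0 _ _.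
  have pab : 0 < gc v w a y * gc v w b y by move: qy sy; rewrite /q; lra.
  have pa : 0 < gc v w a y.
    by rewrite lt_neqAle ga0 andbT; apply/eqP => e; rewrite -e mul0r ltxx in pab.
  have pb : 0 < gc v w b y.
    by rewrite lt_neqAle gb0 andbT; apply/eqP => e; rewrite -e mulr0 ltxx in pab.
  by have [_ H] := crd_pair ab pa pb; exact: H.
have w1 : edge_pt v w 1 = vtx w.
  by apply: crd_inj => j; rewrite !crd_edge ?lexx ?ler01 // subrr mul0r add0r mul1r subr0 mul0r addr0 mul1r.
have g0 j : gc v w j 0 = (j == u)%:R by rewrite /gc vtx_edge gv crd_vtx.
have g1 j : gc v w j 1 = (j == u')%:R by rewrite /gc w1 gw crd_vtx.
(* Otherwise the coordinate [u] would fall from 1 at the start to 0 at the midpoint and be positive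
   in between, where only [a] and [b] are supported. *)
have uab : (u == a) || (u == b).
  apply: contraT; rewrite negb_or => /andP [ua ub].
  case/andP: (half) => h0 h1.
  have [|c /andP [c0 c1] gc_] := @IVT_cont (gc v w u) 0 2^-1 2^-1 (@gc_cont v w u) (ltW h0).
    by rewrite g0 eqxx (z u _ ua ub half) ge_min le_max (ltW h0) (ltW h1) orbT.
  have cn0 : c != 0 by apply/eqP => e; move: gc_ h1; rewrite e g0 eqxx => <-; rewrite ltxx.
  have c01 : 0 < c < 1 by rewrite lt_neqAle eq_sym cn0 c0 (le_lt_trans c1).
  move: gc_; rewrite z //.
  by move=> /esym e; move: h0; rewrite e ltxx.
have u'ab : (u' == a) || (u' == b).
  apply: contraT; rewrite negb_or => /andP [u'a u'b].
  case/andP: (half) => h0 h1.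
  have [|c /andP [c0 c1] gc_] := @IVT_cont (gc v w u') 2^-1 1 2^-1 (@gc_cont v w u') (ltW h1).
    by rewrite g1 eqxx (z u' _ u'a u'b half) ge_min le_max (ltW h0) (ltW h1) orbT.
  have cn1 : c != 1 by apply/eqP => e; move: gc_ h1; rewrite e g1 eqxx => <-; rewrite ltxx.
  have c01 : 0 < c < 1 by rewrite (lt_le_trans h0) // lt_neqAle cn1 c1.
  move: gc_; rewrite z //.
  by move=> /esym e; move: h0; rewrite e ltxx.
have uu' : u != u'.
  by apply/eqP => e; move: vw; rewrite -(inj_eq vtx_inj) -(inj_eq g_inj) gv gw e eqxx.
have [->|s0] := eqVneq s 0; first by rewrite g0 (negPf iu).
have [->|s1] := eqVneq s 1; first by rewrite g1 (negPf iu').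
have y01 : 0 < s < 1 by case/andP: s01 => h0 h1; rewrite !lt_neqAle h0 h1 eq_sym s0 s1.
by case/orP: uab uu' iu => /eqP ->; case/orP: u'ab iu' => /eqP ->; rewrite ?eqxx // => *; apply: z.
Qed.

End GraphSelfMaps.

(** * Singular chains in the 3-sphere *)

Section ContOn.
Variables (X Y Z : topologicalType).

Lemma cont_on_comp (C : set X) (D : set Y) (F : X -> Y) (G : Y -> Z) :
  cont_on C F -> (forall x, C x -> D (F x)) -> cont_on D G -> cont_on C (G \o F).
Proof.
move=> cF FD cG x Cx U /(cG _ (FD x Cx)) GU; have := cF x Cx _ GU.
rewrite /= !nbhs_simpl /=; apply: filterS2 (withinT C (nbhs_filter x)) => y Cy /=.
by apply; exact: FD.
Qed.

Lemma cont_on_sub (C D : set X) (F : X -> Y) : C `<=` D -> cont_on D F -> cont_on C F.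
Proof.
move=> CD cF x Cx U /(cF x (CD _ Cx)); rewrite /= !nbhs_simpl /= /within /=.
by apply: filterS => y H /CD; exact: H.
Qed.

Lemma continuous_cont_on (C : set X) (F : X -> Y) : continuous F -> cont_on C F.
Proof. by move=> cF x _; apply: cvg_within_filter; exact: cF. Qed.

End ContOn.

Section SubExt.
Variables (X Y : topologicalType) (A : set X) (y0 : Y) (F : set_type A -> Y).

Definition sub_pt x (a : A x) : set_type A := exist (fun y => y \in A) x (mem_set a).

(** Maps out of a [set_type] are extended by a constant, so that they can be applied to barycentres,
    which are computed in the ambient vector space. *)
Definition sub_ext (x : X) : Y :=
  if pselect (A x) is left a then F (sub_pt a) else y0.

Lemma sub_extE a : sub_ext (set_val a) = F a.
Proof.
rewrite /sub_ext; case: pselect => [b|]; last by case; exact: set_valP.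
by congr F; apply: val_inj.
Qed.

Lemma sub_ext_pt x (a : A x) : sub_ext x = F (sub_pt a).
Proof. by rewrite -(sub_extE (sub_pt a)). Qed.

Lemma sub_ext_cont : continuous F -> cont_on A sub_ext.
Proof.
move=> cF x Ax U; rewrite (sub_ext_pt Ax) => /cF [V [[B oB BV] Vx VU]].
rewrite /= nbhs_simpl /= /within /=.
rewrite /= in Vx.
have : nbhs x B by apply: open_nbhs_nbhs; split => //; rewrite -BV in Vx.
apply: filterS => y By Ay; rewrite /= (sub_ext_pt Ay); apply: VU.
by rewrite -BV.
Qed.

End SubExt.

(** Where [N] vanishes the bound [M] forces the limit 0; elsewhere rescaling to the level [N = 1] is
    continuous. *)
Lemma cone_ext_cont (R : realType) (W W' : normedModType R) (K : set W) (N : W -> R)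
    (F : W -> W') (M : R) :
  (forall x c, 0 < c -> K x -> K (c *: x)) -> continuous N ->
  (forall x c, 0 < c -> N (c *: x) = c * N x) -> (forall x, K x -> 0 <= N x) ->
  cont_on (K `&` [set x | N x = 1]) F -> (forall x, K x -> N x = 1 -> `|F x| <= M) ->
  cont_on K (fun x => N x *: F ((N x)^-1 *: x)).
Proof.
move=> KZ cN NZ N0 cF FM x Kx.
have [Nx|Nx] := ltP 0 (N x); last first.
  have {}Nx : N x = 0 by apply/eqP; rewrite eq_le Nx N0.
  rewrite Nx scale0r; apply/cvgrPdist_lt => e e0.
  have M0 : 0 < `|M| + 1 by rewrite ltr_wpDl.
  have e' : 0 < e / (`|M| + 1) by rewrite divr_gt0.
  have /cvgrPdist_lt/(_ _ e') := cN x; rewrite Nx.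
  rewrite near_withinE; apply: filterS => y Hy Ky.
  rewrite sub0r normrN normrZ; have [Ny|Ny] := ltP 0 (N y); last first.
    have -> : N y = 0 by apply/eqP; rewrite eq_le Ny N0.
    by rewrite normr0 mul0r.
  move: Hy; rewrite sub0r normrN ltr_pdivlMr // => Hy; apply: le_lt_trans Hy.
  rewrite ler_wpM2l //; apply: le_trans (FM _ _ _) _.
  - by apply: KZ => //; rewrite invr_gt0.
  - by rewrite NZ ?invr_gt0 // mulVf // gt_eqF.
  - by rewrite (le_trans (ler_norm M)) // lerDl.
apply: cvgZ; first by apply: cvg_within_filter; exact: cN.
have K1 : (K `&` [set x | N x = 1]) ((N x)^-1 *: x).
  by split; [apply: KZ; rewrite ?invr_gt0|rewrite /= NZ ?invr_gt0 // mulVf // gt_eqF].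
move=> U /(cF _ K1); rewrite /= !nbhs_simpl /= /within /= => HU.
have cn : (N y)^-1 *: y @[y --> x] --> (N x)^-1 *: x.
  by apply: cvgZ; [apply: cvgV; [rewrite gt_eqF|exact: cN]|exact: cvg_id].
have := cn _ HU; rewrite /= nbhs_simpl /=.
have NN : \forall y \near x, 0 < N y by apply: (cvgr_gt (N x)) => //; exact: cN.
apply: filterS2 NN => y Ny H Ky; apply: H; split.
  by apply: KZ; rewrite ?invr_gt0.
by rewrite /= NZ ?invr_gt0 // mulVf // gt_eqF.
Qed.

Lemma sum_continuous (R : realType) (T : topologicalType) (W : normedModType R)
    (I : Type) (r : seq I) (f : I -> T -> W) :
  (forall i, continuous (f i)) -> continuous (fun x => \sum_(i <- r) f i x).
Proof.
move=> cf; elim: r => [|i r IH].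
  have -> : (fun x => \sum_(i <- [::]) f i x) = cst 0 by apply/funext => x; rewrite big_nil.
  by move=> x; exact: cvg_cst.
have -> : (fun x => \sum_(j <- i :: r) f j x) = (fun x => f i x + \sum_(j <- r) f j x).
  by apply/funext => x; rewrite big_cons.
by move=> x; apply: cvgD; [exact: cf|exact: IH].
Qed.

Lemma bary_morph (R : realFieldType) (V W : lmodType R) (A : V -> W) v :
  (forall x y, A (x + y) = A x + A y) -> (forall c x, A (c *: x) = c *: A x) ->
  A (bary v) = bary (map A v).
Proof.
move=> AD AZ; rewrite /bary AZ size_map; congr (_ *: _).
elim: v => [|x v IH]; last by rewrite /= !big_cons AD IH.
by rewrite !big_nil -[in LHS](scale0r (0 : V)) AZ scale0r.
Qed.

Section Simplex.
Variable R : realType.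

Lemma simplex_compact n : compact (@simplex_set R n).
Proof.
have cI : compact [set v : 'rV[R]_n.+1 | forall i, `[0, 1]%classic (v ord0 i)].
  by apply: (@rV_compact R n.+1 (fun=> `[0, 1]%classic)) => i; exact: segment_compact.
apply: (subclosed_compact _ cI); last first.
  move=> x [x0 x1] i /=; rewrite in_itv /= x0 /= -x1 (bigD1 i) //= lerDl.
  by rewrite sumr_ge0.
have -> : @simplex_set R n =
   (\bigcap_(i in [set: 'I_n.+1]) [set x : 'rV[R]_n.+1 | 0 <= x 0 i]) `&`
   [set x : 'rV[R]_n.+1 | \sum_i x 0 i = 1].
  by apply/seteqP; split=> x [x0 x1]; split=> // i *; apply: x0.
apply: closedI.
  apply: closed_bigI => i _.
  have ci : {in ~` ((fun x : 'rV[R]_n.+1 => x 0 i) @^-1` [set y | 0 <= y]),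
      continuous (fun x : 'rV[R]_n.+1 => x 0 i)} by move=> x _; exact: coord_continuous.
  exact: (preimage_closed ci (@closed_ge R 0)).
have cs : {in ~` ((fun x : 'rV[R]_n.+1 => \sum_i x 0 i) @^-1` [set y | y = 1]),
    continuous (fun x : 'rV[R]_n.+1 => \sum_i x 0 i)}.
  by move=> x _; apply: (@sum_continuous _ _ R^o) => i; exact: coord_continuous.
exact: (preimage_closed cs (@closed_eq R 1)).
Qed.

Lemma simplex_bary_closed n : bary_closed (@simplex_set R n).
Proof.
move=> v v0 sv; have n0 : (0 : R) < (size v)%:R by rewrite ltr0n.
have E i : bary v 0 i = (size v)%:R^-1 * \sum_(x <- v) x 0 i.
  rewrite /bary mxE; congr (_ * _); elim: (v) => [|x w IH]; first by rewrite !big_nil mxE.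
  by rewrite !big_cons mxE IH.
split=> [i|].
  rewrite E mulr_ge0 ?invr_ge0 ?ler0n // big_seq sumr_ge0 // => x /sv [x0 _].
  exact: x0.
under eq_bigr do rewrite E.
rewrite -mulr_sumr exchange_big /= (eq_big_seq (fun=> 1)); last by move=> x /sv [].
by rewrite big_const_seq count_predT iter_addr_0 mulVf // gt_eqF.
Qed.

Definition evec n (i : nat) : 'rV[R]_n.+1 := delta_mx 0 (inord i).

Definition evecs n := [seq evec n i | i <- iota 0 n.+1].

Lemma evec_simplex n i : @simplex_set R n (evec n i).
Proof.
split=> [j|]; first by rewrite mxE ler0n.
rewrite (bigD1 (inord i)) //= big1 ?mxE ?eqxx ?addr0 // => j /negPf ji.
by rewrite mxE ji andbF.
Qed.

Lemma evecs_simplex n x : x \in evecs n -> @simplex_set R n x.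
Proof. by case/mapP => i _ ->; exact: evec_simplex. Qed.

Lemma coface_rowD n i (x y : 'rV[R]_n.+1) :
  coface_row i (x + y) = coface_row i x + coface_row i y.
Proof. by apply/rowP => j; rewrite !mxE; case: unlift => [k|]; rewrite ?mxE ?addr0. Qed.

Lemma coface_rowZ n i c (x : 'rV[R]_n.+1) : coface_row i (c *: x) = c *: coface_row i x.
Proof. by apply/rowP => j; rewrite !mxE; case: unlift => [k|]; rewrite ?mxE ?mulr0. Qed.

Lemma coface_row_evec n (i k : nat) : (i <= n.+1)%N -> (k <= n)%N ->
  coface_row (inord i) (evec n k) = evec n.+1 (bump i k).
Proof.
move=> ilen klen; apply/rowP => j; rewrite !mxE eqxx /=.
have bk : (bump i k < n.+2)%N by rewrite /bump; case: leqP; lia.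
have E : inord (bump i k) = lift (inord i) (inord k : 'I_n.+1) :> 'I_n.+2.
  by apply: val_inj; rewrite /= !inordK.
case: unliftP => [m ->|->].
  by rewrite mxE eqxx /= E (inj_eq lift_inj).
by rewrite E (negPf (neq_lift _ _)).
Qed.

Lemma cobd_evecs4 (t : seq 'rV[R]_5 -> int) :
  cobd t (evecs 4) = \sum_(i < 5) (-1) ^+ i * t (map (coface_row i) (evecs 3)).
Proof.
have -> : \sum_(i < 5) (-1) ^+ i * t (map (coface_row i) (evecs 3)) =
    \sum_(0 <= i < 5) (-1) ^+ i * t (map (coface_row (inord i)) (evecs 3)).
  by rewrite big_mkord; apply: eq_bigr => i _; rewrite inord_val.
rewrite unlock /= !coface_row_evec //= /bump /=; ring.
Qed.

End Simplex.

HB.instance Definition _ (R : nzRingType) (M : lmodType R) (K : choiceType) (f : K -> M) :=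
  GRing.isAdditive.Build {freeg K / R} M (fglift f) (lift_is_additive f).

Section SingularDegree.
Variable R : realType.
Local Notation S := (S3 R).

Lemma S3_neq0 (p : S) : set_val p != 0 :> 'rV[R]_4.
Proof.
apply/eqP => p0; have : \sum_i (set_val p : 'rV[R]_4) 0 i ^+ 2 = 1 := set_valP p.
rewrite p0 big1 => [/eqP|i _]; first by rewrite eq_sym oner_eq0.
by rewrite mxE expr0n.
Qed.

Definition simplex_ext n (s : continuousType (simplex R n) S) (x : 'rV[R]_n.+1) : 'rV[R]_4 :=
  sub_ext (0 : 'rV[R]_4) (fun a => set_val (s a)) x.

Lemma set_val_continuous (X : topologicalType) (A : set X) :
  continuous (set_val : set_type A -> X).
Proof. exact: initial_continuous. Qed.

Lemma simplex_ext_cont n (s : continuousType (simplex R n) S) :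
  cont_on (@simplex_set R n) (simplex_ext s).
Proof.
apply: sub_ext_cont => x; apply: continuous_comp; first exact: cts_fun.
exact: set_val_continuous.
Qed.

Lemma simplex_ext_fine n (s : continuousType (simplex R n) S) :
  exists d, fine_on d (@simplex_set R n) (simplex_ext s).
Proof.
apply: fine_on_compact; [exact: simplex_compact|exact: simplex_ext_cont|].
by move=> x sx; rewrite /simplex_ext (sub_ext_pt _ _ sx) S3_neq0.
Qed.

(** The number of crossings of the [k]-th subdivision of [s] with the half-line given by [t]: a
    stand-in for the degree class of the sphere. *)
Definition simplex_value k t (s : continuousType (simplex R 3) S) : int^o :=
  subdivk 3 k (fun w => winding (evalv t) 3 (map (simplex_ext s) w)) (evecs R 3).

Lemma simplex_ext_face n (s : continuousType (simplex R n.+1) S) i x :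
  @simplex_set R n x -> simplex_ext (face i s) x = simplex_ext s (coface_row i x).
Proof.
move=> sx; rewrite /simplex_ext (sub_ext_pt _ _ sx).
have sx' : @simplex_set R n.+1 (coface_row i x).
  by have /set_mem := coface_row_simplex i (sub_pt sx).
rewrite (sub_ext_pt _ _ sx') /face /=; congr (set_val (s _)).
by apply: val_inj.
Qed.

(** Coface maps are linear, so they commute with barycentres, and the sum over the faces is [cobd]
    on the standard 4-simplex, where [fine_cocycle] applies. *)
Lemma simplex_value_boundary (s : continuousType (simplex R 4) S) :
  exists K, forall k, (K <= k)%N -> forall t, distinct 4 t ->
  \sum_(i < 5) (-1) ^+ i * simplex_value k t (face i s) = 0.
Proof.
have [d dF] := simplex_ext_fine s.
have [K HK] := fine_cocycle (@simplex_bary_closed R 4) dF (erefl 5%N : size (evecs R 4) = 5%N)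
  (@evecs_simplex R 4).
exists K => k Kk t Dt; rewrite -[RHS](HK k Kk t Dt) cobd_evecs4.
apply: eq_bigr => i _; congr (_ * _).
rewrite subdivk_map; last first.
  by move=> v; apply: bary_morph; [exact: coface_rowD|exact: coface_rowZ].
apply: subdivk_eq => w wE; congr winding; rewrite -map_comp; apply/eq_in_map => x xw.
apply: simplex_ext_face.
exact: (subdivks_closed (@simplex_bary_closed R 3) (erefl _ : size (evecs R 3) = 4%N)
  (@evecs_simplex R 3) wE).
Qed.

Definition chain_value k t : singular_chain R 3 S -> int^o := fglift (simplex_value k t).

(** Each singular simplex needs its own mesh; the support of [w] is finite, so one bound serves them
    all. *)
Lemma chain_value_boundary (w : singular_chain R 4 S) :
  exists K, forall k, (K <= k)%N -> forall t, distinct 4 t -> chain_value k t (boundary w) = 0.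
Proof.
have [s sw|K HK] := @eventually_all _ (dom w) (fun s k => forall t, distinct 4 t ->
    \sum_(i < 5) (-1) ^+ i * simplex_value k t (face i s) = 0).
  exact: simplex_value_boundary.
exists K => k Kk t Dt; rewrite -[w in boundary w]freeg_sumE /boundary /chain_value.
rewrite 2!raddf_sum big1_seq // => s /andP [_ sw].
rewrite /= liftU -[coeff s w]intz scaler_int raddfMz raddf_sum /=.
rewrite (eq_bigr (fun i : 'I_5 => (-1) ^+ i * simplex_value k t (face i s))).
  by rewrite (HK k Kk s sw) // mul0rz.
by move=> i _; rewrite liftU.
Qed.

End SingularDegree.

(** * The Euclidean norm on [R^4] *)

Section EuclideanNorm.
Variable R : realType.
Local Notation W := 'rV[R]_4.

(** The norm of the matrix structure is the maximum norm; it serves for the mesh estimates, whereas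
    [S3] is the unit sphere of this one. *)
Definition enorm (p : W) : R := Num.sqrt (\sum_i p 0 i ^+ 2).

Lemma enorm_continuous : continuous enorm.
Proof.
move=> p; apply: (@continuous_comp _ _ _ (fun p : W => \sum_i p 0 i ^+ 2) Num.sqrt); last first.
  exact: sqrt_continuous.
apply: (@sum_continuous _ _ R^o) => i q.
apply: (@continuousM _ _ (fun p : W => p 0 i) (fun p : W => p 0 i)); exact: coord_continuous.
Qed.

Lemma enorm_ge0 p : 0 <= enorm p.
Proof. exact: sqrtr_ge0. Qed.

Lemma enormZ p c : 0 <= c -> enorm (c *: p) = c * enorm p.
Proof.
move=> c0; rewrite /enorm (eq_bigr (fun i => c ^+ 2 * p 0 i ^+ 2)); last first.
  by move=> i _; rewrite mxE exprMn.
by rewrite -mulr_sumr sqrtrM ?sqr_ge0 // sqrtr_sqr ger0_norm.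
Qed.

Lemma enorm_eq0 p : enorm p = 0 -> p = 0.
Proof.
move/eqP; rewrite /enorm sqrtr_eq0 => p0; apply/rowP => i; rewrite mxE.
have /eqP := le_anti (introT andP (conj p0 (sumr_ge0 _ (fun i _ => sqr_ge0 (p 0 i))))).
by rewrite psumr_eq0 => [/allP /(_ i)|j _]; rewrite ?sqr_ge0 // mem_index_enum => /(_ isT) /=;
  rewrite sqrf_eq0 => /eqP.
Qed.

Lemma enorm0 : enorm 0 = 0.
Proof. by rewrite -[X in enorm X](scale0r (0 : W)) enormZ // mul0r. Qed.

Lemma enorm_S3 p : S3_set p <-> enorm p = 1.
Proof.
rewrite /S3_set /enorm /=; split=> [->|e]; first exact: sqrtr1.
have s0 : 0 <= \sum_i p 0 i ^+ 2 by apply: sumr_ge0 => i _; exact: sqr_ge0.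
by rewrite -(sqr_sqrtr s0) e expr1n.
Qed.

Lemma S3_le1 (p : W) : S3_set p -> `|p| <= 1.
Proof.
rewrite /S3_set /= => p1; rewrite [leLHS]/Num.norm /= mx_normrE.
apply/bigmax_leP; split=> // -[i j] _ /=; rewrite ord1.
rewrite -(@ler_pXn2r _ 2) ?nnegrE // expr1n real_normK ?num_real // -p1.
by rewrite (bigD1 j) //= lerDl sumr_ge0 // => k _; exact: sqr_ge0.
Qed.

Lemma enorm_gt0 p : p != 0 -> 0 < enorm p.
Proof.
by move=> p0; rewrite lt_neqAle enorm_ge0 andbT eq_sym; apply: contra p0 => /eqP/enorm_eq0/eqP.
Qed.

Lemma S3_normalize p : p != 0 -> S3_set ((enorm p)^-1 *: p).
Proof.
move=> /enorm_gt0 p0; apply/enorm_S3.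
by rewrite enormZ ?invr_ge0 ?enorm_ge0 // mulVf // gt_eqF.
Qed.

End EuclideanNorm.

(** * Homogeneous extensions *)

Section Comb.
Variables (R : realType) (V : normedModType R).

Definition comb n (l : 'I_n.+1 -> V) (x : 'rV[R]_n.+1) : V := \sum_i x 0 i *: l i.

Lemma comb_bary n (l : 'I_n.+1 -> V) v : comb l (bary v) = bary (map (comb l) v).
Proof.
apply: bary_morph => [x y|c x]; rewrite /comb.
  by rewrite -big_split; apply: eq_bigr => i _; rewrite mxE scalerDl.
by rewrite scaler_sumr; apply: eq_bigr => i _; rewrite mxE scalerA.
Qed.

Lemma comb_evec n (l : 'I_n.+1 -> V) i : comb l (evec R n i) = l (inord i).
Proof.
rewrite /comb (bigD1 (inord i)) //= mxE !eqxx scale1r big1 ?addr0 // => j /negPf ji.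
by rewrite mxE ji andbF scale0r.
Qed.

Lemma comb_coface n (l : 'I_n.+2 -> V) (i : 'I_n.+2) x :
  comb l (coface_row i x) = comb (l \o lift i) x.
Proof.
rewrite /comb (bigD1_ord i) //= mxE unlift_none scale0r add0r.
by apply: eq_bigr => j _; rewrite mxE liftK.
Qed.

Lemma comb_continuous n (l : 'I_n.+1 -> V) : continuous (comb l).
Proof.
apply: sum_continuous => i x.
apply: (@cvgZ _ _ _ (nbhs x) _ (fun x => x 0 i) (fun=> l i)); last exact: cvg_cst.
exact: coord_continuous.
Qed.

Definition comb_hull n (l : 'I_n.+1 -> V) : set V := comb l @` @simplex_set R n.

Lemma comb_hull_compact n (l : 'I_n.+1 -> V) : compact (comb_hull l).
Proof.
apply: continuous_compact; last exact: simplex_compact.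
exact: continuous_subspaceT (@comb_continuous n l).
Qed.

Lemma comb_hull_closed n (l : 'I_n.+1 -> V) : bary_closed (comb_hull l).
Proof.
move=> v v0 vC.
have [u uv us] : exists2 u, map (comb l) u = v & forall x, x \in u -> @simplex_set R n x.
  elim: v vC {v0} => [|a v IH] vC; first by exists [::].
  have [|u uv us] := IH; first by move=> x xv; apply: vC; rewrite inE xv orbT.
  have [x xs xa] := vC a (mem_head _ _); exists (x :: u); first by rewrite /= xa uv.
  by move=> y; rewrite inE => /orP [/eqP -> //|/us].
rewrite -uv -comb_bary; exists (bary u) => //.
by apply: simplex_bary_closed => //; rewrite -uv size_map in v0.
Qed.

Lemma comb_hull_vertex n (l : 'I_n.+1 -> V) i : comb_hull l (l i).
Proof.
exists (evec R n i); first exact: evec_simplex.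
by rewrite comb_evec inord_val.
Qed.

End Comb.

(** * The cone over the graph in [R^7] *)

Section EdgeCones.
Variable R : realType.
Local Notation I := 'I_7.
Local Notation U := 'rV[R]_7.
Local Notation del i := (delta_mx 0 i : U).

(* [gcone] is the cone over the realization of [K_7], embedded in [R^7]. *)
Definition econe (v w : I) : set U :=
  [set x | exists a b, [/\ 0 <= a, 0 <= b & x = a *: del v + b *: del w]].

Definition gcone : set U := [set x | exists v w, econe v w x].

Definition total (x : U) : R := \sum_i x 0 i.

Lemma total_continuous : continuous total.
Proof. by apply: (@sum_continuous _ _ R^o) => i; exact: coord_continuous. Qed.

Lemma totalZ c x : total (c *: x) = c * total x.
Proof. by rewrite /total mulr_sumr; apply: eq_bigr => i _; rewrite mxE. Qed.

Lemma totalD x y : total (x + y) = total x + total y.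
Proof. by rewrite /total -big_split; apply: eq_bigr => i _; rewrite mxE. Qed.

Lemma total_del i : total (del i) = 1.
Proof.
rewrite /total (bigD1 i) //= mxE !eqxx big1 ?addr0 // => j /negPf ji.
by rewrite mxE ji andbF.
Qed.

Lemma econe_scale v w c x : 0 <= c -> econe v w x -> econe v w (c *: x).
Proof.
move=> c0 [a [b [a0 b0 ->]]]; exists (c * a), (c * b).
by rewrite !mulr_ge0 // scalerDr !scalerA.
Qed.

Lemma econe_add v w x y : econe v w x -> econe v w y -> econe v w (x + y).
Proof.
move=> [a [b [a0 b0 ->]]] [c [d [c0 d0 ->]]]; exists (a + c), (b + d).
by rewrite !addr_ge0 // !scalerDl addrACA.
Qed.

Lemma gcone_scale x c : 0 < c -> gcone x -> gcone (c *: x).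
Proof. by move=> c0 [v [w H]]; exists v, w; apply: econe_scale; rewrite // ltW. Qed.

Lemma econe_total v w x : econe v w x -> 0 <= total x.
Proof. by move=> [a [b [a0 b0 ->]]]; rewrite totalD !totalZ !total_del !mulr1 addr_ge0. Qed.

Lemma gcone_total_ge0 x : gcone x -> 0 <= total x.
Proof. by move=> [v [w /econe_total]]. Qed.

Lemma gcone_total_eq0 x : gcone x -> total x = 0 -> x = 0.
Proof.
move=> [v [w [a [b [a0 b0 ->]]]]]; rewrite totalD !totalZ !total_del !mulr1 => ab.
have -> : a = 0 by lra.
have -> : b = 0 by lra.
by rewrite !scale0r addr0.
Qed.

Lemma econe_ge0 v w x i : econe v w x -> 0 <= x 0 i.
Proof. by move=> [a [b [a0 b0 ->]]]; rewrite !mxE addr_ge0 // mulr_ge0 ?ler0n. Qed.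

Lemma econe_supp v w x i : econe v w x -> x 0 i != 0 -> i = v \/ i = w.
Proof.
move=> [a [b [a0 b0 ->]]]; rewrite !mxE !eqxx /=.
case: (i =P v) => [->|_]; first by left.
case: (i =P w) => [->|_]; first by right.
by rewrite !mulr0 addr0 eqxx.
Qed.

Definition row_fun (x : U) : I -> R := fun i => x 0 i.

Lemma row_fun_continuous : continuous (row_fun : U -> {ptws I -> R}).
Proof.
move=> x; apply/cvg_sup => [|i]; first exact/fmap_filter/(nbhs_filter x).
move: x.
apply: (@continuous_comp_initial _ _ _ (fun g : I -> R => g i) row_fun).
exact: coord_continuous.
Qed.

Lemma row_fun_realization x : gcone x -> total x = 1 ->
  @realization_set R (complete_graph 7) (row_fun x).
Proof.
move=> [v [w xvw]] x1; split=> // [i|]; first exact: econe_ge0 xvw.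
exists v, w; split; first by have [->|vw] := eqVneq v w; [left|right].
by move=> u; exact: econe_supp.
Qed.

Definition fun_row (g : I -> R) : U := \sum_i g i *: del i.

Lemma fun_rowE g i : fun_row g 0 i = g i.
Proof.
rewrite /fun_row summxE (bigD1 i) //= !mxE !eqxx mulr1 big1 ?addr0 // => j /negPf ji.
by rewrite !mxE [i == j]eq_sym ji andbF mulr0.
Qed.

Lemma fun_rowK : cancel fun_row row_fun.
Proof. by move=> g; apply/funext => i; rewrite /row_fun fun_rowE. Qed.

Lemma fun_row_econe v w (g : I -> R) : (forall i, 0 <= g i) ->
  (forall i, i != v -> i != w -> g i = 0) -> econe v w (fun_row g).
Proof.
move=> g0 gz; have [vw|vw] := eqVneq v w.
  exists (g v), 0; split=> //; apply/rowP => i; rewrite fun_rowE !mxE !eqxx mul0r addr0.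
  by have [->|iv] := eqVneq i v; rewrite ?mulr1 // gz // -?vw // mulr0.
exists (g v), (g w); split=> //; apply/rowP => i; rewrite fun_rowE !mxE !eqxx.
have [->|iv] := eqVneq i v; first by rewrite (negPf vw) mulr1 mulr0 addr0.
have [->|iw] := eqVneq i w; first by rewrite mulr0 add0r mulr1.
by rewrite gz // !mulr0 addr0.
Qed.

End EdgeCones.

Section ConeExtensions.
Variable R : realType.
Local Notation I := 'I_7.
Local Notation U := 'rV[R]_7.
Local Notation W := 'rV[R]_4.
Local Notation X := (realization R (complete_graph 7)).
Local Notation S := (S3 R).
Local Notation del i := (delta_mx 0 i : U).

(** Homogeneity absorbs the join parameter: a point of the join of two edges is a pair of cone
    points whose totals add up to one, and at either end of the join one of the two values must
    shrink to zero continuously. *)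
Definition gcone_ext (Y : normedModType R) (F : X -> Y) (x : U) : Y :=
  total x *: sub_ext (0 : Y) F (row_fun ((total x)^-1 *: x)).

Lemma gcone_ext_eq0 (Y : normedModType R) (F : X -> Y) x : total x = 0 -> gcone_ext F x = 0.
Proof. by rewrite /gcone_ext => ->; rewrite scale0r. Qed.

Lemma gcone_ext_pt (Y : normedModType R) (F : X -> Y) x : gcone x -> 0 < total x ->
  exists a : X, (forall i, x 0 i = total x * crd a i) /\ gcone_ext F x = total x *: F a.
Proof.
move=> gx tx; have H : @realization_set R (complete_graph 7) (row_fun ((total x)^-1 *: x)).
  apply: row_fun_realization; first by apply: gcone_scale => //; rewrite invr_gt0.
  by rewrite totalZ mulVf // gt_eqF.
exists (sub_pt H); split; last by rewrite /gcone_ext (sub_ext_pt _ _ H).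
by move=> i; rewrite /crd -[set_val _]/(row_fun _) /row_fun mxE mulVKf // gt_eqF.
Qed.

Lemma gcone_ext_cont (Y : normedModType R) (F : X -> Y) (M : R) : continuous F ->
  (forall a, `|F a| <= M) -> cont_on (@gcone R) (gcone_ext F).
Proof.
move=> cF FM; apply: (@cone_ext_cont _ _ _ _ (@total R) (fun x => sub_ext (0 : Y) F (row_fun x)) M).
- by move=> x c; exact: gcone_scale.
- exact: total_continuous.
- by move=> x c _; rewrite totalZ.
- exact: gcone_total_ge0.
- apply: (@cont_on_comp U {ptws I -> R} Y _ (@realization_set R (complete_graph 7))
    (@row_fun R) (sub_ext (0 : Y) F)).
  + exact/continuous_cont_on/row_fun_continuous.
  + by move=> x [gx x1]; exact: row_fun_realization.
  + exact: sub_ext_cont.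
- by move=> x gx x1; rewrite (sub_ext_pt _ _ (row_fun_realization gx x1)).
Qed.

Variables (f : X -> S) (h : S -> S) (g : X -> X).
Hypotheses (f_cont : continuous f) (f_inj : injective f).
Hypotheses (h_cont : continuous h) (h_inj : injective h).
Hypotheses (g_cont : continuous g) (fg : forall a, f (g a) = h (f a)).

Definition fhat := gcone_ext (fun a => set_val (f a) : W).

Definition ghat := gcone_ext (fun a => fun_row (crd (g a))).

Definition hhat (p : W) : W :=
  enorm p *: sub_ext (0 : W) (fun a : S => set_val (h a) : W) ((enorm p)^-1 *: p).

Lemma S3_val (a : S) : S3_set (set_val a : W).
Proof. exact: set_valP. Qed.

Lemma enorm_val (a : S) : enorm (set_val a : W) = 1.
Proof. by apply/enorm_S3; exact: S3_val. Qed.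

Lemma fhat_cont : cont_on (@gcone R) fhat.
Proof.
apply: (@gcone_ext_cont _ _ 1); last by move=> a; exact/S3_le1/S3_val.
by move=> a; apply: continuous_comp; [exact: f_cont|exact: set_val_continuous].
Qed.

Lemma ghat_cont : cont_on (@gcone R) ghat.
Proof.
apply: (@gcone_ext_cont _ _ (\sum_i `|del i|)).
  rewrite /fun_row; apply: sum_continuous => i a.
  apply: (@cvgZ _ _ _ (nbhs a) _ (fun a => crd (g a) i) (fun=> del i)); last exact: cvg_cst.
  have cga := @g_cont a; have ccr := @crd_continuous R 7 i (g a).
  exact: (@continuous_comp X X R g (fun b => crd b i) a cga ccr).
move=> a; apply: le_trans (ler_norm_sum _ _ _) _; apply: ler_sum => i _.
rewrite normrZ ler_piMl // ger0_norm ?crd_ge0 // -(crd_sum (g a)) (bigD1 i) //= lerDl.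
by rewrite sumr_ge0 // => j _; exact: crd_ge0.
Qed.

Lemma hhat_cont : continuous hhat.
Proof.
suff H : cont_on setT hhat.
  by move=> p Q /(H p Logic.I) ; rewrite /= !nbhs_simpl /= /within /=; apply: filterS => q; apply.
apply: (@cone_ext_cont _ _ _ _ (@enorm R) (sub_ext (0 : W) (fun a : S => set_val (h a) : W)) 1) => //.
- exact: enorm_continuous.
- by move=> p c c0; rewrite enormZ // ltW.
- by move=> p _; exact: enorm_ge0.
- apply: (@cont_on_sub _ _ _ (@S3_set R)); first by move=> p [_ /enorm_S3].
  apply: sub_ext_cont => a.
  by apply: continuous_comp; [exact: h_cont|exact: set_val_continuous].
- by move=> p _ /enorm_S3 Sp; rewrite (sub_ext_pt _ _ Sp); exact/S3_le1/S3_val.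
Qed.

Lemma hhat_scale c (a : S) : 0 <= c -> hhat (c *: set_val a) = c *: set_val (h a).
Proof.
rewrite le_eqVlt => /orP [/eqP <-|c0].
  by rewrite /hhat !scale0r enorm0 scale0r.
rewrite /hhat enormZ ?ltW // enorm_val mulr1 scalerA mulVf ?gt_eqF // scale1r.
by rewrite sub_extE.
Qed.

Lemma hhat_polar (p : W) : p != 0 -> exists a : S, p = enorm p *: set_val a.
Proof.
move=> p0; exists (sub_pt (S3_normalize p0)).
by rewrite -[set_val _]/(_ *: _) scalerA mulfV ?scale1r // gt_eqF // enorm_gt0.
Qed.

Lemma hhat0 : hhat 0 = 0.
Proof. by rewrite /hhat enorm0 scale0r. Qed.

Lemma enorm_hhat p : enorm (hhat p) = enorm p.
Proof.
have [->|/hhat_polar [a ->]] := eqVneq p 0; first by rewrite hhat0.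
by rewrite hhat_scale ?enorm_ge0 // !enormZ ?enorm_ge0 // !enorm_val.
Qed.

Lemma hhat_inj : injective hhat.
Proof.
move=> p q pq; have e : enorm p = enorm q by rewrite -enorm_hhat pq enorm_hhat.
have [p0|/[dup] /enorm_gt0 np /hhat_polar [a pE]] := eqVneq p 0.
  by rewrite p0; apply/esym/enorm_eq0; rewrite -e p0 enorm0.
have /hhat_polar [b qE] : q != 0.
  by apply/eqP => q0; move: np; rewrite e q0 enorm0 ltxx.
move: pq; rewrite pE qE !hhat_scale ?enorm_ge0 // -e => /(scalerI (lt0r_neq0 np)).
by move=> /val_inj/h_inj ->.
Qed.

Lemma fhat_pt x : gcone x -> 0 < total x -> exists a : X,
  (forall i, x 0 i = total x * crd a i) /\ fhat x = total x *: set_val (f a).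
Proof. exact: gcone_ext_pt. Qed.

Lemma ghat_pt x : gcone x -> 0 < total x -> exists a : X,
  (forall i, x 0 i = total x * crd a i) /\ ghat x = total x *: fun_row (crd (g a)).
Proof. exact: gcone_ext_pt. Qed.

Lemma enorm_fhat x : gcone x -> enorm (fhat x) = total x.
Proof.
move=> gx; have := gcone_total_ge0 gx; rewrite le_eqVlt => /orP [/eqP x0|x0].
  by rewrite /fhat gcone_ext_eq0 -?x0 // enorm0.
have [a [_ ->]] := fhat_pt gx x0.
by rewrite enormZ ?(ltW x0) // enorm_val mulr1.
Qed.

Lemma fhat_inj x y : gcone x -> gcone y -> fhat x = fhat y -> x = y.
Proof.
move=> gx gy xy; have e : total x = total y by rewrite -!enorm_fhat // xy.
have := gcone_total_ge0 gx; rewrite le_eqVlt => /orP [/eqP x0|x0].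
  have -> : x = 0 by exact: gcone_total_eq0.
  by apply/esym/gcone_total_eq0; rewrite // -e.
have y0 : 0 < total y by rewrite -e.
have [a [xa xE]] := fhat_pt gx x0.
have [b [yb yE]] := fhat_pt gy y0.
move: xy; rewrite xE yE -e => /(scalerI (lt0r_neq0 x0)) /val_inj /f_inj ab.
by apply/rowP => i; rewrite xa yb ab e.
Qed.

Lemma total_fun_row a : total (fun_row (crd (a : X))) = 1.
Proof. by rewrite -(crd_sum a) /total; apply: eq_bigr => i _; rewrite fun_rowE. Qed.

Lemma fhat_fun_row c (a : X) : 0 <= c -> fhat (c *: fun_row (crd a)) = c *: set_val (f a).
Proof.
rewrite le_eqVlt => /orP [/eqP <-|c0].
  by rewrite !scale0r /fhat gcone_ext_eq0 // -[X in total X](scale0r (0 : U)) totalZ mul0r.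
rewrite /fhat /gcone_ext totalZ total_fun_row mulr1 scalerA mulVf ?gt_eqF // scale1r.
congr (_ *: _); rewrite -(sub_extE (0 : W) (fun a => set_val (f a) : W) a).
by congr sub_ext; rewrite fun_rowK.
Qed.

Lemma hhat_fhat x : gcone x -> hhat (fhat x) = fhat (ghat x).
Proof.
move=> gx; have := gcone_total_ge0 gx; rewrite le_eqVlt => /orP [/eqP x0|x0].
  rewrite /ghat gcone_ext_eq0 -?x0 // /fhat !gcone_ext_eq0 -?x0 ?hhat0 //.
  by rewrite -[X in total X](scale0r (0 : U)) totalZ mul0r.
have [a [xa xE]] := fhat_pt gx x0.
have [b [xb xE']] := ghat_pt gx x0.
have ab : a = b.
  by apply: crd_inj => i; apply: (mulfI (lt0r_neq0 x0)); rewrite -xa -xb.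
by rewrite xE xE' hhat_scale ?fhat_fun_row ?(ltW x0) // -ab fg.
Qed.

End ConeExtensions.

Section ContOnAlgebra.
Variables (R : realType) (X : topologicalType) (W : normedModType R) (C : set X).
Implicit Types (F G : X -> W).

Lemma cont_onB F G : cont_on C F -> cont_on C G -> cont_on C (fun x => F x - G x).
Proof. by move=> cF cG x Cx; apply: cvgB; [exact: cF|exact: cG]. Qed.

Lemma cont_onD F G : cont_on C F -> cont_on C G -> cont_on C (fun x => F x + G x).
Proof. by move=> cF cG x Cx; apply: cvgD; [exact: cF|exact: cG]. Qed.

Lemma cont_onZ (k : X -> R) F : cont_on C k -> cont_on C F -> cont_on C (fun x => k x *: F x).
Proof. by move=> ck cF x Cx; apply: cvgZ; [exact: ck|exact: cF]. Qed.

End ContOnAlgebra.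

(** * The join of two triangles as a singular cycle *)

Section Quads.
Variable R : realType.
Local Notation I := 'I_7.
Local Notation U := 'rV[R]_7.
Local Notation W := 'rV[R]_4.
Local Notation V := (U * U)%type.
Local Notation del i := (delta_mx 0 i : U).

Definition jpt (b : bool) (i : I) : V := if b then (del i, 0) else (0, del i).

Definition jsw (p : V) : V := (p.2, p.1).

Definition jlist n (s : seq V) : 'I_n.+1 -> V := fun i => nth 0 s i.

Definition jquad v0 v1 w0 w1 : seq V := [:: jpt true v0; jpt true v1; jpt false w0; jpt false w1].

Definition jhull v0 v1 w0 w1 : set V := comb_hull (@jlist 3 (jquad v0 v1 w0 w1)).

Lemma jsw_bary v : jsw (bary v) = bary (map jsw v).
Proof. exact: bary_morph. Qed.

Lemma jsw_pt b i : jsw (jpt b i) = jpt (~~ b) i.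
Proof. by case: b. Qed.

Lemma jhull_pt v0 v1 w0 w1 : [/\ jhull v0 v1 w0 w1 (jpt true v0),
  jhull v0 v1 w0 w1 (jpt true v1), jhull v0 v1 w0 w1 (jpt false w0) &
  jhull v0 v1 w0 w1 (jpt false w1)].
Proof.
have H (i : 'I_4) := comb_hull_vertex (@jlist 3 (jquad v0 v1 w0 w1)) i.
by split; [exact: (H (@Ordinal 4 0 isT))|exact: (H (@Ordinal 4 1 isT))|
  exact: (H (@Ordinal 4 2 isT))|exact: (H (@Ordinal 4 3 isT))].
Qed.

Lemma jhull_mem v0 v1 w0 w1 p : jhull v0 v1 w0 w1 p ->
  [/\ econe v0 v1 p.1, econe w0 w1 p.2 & total p.1 + total p.2 = 1].
Proof.
move=> [x [x0 x1] <-]; rewrite /comb !big_ord_recl big_ord0 /jlist /=.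
rewrite ?scaler0 ?addr0 ?add0r.
split; [by exists (x 0 ord0), (x 0 (lift ord0 ord0))| |].
  by eexists; eexists; split; last reflexivity.
by rewrite !totalD !totalZ !total_del !mulr1 -[RHS]x1 !big_ord_recl big_ord0 addr0 !addrA.
Qed.

(** A common value would be supported on two disjoint edges, hence be 0, while the two totals add up
    to 1. *)
Lemma jhull_neq v0 v1 w0 w1 p : uniq [:: v0; v1; w0; w1] -> jhull v0 v1 w0 w1 p -> p.1 <> p.2.
Proof.
rewrite /= !inE !negb_or => /and4P [/and3P [_ a b] /andP [c d] _ _].
move=> /jhull_mem [e1 e2 t] e; rewrite -e in e2 t.
have : p.1 = 0.
  apply/rowP => i; rewrite mxE; apply/eqP/negPn/negP => /[dup] /(econe_supp e1) H1 /(econe_supp e2) H2.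
  by case: H1 H2 a b c d => -> [] ->; rewrite ?eqxx.
by move=> p0; move: t; rewrite p0 -(scale0r (0 : U)) totalZ mul0r addr0 => /esym/eqP; rewrite oner_eq0.
Qed.

Definition unit_itv : set R := [set a : R | 0 <= a <= 1].

Definition wquadF (F : V -> W) := wquad F jpt.

Definition quads9 a b c x y z : seq (I * I * I * I) :=
  [:: (a, b, x, y); (a, b, y, z); (a, b, z, x); (b, c, x, y); (b, c, y, z); (b, c, z, x);
      (c, a, x, y); (c, a, y, z); (c, a, z, x)].

Lemma linking_quads9 (s : I -> I -> I -> I -> int) a b c x y z :
  linking s a b c x y z =
  \sum_(q <- quads9 a b c x y z) s q.1.1.1 q.1.1.2 q.1.2 q.2.
Proof. by rewrite /linking !big_cons big_nil /=; ring. Qed.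

Lemma quads9_uniq a b c x y z q : uniq [:: a; b; c; x; y; z] -> q \in quads9 a b c x y z ->
  uniq [:: q.1.1.1; q.1.1.2; q.1.2; q.2].
Proof.
rewrite /= !inE !negb_or -!andbA.
move=> /and5P [ab ac ax ay] /and5P [az bc bx bY] /and5P [bz cx cy cz] /and4P [xy xz yz _].
by do 8?[case/orP]; move/eqP => -> /=; rewrite ?inE ?negb_or ?(eq_sym c a) ?(eq_sym z x)
  ?ab ?ac ?ax ?ay ?az ?bc ?bx ?bY ?bz ?cx ?cy ?cz ?xy ?xz ?yz.
Qed.

(** One [N] is taken for all nine quads: the correction is then the coboundary of a single cochain,
    and [linking_cobd] removes it. *)
Lemma linking_homotopy (F : R -> V -> W) a b c x y z : uniq [:: a; b; c; x; y; z] ->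
  (forall v0 v1 w0 w1, uniq [:: v0; v1; w0; w1] ->
    cont_on (unit_itv `*` jhull v0 v1 w0 w1) (fun p : R * V => F p.1 p.2) /\
    (forall s p, unit_itv s -> jhull v0 v1 w0 w1 p -> F s p != 0)) ->
  exists K, forall k, (K <= k)%N -> forall t, distinct 4 t ->
    linking (wquadF (F 1) t k) a b c x y z = linking (wquadF (F 0) t k) a b c x y z.
Proof.
move=> u HF; pose C (q : I * I * I * I) := jhull q.1.1.1 q.1.1.2 q.1.2 q.2.
have [q qs|N HN] := @eventually_all _ (quads9 a b c x y z)
    (fun q N => (0 < N)%N -> fine_homotopy (C q) N%:R^-1 F).
  have uq := quads9_uniq u qs; have [cF F0] := HF _ _ _ _ uq.
  have [|||d [d0 Hd]] := @fine_homotopy_compact _ _ (C q) F => //.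
    exact: comb_hull_compact.
  exists (Num.trunc d^-1).+1 => N dN N0; split; first by rewrite invr_gt0 ltr0n.
  have Nd : N%:R^-1 <= d.
    rewrite invf_ple ?posrE ?ltr0n //; apply: le_trans (ltW (truncnS_gt _)) _.
    by rewrite ler_nat.
  by move=> p p' s s' Cp Cp' s1 s1' pp ss; apply: Hd => //; exact: le_trans Nd.
have [q qs|K HK] := @eventually_all _ (quads9 a b c x y z) (fun q k => forall t, distinct 4 t ->
    let w3 := winding (evalv t) 3 in let v := jquad q.1.1.1 q.1.1.2 q.1.2 q.2 in
    subdivk 3 k (fun w => w3 (map (F 1) w)) v - subdivk 3 k (fun w => w3 (map (F 0) w)) v
    = cobd (subdivk 2 k (prism_sum N.+1 F w3)) v).
  apply: (@fine_homotopy_cobd _ _ (C q) (N.+1%:R^-1)) => //.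
  - exact: comb_hull_closed.
  - exact: HN.
  - have [? ? ? ?] := jhull_pt q.1.1.1 q.1.1.2 q.1.2 q.2.
    by move=> p; rewrite !inE => /or4P [] /eqP ->.
exists K => k Kk t Dt; apply/eqP; rewrite -subr_eq0; apply/eqP.
rewrite -[RHS](linking_cobd (jpt true) (jpt false)
  (subdivk 2 k (prism_sum N.+1 F (winding (evalv t) 3))) a b c x y z).
rewrite !linking_quads9 -sumrB; apply: eq_big_seq => q qs.
exact: (HK k Kk q qs t Dt).
Qed.

End Quads.

Lemma cobd4 (V : Type) (t : seq V -> int) p0 p1 p2 p3 (s := [:: p0; p1; p2; p3]) :
  cobd t s = \sum_(i < 4) (-1) ^+ i * t (take i s ++ drop i.+1 s).
Proof. by rewrite !big_ord_recl big_ord0 /= /bump /=; ring. Qed.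

Section JoinChain.
Variable R : realType.
Local Notation I := 'I_7.
Local Notation U := 'rV[R]_7.
Local Notation W := 'rV[R]_4.
Local Notation V := (U * U)%type.
Local Notation X := (realization R (complete_graph 7)).
Local Notation S := (S3 R).

Variable f : X -> S.
Hypotheses (f_cont : continuous f) (f_inj : injective f).

(* [join_map] realises the simplex spanned by two disjoint edges [e] and [e'] as
   the join of [f e] and [- f e']. *)
Definition join_map (p : V) : W := fhat f p.1 - fhat f p.2.

Lemma join_map_sw p : join_map (jsw p) = - join_map p.
Proof. by rewrite /join_map opprB. Qed.

Lemma jhull_gcone v0 v1 w0 w1 p : jhull v0 v1 w0 w1 (p : V) -> gcone p.1 /\ gcone p.2.
Proof. by move=> /jhull_mem [e1 e2 _]; split; [exists v0, v1|exists w0, w1]. Qed.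

Lemma jhull_fhat_neq v0 v1 w0 w1 p : uniq [:: v0; v1; w0; w1] -> jhull v0 v1 w0 w1 p ->
  fhat f p.1 != fhat f p.2.
Proof.
move=> u /[dup] /jhull_gcone [g1 g2] /(jhull_neq u) ne.
by apply/eqP => /(fhat_inj f_inj g1 g2).
Qed.

Lemma join_map_neq0 v0 v1 w0 w1 p : uniq [:: v0; v1; w0; w1] -> jhull v0 v1 w0 w1 p ->
  join_map p != 0.
Proof. by move=> u Hp; rewrite subr_eq0; exact: jhull_fhat_neq Hp. Qed.

Lemma fst_cont_on (C : set V) : cont_on C (fun p : V => p.1).
Proof. by apply: continuous_cont_on => p; exact: cvg_fst. Qed.

Lemma snd_cont_on (C : set V) : cont_on C (fun p : V => p.2).
Proof. by apply: continuous_cont_on => p; exact: cvg_snd. Qed.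

Lemma join_map_cont v0 v1 w0 w1 : cont_on (jhull v0 v1 w0 w1) join_map.
Proof.
apply: cont_onB.
  apply: (@cont_on_comp V U W _ (@gcone R) (fun p => p.1) (fhat f)); first exact: fst_cont_on.
    by move=> p /jhull_gcone [].
  exact: fhat_cont.
apply: (@cont_on_comp V U W _ (@gcone R) (fun p => p.2) (fhat f)); first exact: snd_cont_on.
  by move=> p /jhull_gcone [].
exact: fhat_cont.
Qed.

Lemma join_map_fine v0 v1 w0 w1 : uniq [:: v0; v1; w0; w1] ->
  exists d, fine_on d (jhull v0 v1 w0 w1) join_map.
Proof.
move=> u; apply: fine_on_compact; first exact: comb_hull_compact.
  exact: join_map_cont.
by move=> p; exact: join_map_neq0.
Qed.

Definition to_S3 (p : W) : S :=
  if pselect (p != 0) is left H then sub_pt (S3_normalize H) else f (vtx R ord0).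

Lemma to_S3E p : p != 0 -> set_val (to_S3 p) = (enorm p)^-1 *: p.
Proof. by move=> p0; rewrite /to_S3; case: pselect. Qed.

Definition join_simplex_map n (l : 'I_n.+1 -> V) (x : simplex R n) : S :=
  to_S3 (join_map (comb l (set_val x))).

Lemma join_simplex_map_cont n (l : 'I_n.+1 -> V) :
  cont_on (comb_hull l) join_map -> (forall p, comb_hull l p -> join_map p != 0) ->
  continuous (join_simplex_map l).
Proof.
move=> cJ J0; apply: continuous_comp_initial.
have Hl (x : simplex R n) : comb_hull l (comb l (set_val x)).
  by exists (set_val x) => //; exact: set_valP.
have c1 : cont_on [set: simplex R n] (fun x => join_map (comb l (set_val x))).
  apply: (@cont_on_comp _ V W _ (comb_hull l) (fun x : simplex R n => comb l (set_val x))) => //.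
  apply: continuous_cont_on => x; apply: continuous_comp; first exact: set_val_continuous.
  exact: comb_continuous.
have E : set_val \o join_simplex_map l = (fun x : simplex R n =>
    (enorm (join_map (comb l (set_val x))))^-1 *: join_map (comb l (set_val x))).
  by apply/funext => x; rewrite /= to_S3E // J0.
rewrite E => x.
have c2 : continuous (fun x : simplex R n => join_map (comb l (set_val x))).
  move=> y Q /(c1 y Logic.I); rewrite /= !nbhs_simpl /= /within /=.
  by apply: filterS => z; apply.
apply: (@cvgZ _ _ _ (nbhs x) _ (fun x : simplex R n =>
  (enorm (join_map (comb l (set_val x))))^-1)); last exact: c2.
apply: (@cvgV _ _ (nbhs x) _ (fun x : simplex R n => enorm (join_map (comb l (set_val x))))).
  by rewrite gt_eqF // enorm_gt0 // J0.
apply: (@continuous_comp _ _ _ (fun x : simplex R n => join_map (comb l (set_val x))) (@enorm R)).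
  exact: c2.
exact: enorm_continuous.
Qed.

Definition mk_continuous (Y Z : topologicalType) (F : Y -> Z) (c : continuous F) :
  continuousType Y Z := HB.pack_for (continuousType Y Z) F (isContinuous.Build Y Z F c).

(** A constant map is the fallback, so that chains can be written down before continuity is proved;
    it holds for quads of distinct vertices and passes to their faces. *)
Definition join_sing n (l : 'I_n.+1 -> V) : continuousType (simplex R n) S :=
  if pselect (continuous (join_simplex_map l)) is left c then mk_continuous c
  else cst (f (vtx R ord0)).

Lemma join_singE n (l : 'I_n.+1 -> V) x : continuous (join_simplex_map l) ->
  join_sing l x = join_simplex_map l x.
Proof. by move=> c; rewrite /join_sing; case: pselect. Qed.

Lemma join_sing_face n (l : 'I_n.+2 -> V) (i : 'I_n.+2) : continuous (join_simplex_map l) ->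
  face i (join_sing l) = join_sing (l \o lift i).
Proof.
move=> c; have E x : join_simplex_map (l \o lift i) x = join_simplex_map l (coface i x).
  by rewrite /join_simplex_map -comb_coface.
have c' : continuous (join_simplex_map (l \o lift i)).
  have -> : join_simplex_map (l \o lift i) = join_simplex_map l \o coface i.
    by apply/funext => x; rewrite E.
  by move=> x; apply: continuous_comp; [exact: coface_continuous|exact: c].
by apply/continuousEP => x; rewrite /face /= !join_singE // E.
Qed.

Definition join_tri (s : seq V) := join_sing (@jlist R 2 s).
Definition join_quad v0 v1 w0 w1 := join_sing (@jlist R 3 (jquad R v0 v1 w0 w1)).

Lemma join_quad_cont v0 v1 w0 w1 : uniq [:: v0; v1; w0; w1] ->
  continuous (join_simplex_map (@jlist R 3 (jquad R v0 v1 w0 w1))).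
Proof.
move=> u; apply: join_simplex_map_cont; first exact: join_map_cont.
by move=> p; exact: join_map_neq0.
Qed.

Lemma jlist_lift (s : seq V) (i : 'I_4) : size s = 4%N ->
  @jlist R 3 s \o lift i = @jlist R 2 (take i s ++ drop i.+1 s).
Proof.
move=> s4; apply/funext => j; rewrite /jlist /=.
rewrite nth_cat size_take s4 ltn_ord /bump nth_drop; case: ltnP => ij.
  by rewrite nth_take // add0n.
by congr nth; rewrite add1n; lia.
Qed.

Definition link_chain a b c x y z : singular_chain R 3 S :=
  \sum_(q <- quads9 a b c x y z) << join_quad q.1.1.1 q.1.1.2 q.1.2 q.2 >>.

(** The coefficient of a singular simplex [s] in the boundary is [linking] of the coboundary of the
    indicator of [s], which is zero by [linking_cobd]. *)
Lemma link_chain_cycle a b c x y z : uniq [:: a; b; c; x; y; z] ->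
  boundary (link_chain a b c x y z) = 0.
Proof.
move=> u; apply/eqP/freeg_eqP => s; rewrite coeff0.
rewrite /boundary /link_chain raddf_sum raddf_sum /=.
pose t (l : seq V) : int := (join_tri l == s)%:R.
rewrite -[RHS](linking_cobd (jpt R true) (jpt R false) t a b c x y z) linking_quads9.
apply: eq_big_seq => q qs; rewrite liftU scale1r raddf_sum /=.
have uq := quads9_uniq u qs; have cq := join_quad_cont uq.
have E (i : 'I_4) : coeff s << (-1) ^+ i *g face i (join_quad q.1.1.1 q.1.1.2 q.1.2 q.2) >> =
    (-1) ^+ i * t (take i (jquad R q.1.1.1 q.1.1.2 q.1.2 q.2) ++
                   drop i.+1 (jquad R q.1.1.1 q.1.1.2 q.1.2 q.2)).
  by rewrite coeffU /join_quad (join_sing_face _ cq) jlist_lift.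
by rewrite (eq_bigr _ (fun i _ => E i)); exact/esym/cobd4.
Qed.

Lemma jquad_evecs v0 v1 w0 w1 :
  map (comb (@jlist R 3 (jquad R v0 v1 w0 w1))) (evecs R 3) = jquad R v0 v1 w0 w1.
Proof. by rewrite /= !comb_evec /jlist !inordK. Qed.

(** A positive factor depending on the point changes no crossing, so the normalisation to the sphere
    can be undone. *)
Lemma simplex_value_join (F : V -> W) k t (s : continuousType (simplex R 3) S) v0 v1 w0 w1 :
  (forall x, exists2 c : R, 0 < c &
     set_val (s x) = c *: F (comb (@jlist R 3 (jquad R v0 v1 w0 w1)) (set_val x))) ->
  simplex_value k t s = wquadF F t k v0 v1 w0 w1.
Proof.
move=> H; rewrite /wquadF /wquad /wchain -/(jquad R v0 v1 w0 w1) -jquad_evecs.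
rewrite subdivk_map; last by move=> v; exact: comb_bary.
set l := @jlist R 3 _; rewrite /simplex_value.
(* The hypothesis yields a factor at each point of the simplex only; elsewhere any choice will
   do. *)
pose c x := xget (1 : R) [set c | 0 < c /\ simplex_ext s x = c *: F (comb l x)].
have cP x : @simplex_set R 3 x -> 0 < c x /\ simplex_ext s x = c x *: F (comb l x).
  move=> sx; have [e e0 E] := H (sub_pt sx).
  apply: (@xgetPex _ (1 : R) [set c | 0 < c /\ simplex_ext s x = c *: F (comb l x)]).
  by exists e; split=> //; rewrite /simplex_ext (sub_ext_pt _ _ sx).
apply: subdivk_eq => w wE.
have sw x : x \in w -> @simplex_set R 3 x.
  exact: (subdivks_closed (@simplex_bary_closed R 3) (erefl _ : size (evecs R 3) = 4%N)
    (@evecs_simplex R 3) wE).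
rewrite -map_comp -(@winding_scale _ _ _ _ _ (F \o comb l) c); last by move=> x /sw /cP [].
by congr winding; apply/eq_in_map => x /sw /cP [].
Qed.

End JoinChain.

(** * Effect of an orientation-reversing homeomorphism *)

Section Reversal.
Variable R : realType.
Local Notation I := 'I_7.
Local Notation U := 'rV[R]_7.
Local Notation W := 'rV[R]_4.
Local Notation V := (U * U)%type.
Local Notation X := (realization R (complete_graph 7)).
Local Notation S := (S3 R).
Local Notation del i := (delta_mx 0 i : U).

Variables (f : X -> S) (h : continuousType S S) (g : X -> X) (phi : I -> I).
Hypotheses (f_cont : continuous f) (f_inj : injective f) (h_inj : injective h).
Hypotheses (g_cont : continuous g) (fg : forall a, f (g a) = h (f a)).
Hypotheses (phi_inj : injective phi).
Hypothesis g_edge : forall (v w : I) (a : X), v != w ->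
  (forall i, i != v -> i != w -> crd a i = 0) ->
  forall i, i != phi v -> i != phi w -> crd (g a) i = 0.

Lemma wquadF_eq (F F' : V -> W) t k v0 v1 w0 w1 :
  (forall p, jhull v0 v1 w0 w1 p -> F p = F' p) ->
  wquadF F t k v0 v1 w0 w1 = wquadF F' t k v0 v1 w0 w1.
Proof.
move=> FF; apply: subdivk_eq => w wE; congr winding; apply/eq_in_map => p pw; apply: FF.
apply: (subdivks_closed (@comb_hull_closed _ _ _ _) (erefl _ : size (jquad R v0 v1 w0 w1) = 4%N) _ wE) pw.
have [? ? ? ?] := jhull_pt R v0 v1 w0 w1.
by move=> q; rewrite !inE => /or4P [] /eqP ->.
Qed.

Lemma linking_wquadF_eq (F F' : V -> W) t k a b c x y z : uniq [:: a; b; c; x; y; z] ->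
  (forall v0 v1 w0 w1 p, uniq [:: v0; v1; w0; w1] -> jhull v0 v1 w0 w1 p -> F p = F' p) ->
  linking (wquadF F t k) a b c x y z = linking (wquadF F' t k) a b c x y z.
Proof.
move=> u FF; rewrite !linking_quads9; apply: eq_big_seq => q /(quads9_uniq u) uq.
by apply: wquadF_eq => p; exact: FF.
Qed.

Lemma chain_value_link k t a b c x y z : uniq [:: a; b; c; x; y; z] ->
  chain_value k t (link_chain f a b c x y z) = linking (wquadF (join_map f) t k) a b c x y z.
Proof.
move=> u; rewrite linking_quads9 /chain_value raddf_sum; apply: eq_big_seq => q qs.
have uq := quads9_uniq u qs; rewrite /= liftU scale1r.
apply: simplex_value_join => s.
have Hp : jhull q.1.1.1 q.1.1.2 q.1.2 q.2
    (comb (@jlist R 3 (jquad R q.1.1.1 q.1.1.2 q.1.2 q.2)) (set_val s)).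
  by exists (set_val s) => //; exact: set_valP.
have J0 := join_map_neq0 f_inj uq Hp.
exists (enorm (join_map f (comb (@jlist R 3 (jquad R q.1.1.1 q.1.1.2 q.1.2 q.2)) (set_val s))))^-1.
  by rewrite invr_gt0 enorm_gt0.
by rewrite join_singE ?to_S3E //; exact: join_quad_cont.
Qed.

Lemma chain_value_push k t a b c x y z : uniq [:: a; b; c; x; y; z] ->
  chain_value k t (chain_map h (link_chain f a b c x y z)) =
  linking (wquadF (hhat h \o join_map f) t k) a b c x y z.
Proof.
move=> u; rewrite linking_quads9 /chain_value /chain_map !raddf_sum /=.
apply: eq_big_seq => q qs.
have uq := quads9_uniq u qs; rewrite liftU scale1r liftU scale1r.
apply: simplex_value_join => s.
set p := comb _ _.
have Hp : jhull q.1.1.1 q.1.1.2 q.1.2 q.2 p.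
  by exists (set_val s) => //; exact: set_valP.
have J0 := join_map_neq0 f_inj uq Hp.
exists (enorm (join_map f p))^-1; first by rewrite invr_gt0 enorm_gt0.
rewrite /push /= join_singE; last exact: join_quad_cont.
have E : join_map f p = enorm (join_map f p) *: set_val (to_S3 f (join_map f p)).
  by rewrite to_S3E // scalerA mulfV ?scale1r // gt_eqF // enorm_gt0.
rewrite [in X in _ = _ *: X]E hhat_scale ?enorm_ge0 // scalerA mulVf ?scale1r //.
by rewrite gt_eqF // enorm_gt0.
Qed.

(** The hypothesis on [h], applied to the cycle [link_chain], gives a 4-chain bounded by the sum of
    the cycle and its image; on a boundary the crossing number is 0 once the subdivision is fine. *)
Lemma reversing_linking a b c x y z : orientation_reversing h ->
  uniq [:: a; b; c; x; y; z] ->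
  exists K, forall k, (K <= k)%N -> forall t, distinct 4 t ->
    linking (wquadF (hhat h \o join_map f) t k) a b c x y z =
    - linking (wquadF (join_map f) t k) a b c x y z.
Proof.
move=> rev u; have [w wE] := rev _ (link_chain_cycle f_cont f_inj u).
have [K HK] := chain_value_boundary w; exists K => k Kk t Dt.
have D (A B : singular_chain R 3 S) :
    chain_value k t (A + B) = chain_value k t A + chain_value k t B by exact: raddfD.
have := HK k Kk t Dt; rewrite wE D chain_value_push // chain_value_link // => /eqP.
by rewrite addr_eq0 => /eqP.
Qed.

(* Deforms [hhat (x - y)] into [hhat x - hhat y]; a zero would give
   [x - s y = (1 - s) y], that is, [x = y]. *)
Definition push_homotopy (s : R) (p : V) : W :=
  hhat h (fhat f p.1 - s *: fhat f p.2) - hhat h ((1 - s) *: fhat f p.2).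

Lemma comp_cont_on (Y : topologicalType) (A B : normedModType R) (C : set Y)
    (F : Y -> A) (G : A -> B) : continuous G -> cont_on C F -> cont_on C (fun y => G (F y)).
Proof.
move=> cG cF; apply: (@cont_on_comp Y A B C setT F G) => //.
exact: continuous_cont_on.
Qed.

Lemma fst_cont_on' (C : set (R * V)) : cont_on C (fun q : R * V => q.1).
Proof. by apply: continuous_cont_on => q; exact: cvg_fst. Qed.

Lemma fhat_fst_cont v0 v1 w0 w1 :
  cont_on (@unit_itv R `*` jhull v0 v1 w0 w1) (fun q : R * V => fhat f q.2.1).
Proof.
apply: (@cont_on_comp (R * V)%type V W _ (jhull v0 v1 w0 w1) (fun q => q.2) (fun p => fhat f p.1)).
- by apply: continuous_cont_on => q; exact: cvg_snd.
- by move=> q [].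
apply: (@cont_on_comp V U W _ (@gcone R) (fun p => p.1) (fhat f)); first exact: fst_cont_on.
  by move=> p /jhull_gcone [].
exact: fhat_cont.
Qed.

Lemma fhat_snd_cont v0 v1 w0 w1 :
  cont_on (@unit_itv R `*` jhull v0 v1 w0 w1) (fun q : R * V => fhat f q.2.2).
Proof.
apply: (@cont_on_comp (R * V)%type V W _ (jhull v0 v1 w0 w1) (fun q => q.2) (fun p => fhat f p.2)).
- by apply: continuous_cont_on => q; exact: cvg_snd.
- by move=> q [].
apply: (@cont_on_comp V U W _ (@gcone R) (fun p => p.2) (fhat f)); first exact: snd_cont_on.
  by move=> p /jhull_gcone [].
exact: fhat_cont.
Qed.

Lemma push_homotopy_linking a b c x y z : uniq [:: a; b; c; x; y; z] ->
  exists K, forall k, (K <= k)%N -> forall t, distinct 4 t ->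
    linking (wquadF (push_homotopy 1) t k) a b c x y z =
    linking (wquadF (push_homotopy 0) t k) a b c x y z.
Proof.
move=> u; apply: linking_homotopy => // v0 v1 w0 w1 uq; split.
  have c1 := @fst_cont_on' (@unit_itv R `*` jhull v0 v1 w0 w1).
  have cf1 := @fhat_fst_cont v0 v1 w0 w1; have cf2 := @fhat_snd_cont v0 v1 w0 w1.
  have ch : continuous (hhat h) by apply: hhat_cont; exact: cts_fun.
  apply: cont_onB; apply: (comp_cont_on ch).
    by apply: cont_onB => //; exact: cont_onZ.
  apply: cont_onZ => //; apply: (@cont_onB _ _ R^o) => //.
  by apply: continuous_cont_on => q; exact: cvg_cst.
move=> s p s1 Hp; rewrite subr_eq0; apply/eqP => /(hhat_inj h_inj) /eqP.
rewrite subr_eq scalerBl scale1r subrK.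
exact/negP/(jhull_fhat_neq f_inj uq Hp).
Qed.

Definition vertex_push (x : U) : U := \sum_i x 0 i *: del (phi i).

Definition edge_homotopy_map (s : R) (x : U) : U :=
  (1 - s) *: ghat g x + s *: vertex_push x.

(* Straightens the self-map [g] on each edge, from [fhat x - fhat y] composed with [g] to
   its composite with the simplicial map [phi]. *)
Definition edge_homotopy (s : R) (p : V) : W :=
  fhat f (edge_homotopy_map s p.1) - fhat f (edge_homotopy_map s p.2).

Lemma vertex_push_lin (c d : R) x y :
  vertex_push (c *: x + d *: y) = c *: vertex_push x + d *: vertex_push y.
Proof.
rewrite /vertex_push !scaler_sumr -big_split; apply: eq_bigr => i _.
by rewrite !mxE scalerDl !scalerA.
Qed.

Lemma vertex_push_del i : vertex_push (del i) = del (phi i).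
Proof.
rewrite /vertex_push (bigD1 i) //= mxE !eqxx scale1r big1 ?addr0 // => j /negPf ji.
by rewrite mxE ji andbF scale0r.
Qed.

Lemma vertex_push_econe v w x : econe v w x -> econe (phi v) (phi w) (vertex_push x).
Proof.
by move=> [a [b [a0 b0 ->]]]; rewrite vertex_push_lin !vertex_push_del; exists a, b.
Qed.

Lemma total_vertex_push v w x : econe v w x -> total (vertex_push x) = total x.
Proof.
move=> [a [b [a0 b0 ->]]].
by rewrite vertex_push_lin !vertex_push_del !totalD !totalZ !total_del.
Qed.

Lemma total_eq0_of_0 : total (0 : U) = 0.
Proof. by rewrite -(scale0r (0 : U)) totalZ mul0r. Qed.

Lemma ghat_econe v w x : v != w -> econe v w x ->
  econe (phi v) (phi w) (ghat g x) /\ total (ghat g x) = total x.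
Proof.
move=> vw ex; have gx : gcone x by exists v, w.
have := gcone_total_ge0 gx; rewrite le_eqVlt => /orP [/eqP x0|x0].
  rewrite /ghat gcone_ext_eq0 -?x0 // total_eq0_of_0; split=> //.
  by exists 0, 0; rewrite !scale0r addr0.
have [a [xa ->]] := ghat_pt g gx x0.
rewrite totalZ total_fun_row mulr1; split=> //.
apply: econe_scale; first exact: ltW.
apply: fun_row_econe; first exact: crd_ge0.
apply: g_edge => // i iv iw; apply/eqP/negPn/negP => ai.
have /(econe_supp ex) : x 0 i != 0 by rewrite xa mulf_neq0 // gt_eqF.
by case=> /eqP; rewrite ?(negPf iv) ?(negPf iw).
Qed.

Lemma edge_homotopy_map_econe s v w x : 0 <= s <= 1 -> v != w -> econe v w x ->
  econe (phi v) (phi w) (edge_homotopy_map s x) /\ total (edge_homotopy_map s x) = total x.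
Proof.
move=> /andP [s0 s1] vw ex; have [e t] := ghat_econe vw ex; split.
  apply: econe_add; apply: econe_scale; rewrite ?subr_ge0 //.
  exact: vertex_push_econe.
rewrite totalD (totalZ (1 - s)) t (totalZ s) (total_vertex_push ex); ring.
Qed.

Lemma econe_disjoint v0 v1 w0 w1 (x : U) : uniq [:: v0; v1; w0; w1] ->
  econe v0 v1 x -> econe w0 w1 x -> x = 0.
Proof.
rewrite /= !inE !negb_or => /and4P [/and3P [_ a b] /andP [c d] _ _] e1 e2.
apply/rowP => i; rewrite mxE; apply/eqP/negPn/negP => /[dup] /(econe_supp e1) H1 /(econe_supp e2) H2.
by case: H1 H2 a b c d => -> [] ->; rewrite ?eqxx.
Qed.

(** Both [ghat] and the linear map [vertex_push] send the cone over an edge into the convex cone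
    over its image edge and keep the total. The segment between them stays there, so disjoint edges
    keep distinct images under [fhat]. *)
Lemma edge_homotopy_linking a b c x y z : uniq [:: a; b; c; x; y; z] ->
  exists K, forall k, (K <= k)%N -> forall t, distinct 4 t ->
    linking (wquadF (edge_homotopy 1) t k) a b c x y z =
    linking (wquadF (edge_homotopy 0) t k) a b c x y z.
Proof.
move=> u; apply: linking_homotopy => // v0 v1 w0 w1 uq.
have [v01 w01] : v0 != v1 /\ w0 != w1.
  by move: uq; rewrite /= !inE !negb_or => /and4P [/and3P [? _ _] _ ? _].
have mapE s p : unit_itv s -> jhull v0 v1 w0 w1 p ->
    [/\ econe (phi v0) (phi v1) (edge_homotopy_map s p.1),
        econe (phi w0) (phi w1) (edge_homotopy_map s p.2),
        total (edge_homotopy_map s p.1) = total p.1 &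
        total (edge_homotopy_map s p.2) = total p.2].
  move=> s1 /jhull_mem [e1 e2 _].
  by have [? ?] := edge_homotopy_map_econe s1 v01 e1; have [? ?] := edge_homotopy_map_econe s1 w01 e2.
split; last first.
  move=> s p s1 Hp; have [e1 e2 t1 t2] := mapE s p s1 Hp.
  rewrite subr_eq0; apply/eqP => /(fhat_inj f_inj) E.
  have {}E : edge_homotopy_map s p.1 = edge_homotopy_map s p.2.
    by apply: E; [exists (phi v0), (phi v1)|exists (phi w0), (phi w1)].
  have uq' : uniq [:: phi v0; phi v1; phi w0; phi w1].
    by rewrite -[X in uniq X]/(map phi [:: v0; v1; w0; w1]) map_inj_uniq.
  have z1 : edge_homotopy_map s p.1 = 0 by apply: (econe_disjoint uq') => //; rewrite E.
  have [_ _] := jhull_mem Hp; rewrite -t1 -t2 -E z1 total_eq0_of_0 addr0 => /esym/eqP.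
  by rewrite oner_eq0.
pose D : set (R * V) := @unit_itv R `*` @jhull R v0 v1 w0 w1.
have side (pr : V -> U) (pr_cont : continuous pr)
    (Hpr : forall s p, unit_itv s -> jhull v0 v1 w0 w1 p -> gcone (pr p) /\ gcone (edge_homotopy_map s (pr p))) :
    cont_on D (fun q : R * V => fhat f (edge_homotopy_map q.1 (pr q.2))).
  apply: (@cont_on_comp (R * V)%type U W D (@gcone R)
    (fun q => edge_homotopy_map q.1 (pr q.2)) (fhat f)); last exact: fhat_cont.
    have c1 := @fst_cont_on' D.
    have cp : continuous (fun q : R * V => pr q.2).
      by move=> q; apply: (@continuous_comp _ _ _ (fun q : R * V => q.2) pr); [exact: cvg_snd|exact: pr_cont].
    apply: cont_onD; apply: cont_onZ => //.
    - apply: (@cont_onB _ _ R^o) => //.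
      by apply: continuous_cont_on => q; exact: cvg_cst.
    - apply: (@cont_on_comp (R * V)%type U U D (@gcone R) (fun q => pr q.2) (ghat g)).
      + exact: continuous_cont_on.
      + by move=> [s p] [/= s1 Hp]; have [] := Hpr s p s1 Hp.
      + exact: ghat_cont.
    - apply: (@comp_cont_on _ U U); last exact: continuous_cont_on.
      apply: sum_continuous => i p.
      apply: (@cvgZ _ _ _ (nbhs p) _ (fun p : U => p 0 i) (fun=> del (phi i))); last exact: cvg_cst.
      exact: coord_continuous.
  by move=> [s p] [/= s1 Hp]; have [] := Hpr s p s1 Hp.
apply: cont_onB; apply: side.
- by move=> p; exact: cvg_fst.
- move=> s p s1 Hp; have [g1 _] := jhull_gcone Hp; have [e _ _ _] := mapE s p s1 Hp.
  by split=> //; exists (phi v0), (phi v1).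
- by move=> p; exact: cvg_snd.
- move=> s p s1 Hp; have [_ g2] := jhull_gcone Hp; have [_ e _ _] := mapE s p s1 Hp.
  by split=> //; exists (phi w0), (phi w1).
Qed.

(** At the end of the homotopy the map is [join_map f] after a linear map that permutes the vertices
    by [phi], and linear maps commute with subdivision. *)
Lemma wquadF_vertex_push t k v0 v1 w0 w1 :
  wquadF (edge_homotopy 1) t k v0 v1 w0 w1 =
  wquadF (join_map f) t k (phi v0) (phi v1) (phi w0) (phi w1).
Proof.
pose A (p : V) : V := (vertex_push p.1, vertex_push p.2).
have vp0 : vertex_push 0 = 0.
  by have := vertex_push_lin 0 0 0 0; rewrite !scale0r addr0.
rewrite /wquadF /wquad /wchain.
have -> : [:: jpt R true (phi v0); jpt R true (phi v1); jpt R false (phi w0); jpt R false (phi w1)] =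
    map A (jquad R v0 v1 w0 w1).
  by rewrite /= /A /= !vertex_push_del vp0.
rewrite (@subdivk_map _ _ _ A); last first.
  move=> v; apply: bary_morph => [p q|c p].
    congr pair; [have := vertex_push_lin 1 1 p.1 q.1|have := vertex_push_lin 1 1 p.2 q.2];
    by rewrite !scale1r.
  by congr pair; [have := vertex_push_lin c 0 p.1 0|have := vertex_push_lin c 0 p.2 0];
    rewrite !scale0r !addr0.
congr (subdivk 3 k _ _); apply/funext => w; congr winding.
rewrite -map_comp; apply: eq_map => p.
by rewrite /edge_homotopy /edge_homotopy_map subrr !scale0r !add0r !scale1r.
Qed.

(** The two homotopies meet at their parameter 0, where [hhat_fhat] identifies them; the far end of
    one is the image pair of triangles, that of the other is [hhat h] after the join map. *)
Lemma linking_antisymmetric a b c x y z : orientation_reversing h ->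
  uniq [:: a; b; c; x; y; z] ->
  exists K, forall k, (K <= k)%N -> forall t, distinct 4 t ->
    linking (wquadF (join_map f) t k) (phi a) (phi b) (phi c) (phi x) (phi y) (phi z) =
    - linking (wquadF (join_map f) t k) a b c x y z.
Proof.
move=> rev u.
have [K1 H1] := reversing_linking rev u.
have [K2 H2] := push_homotopy_linking u.
have [K3 H3] := edge_homotopy_linking u.
exists (maxn K1 (maxn K2 K3)) => k; rewrite !geq_max => /and3P [k1 k2 k3] t Dt.
rewrite -(H1 k k1 t Dt).
transitivity (linking (wquadF (edge_homotopy 1) t k) a b c x y z).
  by rewrite /linking !wquadF_vertex_push.
rewrite (H3 k k3 t Dt).
transitivity (linking (wquadF (push_homotopy 0) t k) a b c x y z).
  apply: linking_wquadF_eq => // v0 v1 w0 w1 p uq Hp; have [g1 g2] := jhull_gcone Hp.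
  rewrite /edge_homotopy /edge_homotopy_map /push_homotopy subr0 !scale0r !addr0 !scale1r subr0.
  by rewrite !(hhat_fhat fg).
rewrite -(H2 k k2 t Dt); apply: linking_wquadF_eq => // v0 v1 w0 w1 p uq Hp.
by rewrite /push_homotopy subrr scale0r hhat0 subr0 scale1r.
Qed.

End Reversal.

(** * The induced graph automorphism and the contradiction *)

Section SelfMap.
Variables (R : realType) (n : nat).
Local Notation I := 'I_n.
Local Notation X := (realization R (complete_graph n)).

(** [g] is [h] transported along [f]. Open sets of the graph are preimages under [f], so continuity
    of [g] reduces to that of [h] after [f]. *)
Lemma self_map_of_homeomorphism (Y : topologicalType) (f : X -> Y) (h : continuousType Y Y) :
  embedding f -> injective h -> h @` range f = range f ->
  exists g : X -> X, [/\ continuous g, injective g & forall a, f (g a) = h (f a)].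
Proof.
move=> [f_inj f_cont f_emb] h_inj hf.
have /choice [g fg] (a : X) : exists b, f b = h (f a).
  have : range f (h (f a)) by rewrite -hf; exists (f a) => //; exists a.
  by case=> b _ <-; exists b.
exists g; split=> //.
  apply/continuousP => U /f_emb [V oV <-].
  rewrite (_ : _ @^-1` _ = f @^-1` (h @^-1` V)).
    have /continuousP f_op := f_cont; have /continuousP h_op := @cts_fun _ _ h.
    exact/f_op/h_op.
  by apply/funext => a; rewrite /preimage /= fg.
by move=> a b /(congr1 f); rewrite !fg => /h_inj /f_inj.
Qed.

Variable g : X -> X.
Hypotheses (n_gt3 : (3 < n)%N) (g_cont : continuous g) (g_inj : injective g).

Lemma edge_support_point v w (a : X) : v != w ->
  (forall i, i != v -> i != w -> crd a i = 0) ->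
  a = edge_pt v w (crd a w) /\ 0 <= crd a w <= 1.
Proof.
move=> vw a0; have := crd_sum a.
rewrite (bigD1 v) //= (bigD1 w) 1?eq_sym //= big1 ?addr0; last first.
  by move=> i /andP [iv iw]; exact: a0.
move=> E; have w01 : 0 <= crd a w <= 1.
  by rewrite crd_ge0 -E lerDr crd_ge0.
have v1 : 1 - crd a w = crd a v by lra.
split=> //; apply: crd_inj => i; rewrite crd_edge // v1.
have [->|iv] := eqVneq i v; first by rewrite (negPf vw) mulr1 mulr0 addr0.
have [->|iw] := eqVneq i w; first by rewrite mulr1 mulr0 add0r.
by rewrite !mulr0 addr0 a0.
Qed.

Lemma self_map_graph_automorphism : exists phi : I -> I, injective phi /\
  forall v w (a : X), v != w -> (forall i, i != v -> i != w -> crd a i = 0) ->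
  forall i, i != phi v -> i != phi w -> crd (g a) i = 0.
Proof.
have [phi phiP] := choice (fun v => vertex_to_vertex g_cont g_inj v n_gt3).
exists phi; split.
  move=> v w e; have /g_inj /(congr1 (fun a : X => crd a v)) : g (vtx R v) = g (vtx R w) by rewrite !phiP e.
  by rewrite !crd_vtx eqxx; case: eqVneq => // _ /eqP; rewrite oner_eq0.
move=> v w a vw a0 i iv iw; have [aE w01] := edge_support_point vw a0.
rewrite aE; exact: (edge_to_edge g_cont g_inj n_gt3 vw (phiP v) (phiP w) w01 iv iw).
Qed.

End SelfMap.

Theorem theorem3p4 (R : realType) : intrinsically_chiral R (complete_graph 7).
Proof.
move=> f f_emb _ [h [[h' [hK _]] rev hf]].
have h_inj : injective h := can_inj hK.
have [f_inj f_cont _] := f_emb.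
have [g [g_cont g_inj fg]] := self_map_of_homeomorphism f_emb h_inj hf.
have [phi [phi_inj g_edge]] := self_map_graph_automorphism (isT : (3 < 7)%N) g_cont g_inj.
have C_closed v0 v1 w0 w1 : bary_closed (@jhull R v0 v1 w0 w1) by exact: comb_hull_closed.
have [K1 H1] := exists_good_flag C_closed (jhull_pt R) (join_map_fine f_cont f_inj).
(* One bound for all sextuples, since a single choice of [k] and [t] must serve every relation of
   the final contradiction. *)
have [[[[[[a b] c] x] y] z] _|K2 H2] := @eventually_all _ (enum {: 'I_7 * 'I_7 * 'I_7 * 'I_7 * 'I_7 * 'I_7})
    (fun '(a, b, c, x, y, z) k => forall t, distinct 4 t -> uniq [:: a; b; c; x; y; z] ->
      linking (wquadF (join_map f) t k) (phi a) (phi b) (phi c) (phi x) (phi y) (phi z) =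
      - linking (wquadF (join_map f) t k) a b c x y z).
  case: (boolP (uniq [:: a; b; c; x; y; z])) => u; last by exists 0%N.
  have [K HK] := linking_antisymmetric f_cont f_inj h_inj g_cont fg phi_inj g_edge rev u.
  by exists K => k Kk t Dt _; exact: HK.
(* At least one subdivision, which makes the cochains alternating. *)
pose k := maxn 1 (maxn K1 K2).
have k0 : (0 < k)%N by rewrite leq_max.
have [|t [Dt Gt]] := H1 k; first by rewrite !leq_max leqnn orbT.
have k2 : (K2 <= k)%N by rewrite !leq_max leqnn !orbT.
apply: (@no_antisymmetric_linking (wquadF (join_map f) t k) phi phi_inj).
- by move=> v0 v1 w0 w1; exact: wquad_swap1.
- by move=> v0 v1 w0 w1; exact: wquad_swap2.
- exact: (linking_sym (@jsw_bary R) (@join_map_sw R f) (@jsw_pt R) k0 Gt).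
- move=> a a_inj.
  rewrite -[RHS](deleted_join_parity_wquad (@jsw_bary R) (@join_map_sw R f) (@jsw_pt R) k0 Gt a_inj).
  apply: eq_big_seq => l lq.
  have /allP /(_ l lq) : all (fun l => [&& size l == 4, nth 0 l 0 < 5, nth 0 l 1 < 5,
     5 <= nth 0 l 2 < 10 & 5 <= nth 0 l 3 < 10])%N deleted_join_quads by [].
  case: l {lq} => [|i0 [|i1 [|i2 [|i3 []]]]] //= /and4P [l0 l1 /andP [l2 l2'] /andP [l3 l3']].
  have m i : (5 <= i < 10)%N -> (i %% 5 = i - 5)%N.
    by move=> /andP [i5 i10]; rewrite -{1}(subnK i5) modnDr modn_small // ltn_subLR.
  rewrite l0 l1 !(modn_small l0) !(modn_small l1) !m ?l2 ?l3 //.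
  by rewrite (leq_gtF l2) (leq_gtF l3).
- by move=> a b c x y z; apply: (H2 k k2 (a, b, c, x, y, z)) => //; rewrite mem_enum.
Qed.
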